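(* Every invariant function on $\mathrm{M}_2$ (i.e. every element of $H^0(\mathrm{M}_2,\mathcal{O}_{\mathrm{M}_2})=H^0(\mathrm{Rat}_2,\mathcal{O}_{\mathrm{Rat}_2})^{\mathrm{SL}_2}$), including in particular each $\sigma_i^{(n)}$ with $n\ge1$ and $1\le i\le\nu_n$, is a polynomial in $\mathbb{Z}[\sigma_1,\sigma_2]$.
   Context: Let $A_2=\mathbb{Z}[a_0,a_1,a_2,b_0,b_1,b_2]$, $F_a=a_0X^2+a_1XY+a_2Y^2$, $F_b=b_0X^2+b_1XY+b_2Y^2$, $\rho=\operatorname{Res}(F_a,F_b)$, and $\mathrm{Rat}_2=\operatorname{Proj}A_2\setminus\{\rho=0\}\subset\mathbb{P}^5_{\mathbb{Z}}$, with coordinate ring $A_2[\rho^{-1}]_{(0)}$ (homogeneous elements of degree $0$). $\mathrm{SL}_2$ acts on $\mathrm{Rat}_2$ by conjugation $\varphi^f=f^{-1}\circ\varphi\circ f$ of rational maps $\varphi=[F_a,F_b]$: for $f=\begin{pmatrix}\alpha&\beta\\ \gamma&\delta\end{pmatrix}$, $\varphi^f=[\delta F_a-\beta F_b,\,-\gamma F_a+\alpha F_b]$ with $F_a,F_b$ evaluated at $(\alpha X+\beta Y,\gamma X+\delta Y)$. $\mathrm{M}_2=\mathrm{Rat}_2/\mathrm{SL}_2=\operatorname{Spec}(A_2[\rho^{-1}]_{(0)})^{\mathrm{SL}_2}$ is the geometric quotient. Let $\varphi=[F_a,F_b]:\mathbb{P}^1_{\mathrm{Rat}_2}\to\mathbb{P}^1_{\mathrm{Rat}_2}$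 be the universal morphism and write its $n$-th iterate as $\varphi^n=[F_a^{(n)},F_b^{(n)}]$. Let $\mathrm{Per}_n\subset\mathbb{P}^1_{\mathrm{Rat}_2}$ be the reduced closed subscheme supported on $\{YF_a^{(n)}-XF_b^{(n)}=0\}$. Define recursively $\mathrm{Per}_1^*=\mathrm{Per}_1$ and, for $n\ge2$, $\mathrm{Per}_n^*$ to be the (reduced) union of the irreducible components of $\mathrm{Per}_n$ not contained in $\bigcup_{m\mid n,\,m<n}\mathrm{Per}_m^*$ (periodic points of formal period $n$). It is finite over $\mathrm{Rat}_2$, of degree $\nu_n=\sum_{r\mid n}\mu(n/r)(2^r+1)$, where $\mu$ is the Möbius function. Since $\varphi^n$ is the identity on $\mathrm{Per}_n^*$, pullback by $\varphi^n$ is an $\mathcal{O}_{\mathrm{Per}_n^*}$-linear endomorphism of $\Omega_{\mathbb{P}^1_{\mathrm{Rat}_2}/\mathrm{Rat}_2}\otimes\mathcal{O}_{\mathrm{Per}_n^*}$, which is locally free of rank $\nu_n$ over $\mathcal{O}_{\mathrm{Rat}_2}$; the functions $\sigma_i^{(n)}$ on $\mathrm{Rat}_2$ are defined by its characteristic polynomial $$\det\bigl(T+(\varphi^n)^*\bigr)=\sum_{i=0}^{\nu_n}\sigma_i^{(n)}T^{\nu_n-i}.$$ They are $\mathrm{SL}_2$-invariant, so are functions on $\mathrm{M}_2$. Finally $\sigma_i=\sigma_i^{(1)}$; over an algebraically closed field $\sum_{i=0}^{3}\sigma_i(\varphi)T^{3-i}=\prod_P(T+\varphi'(P))$, the product being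 over the three fixed points of $\varphi$ with multiplicity and $\varphi'(P)$ being the multiplier. *)

(* Defs.v *)
From HB Require Import structures.
From mathcomp Require Import all_boot all_order all_algebra.
From mathcomp Require Import boolp classical_sets.
From mathcomp Require Import mpoly.

Set Implicit Arguments.
Unset Strict Implicit.
Unset Printing Implicit Defensive.

Import GRing.Theory.
Local Open Scope classical_set_scope.
Local Open Scope ring_scope.

Local Notation "x %:F" := (FracField.tofrac x) : ring_scope.

Notation A2 := {mpoly int[6]}.
Notation A2XY := {mpoly {mpoly int[6]}[2]}.
(* The function field of Rat_2 is the degree-0 part of [FracA2], and that of
   P^1 over Rat_2 is the bidegree-(0,0) part of [FracA2XY]. *)
Notation FracA2 := {fraction {mpoly int[6]}}.
Notation FracA2XY := {fraction {mpoly {mpoly int[6]}[2]}}.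

Section QuadraticPairs.
Variable T : comNzRingType.
Implicit Types (c : 'I_6 -> T) (f : 'M[T]_2).

Definition varX : {mpoly T[2]} := 'X_0.
Definition varY : {mpoly T[2]} := 'X_1.

(* [c] lists a0, a1, a2, b0, b1, b2. *)
Definition form_a c : {mpoly T[2]} :=
  c 0 *: varX ^+ 2 + c 1 *: (varX * varY) + c 2 *: varY ^+ 2.
Definition form_b c : {mpoly T[2]} :=
  c 3 *: varX ^+ 2 + c 4 *: (varX * varY) + c 5 *: varY ^+ 2.

Definition coefs_of (Ga Gb : {mpoly T[2]}) : 'I_6 -> T := fun i =>
  [:: Ga@_(U_(0) *+ 2); Ga@_(U_(0) + U_(1)); Ga@_(U_(1) *+ 2);
      Gb@_(U_(0) *+ 2); Gb@_(U_(0) + U_(1)); Gb@_(U_(1) *+ 2)]`_i.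

(* The coefficients of f^-1 o [F_a, F_b] o f, for \det f = 1. *)
Definition conj_coefs f c : 'I_6 -> T :=
  let s := [tuple f 0 0 *: varX + f 0 1 *: varY;
                  f 1 0 *: varX + f 1 1 *: varY] in
  let Fa := form_a c \mPo s in
  let Fb := form_b c \mPo s in
  coefs_of (f 1 1 *: Fa - f 0 1 *: Fb) (- f 1 0 *: Fa + f 0 0 *: Fb).

Definition eval_coefs c (p : A2) : T := mmap intr c p.

End QuadraticPairs.

Definition gen_coefs : 'I_6 -> A2 := fun i => 'X_i.
Definition F_a : A2XY := form_a gen_coefs.
Definition F_b : A2XY := form_b gen_coefs.

Definition rho : A2 :=
  resultant (Poly [:: gen_coefs 2; gen_coefs 1; gen_coefs 0])
            (Poly [:: gen_coefs 5; gen_coefs 4; gen_coefs 3]).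

(* A_2[h^-1]_(0) for h nonzero and homogeneous, of degree (msize h).-1;
   H^0(Rat_2, O) is the case h = rho, and h = g * rho gives the functions on
   the principal open set {g <> 0} of Rat_2. *)
Definition degree0_loc (h : A2) : set FracA2 :=
  [set x | exists (k : nat) (N : A2),
     N \is (k * (msize h).-1)%N.-homog /\ x = N%:F / h%:F ^+ k].

(* Invariance under the group scheme SL_2, through T-valued points: a pair of
   forms over T with invertible resultant is a T-point of Rat_2, and the
   universal element of SL_2(O(SL_2)) acting on the universal pair over
   A_2[rho^-1] is among the cases, so this is invariance for the coaction. *)
Definition SL2_invariant (x : FracA2) : Prop :=
  exists (k : nat) (N : A2),
    [/\ N \is (k * (msize rho).-1)%N.-homog,
        x = N%:F / rho%:F ^+ k &
        forall (T : comUnitRingType) (c : 'I_6 -> T) (f : 'M[T]_2),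
          eval_coefs c rho \is a GRing.unit -> \det f = 1 ->
          eval_coefs (conj_coefs f c) N / eval_coefs (conj_coefs f c) rho ^+ k
          = eval_coefs c N / eval_coefs c rho ^+ k].

Definition bihomog (d e : nat) (f : A2XY) : Prop :=
  f \is e.-homog /\ forall m, f@_m \is d.-homog.

Definition bihomog_part (d e : nat) (f : A2XY) : A2XY :=
  \sum_(m <- msupp f | mdeg m == e)
    (\sum_(l <- msupp f@_m | mdeg l == d) f@_m@_l *: 'X_[l]) *: 'X_[m].

(* Points of P^1 over Rat_2, the open subscheme {rho <> 0} of the biprojective
   scheme P^5 x P^1 over Z: bihomogeneous primes of A_2[X,Y] that contain
   neither rho nor the ideal (X, Y). As rho is not in P, neither is the ideal
   (a_0, ..., b_2). *)
Definition is_point (P : set A2XY) : Prop :=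
  [/\ idealr_closed (mem P) /\ prime_idealr_closed (mem P),
      forall f d e, P f -> P (bihomog_part d e f),
      ~ P rho%:MP &
      ~ (P (varX _) /\ P (varY _))].

Definition Zclosed (Z : set (set A2XY)) : Prop :=
  exists E : set A2XY, Z = [set P | is_point P /\ E `<=` P].

Definition Zirreducible (Z : set (set A2XY)) : Prop :=
  Z !=set0 /\
  forall Z1 Z2, Zclosed Z1 -> Zclosed Z2 ->
    Z `<=` Z1 `|` Z2 -> Z `<=` Z1 \/ Z `<=` Z2.

Definition irred_component (Z C : set (set A2XY)) : Prop :=
  [/\ Zclosed C, Zirreducible C, C `<=` Z &
      forall C', Zclosed C' -> Zirreducible C' -> C' `<=` Z ->
        C `<=` C' -> C' = C].

Fixpoint phi_iter (n : nat) : A2XY * A2XY :=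
  if n is n'.+1 then
    let s := [tuple (phi_iter n').1; (phi_iter n').2] in
    (F_a \mPo s, F_b \mPo s)
  else (varX _, varY _).

Definition Per (n : nat) : set (set A2XY) :=
  [set P | is_point P /\
           P (varY _ * (phi_iter n).1 - varX _ * (phi_iter n).2)].

(* The recursive definition of Per*_n, with fuel [k]; the value does not
   depend on [k] as long as n <= k. *)
Fixpoint Per_star_rec (k n : nat) : set (set A2XY) :=
  if k is k'.+1 then
    if (n <= 1)%N then Per n else
    \bigcup_(C in [set C | irred_component (Per n) C /\
        ~ C `<=` \bigcup_(m in [set m | (m %| n)%N /\ (m < n)%N])
                   Per_star_rec k' m]) C
  else set0.
Definition Per_star (n : nat) : set (set A2XY) := Per_star_rec n n.

(* Membership in the local ring of P^1 over Rat_2 at P, resp. in its maximal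
   ideal. As the scheme is integral, its sections over an open set U are the
   rational functions that are regular at all points of U. As Per*_n is
   reduced, a function regular along Per*_n restricts to 0 on it if and only
   if it vanishes at all its points. *)
Definition regular_at (P : set A2XY) (x : FracA2XY) : Prop :=
  exists d e N D,
    [/\ bihomog d e N, bihomog d e D, ~ P D & x = N%:F / D%:F].
Definition vanishes_at (P : set A2XY) (x : FracA2XY) : Prop :=
  exists d e N D,
    [/\ bihomog d e N, bihomog d e D, ~ P D & x = N%:F / D%:F /\ P N].

(* The charts Y <> 0 (coordinate X/Y) and X <> 0 (coordinate Y/X) of P^1 over
   the open subset {g <> 0} of Rat_2. *)
Definition chartY (g : A2) : set (set A2XY) :=
  [set P | [/\ is_point P, ~ P (varY _) & ~ P g%:MP]].
Definition chartX (g : A2) : set (set A2XY) :=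
  [set P | [/\ is_point P, ~ P (varX _) & ~ P g%:MP]].

Definition zero_on (U : set (set A2XY)) (x : FracA2XY) : Prop :=
  forall P, U P -> vanishes_at P x.

(* Sections over {g <> 0} of the direct image to Rat_2 of
   Omega_{P^1/Rat_2} (x) O_{Per*_n}: a pair (h0, h1) stands for h0 d(X/Y) on
   chartY and h1 d(Y/X) on chartX, and d(Y/X) = - (Y/X)^2 d(X/Y). *)
Definition Omega_Per (n : nat) (g : A2) : set (FracA2XY * FracA2XY) :=
  [set h | [/\ forall P, chartY g P -> regular_at P h.1,
               forall P, chartX g P -> regular_at P h.2 &
               zero_on (Per_star n `&` chartY g `&` chartX g)
                 (h.1 + ((varY _)%:F / (varX _)%:F) ^+ 2 * h.2)]].

(* Equality of such sections. *)
Definition Omega_eq (n : nat) (g : A2) (h h' : FracA2XY * FracA2XY) : Prop :=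
  zero_on (Per_star n `&` chartY g) (h.1 - h'.1) /\
  zero_on (Per_star n `&` chartX g) (h.2 - h'.2).

(* Pullback by phi^n, which is the identity on Per*_n: multiplication by
   d(F_a^(n)/F_b^(n)) / d(X/Y), resp. d(F_b^(n)/F_a^(n)) / d(Y/X). For u
   homogeneous of degree 0 in X and Y, one has du / d(X/Y) = Y * du/dX and
   du / d(Y/X) = X * du/dY. *)
Definition phi_pullback (n : nat) (h : FracA2XY * FracA2XY) :
    FracA2XY * FracA2XY :=
  let Fa := (phi_iter n).1 in
  let Fb := (phi_iter n).2 in
  ((varY _ * (Fa^`M(0) * Fb - Fa * Fb^`M(0)))%:F / (Fb ^+ 2)%:F * h.1,
   (varX _ * (Fb^`M(1) * Fa - Fb * Fa^`M(1)))%:F / (Fa ^+ 2)%:F * h.2).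

(* The inclusion of FracA2 in FracA2XY. *)
Definition frac_incl (x : FracA2) : FracA2XY :=
  (frac (repr x)).1%:MP%:F / (frac (repr x)).2%:MP%:F.

Definition lincomb (d : nat) (r : 'cV[FracA2]_d)
    (e : 'I_d -> FracA2XY * FracA2XY) : FracA2XY * FracA2XY :=
  (\sum_j frac_incl (r j 0) * (e j).1, \sum_j frac_incl (r j 0) * (e j).2).

Definition is_basis (n : nat) (g : A2) (d : nat)
    (e : 'I_d -> FracA2XY * FracA2XY) : Prop :=
  (forall j, Omega_Per n g (e j)) /\
  forall h, Omega_Per n g h ->
    exists! r : 'cV[FracA2]_d,
      (forall j, degree0_loc (g * rho) (r j 0)) /\ Omega_eq n g h (lincomb r e).

Definition is_pullback_matrix (n : nat) (g : A2) (d : nat)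
    (e : 'I_d -> FracA2XY * FracA2XY) (M : 'M[FracA2]_d) : Prop :=
  (forall i j, degree0_loc (g * rho) (M i j)) /\
  forall j, Omega_eq n g (phi_pullback n (e j)) (lincomb (col j M) e).

Definition moebius (n : nat) : int :=
  if all (fun p => logn p n == 1%N) (primes n)
  then (-1) ^+ size (primes n) else 0.

Definition nu (n : nat) : int :=
  \sum_(r <- divisors n) moebius (n %/ r) * (2 ^ r + 1)%N%:Z.

(* [s i] are global functions on Rat_2 that give the coefficients of
   det(T + (phi^n)^* ) over every principal open set, and for every basis over
   that open set, of the locally free module. *)
Definition is_sigma (n : nat) (s : nat -> FracA2) : Prop :=
  (forall i, degree0_loc rho (s i)) /\
  let d := `|nu n|%N in
  forall (g : A2) (e : 'I_d -> FracA2XY * FracA2XY) (M : 'M[FracA2]_d),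
    g != 0 -> (exists l : nat, g \is l.-homog) ->
    is_basis n g e -> is_pullback_matrix n g e M ->
    \det ('X%:M + map_mx polyC M) = \sum_(i < d.+1) (s i)%:P * 'X^(d - i).

Definition sigma (n i : nat) : FracA2 :=
  xget (fun=> 0) [set s | is_sigma n s] i.

Definition in_Z_sigma12 (x : FracA2) : Prop :=
  exists P : {mpoly int[2]},
    x = mmap intr (fun i : 'I_2 => sigma 1 i.+1) P.

(* Main.v *)
Require Import Defs.
From HB Require Import structures.
From mathcomp Require Import all_boot all_order all_fingroup all_algebra all_field.
From mathcomp Require Import boolp classical_sets.
From mathcomp Require Import ring zify.
From mathcomp Require Import mpoly.

(** Everything is tested on geometric points. A point of P^1 over Rat_2 is
    represented by a coefficient vector [c] over a field [K] together with
    homogeneous coordinates [(x, y)], and a bihomogeneous element belongs to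
    the point if and only if it vanishes under the evaluation [evXY c x y].
    A rational function is regular, resp. vanishing, at the point if and only
    if it has a value, resp. the value 0, there; values are partial functions
    [hv] on the function field of P^1 and [rv] on that of Rat_2. A polynomial
    over Z that vanishes at all points of a nonempty open set over the
    algebraic numbers is 0, so that identities between functions on Rat_2 can
    be checked at algebraic points where everything is as generic as needed.

    The sigma_i^(n). A point lies on Per*_n over the locus where a certain
    homogeneous [g <> 0] does not vanish if and only if its exact period is [n]
    ([exact_Per_star], [Per_star_exact]), and over such a locus Per*_n is cut
    out by a dynatomic polynomial of degree [nu n] with separable
    specializations ([dyn_exists]). This gives an explicit basis of the module
    of sections of Omega on Per*_n ([eb_basis]) and a matrix of the pullback
    ([eb_matrix]). For an arbitrary basis over an arbitrary principal open set,
    evaluation at the [nu n] points of exact period [n] diagonalizes the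
    pullback, with the multipliers as eigenvalues; hence the characteristic
    polynomial takes the value prod_P (T + multiplier of P)
    ([charpoly_exists]). Multipliers are invariant under conjugation by SL_2,
    which over the algebraic numbers gives the invariance of the sigma_i^(n),
    and a polynomial identity in the coefficients of the map and of the matrix
    gives it for all rings ([cj_invariant], [sigma_invariant]).

    For n = 1 the same computation shows that sigma_1 and sigma_2 are given by
    Milnor's formulas ([milnor_s_is_sigma], [sigma1E]).

    Invariant functions. A map with a fixed point of multiplier [mu <> 0] is
    conjugate to a multiple of (X^2 - q mu XY - q Y^2, mu XY + Y^2), which has
    resultant 1 ([fixed_nf]). An invariant function restricted to this normal
    form is a polynomial in Z[mu, q], invariant under the involution of [q]
    that exchanges the two critical points; so it is a polynomial in [mu] and
    in one invariant [p] of the involution ([inv_nf]). Now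
    sigma_1 = mu p + 2 and sigma_2 = mu^2 p - mu^2 + 2 mu + p on the normal
    form, so that Z[mu, p] is generated by 1, mu, mu^2 as a module over
    Z[sigma_1, sigma_2] ([Rep_ev2]). An invariant is therefore
    c0 + c1 mu + c2 mu^2 with c0, c1, c2 in Z[sigma_1, sigma_2], for each of
    the three multipliers [mu] of a generic map; as these are distinct,
    c1 = c2 = 0 ([invariant_poly]). *)

Set Implicit Arguments.
Unset Strict Implicit.
Unset Printing Implicit Defensive.

Import GRing.Theory Num.Theory.
Local Open Scope ring_scope.
Local Notation "x %:F" := (FracField.tofrac x) : ring_scope.

(** * Evaluation of the universal map at a coefficient vector *)
HB.instance Definition _ (T : comNzRingType) (c : 'I_6 -> T) :=
  GRing.RMorphism.copy (eval_coefs c) (mmap intr c).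

Definition vX : A2XY := varX _.
Definition vY : A2XY := varY _.

Section Quad.
Variable T : comNzRingType.
Implicit Types (c : 'I_6 -> T) (u : T * T).

(** The two forms at the pair [u], the map as a function on pairs, and its
    iterates. *)
Definition qa c u : T := c 0 * u.1 ^+ 2 + c 1 * (u.1 * u.2) + c 2 * u.2 ^+ 2.
Definition qb c u : T := c 3 * u.1 ^+ 2 + c 4 * (u.1 * u.2) + c 5 * u.2 ^+ 2.
Definition step c u := (qa c u, qb c u).
Definition orb c n u := iter n (step c) u.

Definition pt2 (x y : T) : 'I_2 -> T := fun i => if i == 0 then x else y.
(** Evaluation of the universal ring A_2[X, Y] at a coefficient vector and a
    pair of coordinates. *)
Definition evXY c (x y : T) (F : A2XY) : T := mmap (eval_coefs c) (pt2 x y) F.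

HB.instance Definition _ c x y :=
  GRing.RMorphism.copy (evXY c x y) (mmap (eval_coefs c) (pt2 x y)).

Lemma ev_X c i : eval_coefs c 'X_i = c i.
Proof. by rewrite /eval_coefs mmapX mmap1U. Qed.
Lemma evXY_X c x y : evXY c x y vX = x.
Proof. by rewrite /evXY mmapX mmap1U. Qed.
Lemma evXY_Y c x y : evXY c x y vY = y.
Proof. by rewrite /evXY mmapX mmap1U. Qed.
Lemma evXY_C c x y p : evXY c x y p%:MP = eval_coefs c p.
Proof. by rewrite /evXY mmapC. Qed.
Lemma evXYZ c x y p F : evXY c x y (p *: F) = eval_coefs c p * evXY c x y F.
Proof. by rewrite /evXY mmapZ. Qed.
Lemma evXYM c x y F G : evXY c x y (F * G) = evXY c x y F * evXY c x y G.
Proof. exact: rmorphM. Qed.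
Lemma evXYD c x y F G : evXY c x y (F + G) = evXY c x y F + evXY c x y G.
Proof. exact: rmorphD. Qed.
Lemma evXYB c x y F G : evXY c x y (F - G) = evXY c x y F - evXY c x y G.
Proof. exact: rmorphB. Qed.
Lemma evXYN c x y F : evXY c x y (- F) = - evXY c x y F.
Proof. exact: rmorphN. Qed.
Lemma evXYXn c x y F k : evXY c x y (F ^+ k) = evXY c x y F ^+ k.
Proof. exact: rmorphXn. Qed.
Lemma evM c p q : eval_coefs c (p * q) = eval_coefs c p * eval_coefs c q.
Proof. exact: rmorphM. Qed.
Lemma evXn c p k : eval_coefs c (p ^+ k) = eval_coefs c p ^+ k.
Proof. exact: rmorphXn. Qed.
End Quad.

Lemma ord2_cases (i : 'I_2) : i = 0 \/ i = 1.
Proof. by case: i => [[|[|//]] h]; [left|right]; apply/val_inj. Qed.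

Lemma mpoly_rm_eq (n : nat) (R T : comNzRingType) (f g : {rmorphism {mpoly R[n]} -> T}) :
  (forall r, f r%:MP = g r%:MP) -> (forall i, f 'X_i = g 'X_i) -> f =1 g.
Proof.
move=> hC hX p; rewrite [p]mpolyE !rmorph_sum; apply: eq_bigr => m _.
rewrite -mul_mpolyC !rmorphM /= hC mpolyXE_id !rmorph_prod; congr (_ * _).
by apply: eq_bigr => i _; rewrite !rmorphXn /= hX.
Qed.

(** Every ring morphism on A_2 is an evaluation. *)
Lemma ev_universal (T : comNzRingType) (f : {rmorphism A2 -> T}) p :
  f p = eval_coefs (fun i => f 'X_i) p.
Proof.
apply: (mpoly_rm_eq (g := eval_coefs _)) => [r|i]; last by rewrite /= ev_X.
rewrite /= /eval_coefs mmapC -[r in LHS]intz.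
by rewrite !rmorph_int.
Qed.

Lemma evXY_universal (T : comNzRingType) (f : {rmorphism A2XY -> T}) F :
  f F = evXY (fun i => f ('X_i)%:MP) (f vX) (f vY) F.
Proof.
apply: (mpoly_rm_eq (g := evXY _ _ _)) => [r|i] /=.
  rewrite evXY_C.
  exact: (@ev_universal T (GRing.RMorphism.clone _ _ (f \o @mpolyC 2 _) _)).
by case: (ord2_cases i) => ->; rewrite ?evXY_X ?evXY_Y.
Qed.

Section Morph.
Variables (T S : comNzRingType) (f : {rmorphism T -> S}).

Lemma rm_ev c p : f (eval_coefs c p) = eval_coefs (f \o c) p.
Proof.
etransitivity; first exact: (@ev_universal _ (GRing.RMorphism.clone _ _ (f \o eval_coefs c) _) p).
by congr (eval_coefs _ p); apply/funext => i /=; rewrite ev_X.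
Qed.

Lemma rm_evXY c x y F : f (evXY c x y F) = evXY (f \o c) (f x) (f y) F.
Proof.
etransitivity; first exact: (@evXY_universal _ (GRing.RMorphism.clone _ _ (f \o evXY c x y) _) F).
rewrite /= evXY_X evXY_Y.
by congr (evXY _ _ _ F); apply/funext => i /=; rewrite evXY_C ev_X.
Qed.

Lemma rm_qa c u : f (qa c u) = qa (f \o c) (f u.1, f u.2).
Proof. by rewrite /qa !expr2 !rmorphD !rmorphM. Qed.
Lemma rm_qb c u : f (qb c u) = qb (f \o c) (f u.1, f u.2).
Proof. by rewrite /qb !expr2 !rmorphD !rmorphM. Qed.

Lemma rm_orb c n u : (f (orb c n u).1, f (orb c n u).2) =
   orb (f \o c) n (f u.1, f u.2).
Proof.
elim: n => [//|n IH]; rewrite /orb !iterS -!/(orb _ _ _) /step /= rm_qa rm_qb IH //.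
Qed.
End Morph.

Lemma form_aE (T : comNzRingType) (c : 'I_6 -> T) :
  form_a c = qa (fun i => (c i)%:MP) (varX _, varY _).
Proof. by rewrite /form_a /qa /= !mul_mpolyC. Qed.
Lemma form_bE (T : comNzRingType) (c : 'I_6 -> T) :
  form_b c = qb (fun i => (c i)%:MP) (varX _, varY _).
Proof. by rewrite /form_b /qb /= !mul_mpolyC. Qed.

Lemma phi_iterE n :
  phi_iter n = orb (fun i => (gen_coefs i)%:MP : A2XY) n (vX, vY).
Proof.
elim: n => [//|n]; rewrite /orb iterS -/(orb _ _ _) /= => <-.
case: (phi_iter n) => P Q; rewrite /step /F_a /F_b !form_aE !form_bE /=.
have h : (comp_mpoly [tuple P; Q] \o (fun i => (gen_coefs i)%:MP : A2XY)) = fun i => (gen_coefs i)%:MP.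
  by apply/funext => i /=; rewrite comp_mpolyC.
have e (u : A2XY * A2XY) : qa (comp_mpoly [tuple P; Q] \o (fun i => (gen_coefs i)%:MP : A2XY)) u = qa (fun i => (gen_coefs i)%:MP) u by rewrite h.
have e' (u : A2XY * A2XY) : qb (comp_mpoly [tuple P; Q] \o (fun i => (gen_coefs i)%:MP : A2XY)) u = qb (fun i => (gen_coefs i)%:MP) u by rewrite h.
have hX : vX \mPo [tuple P; Q] = P by rewrite /vX /varX comp_mpolyXU.
have hY : vY \mPo [tuple P; Q] = Q by rewrite /vY /varY comp_mpolyXU.
congr (_, _).
  by etransitivity; [exact: (rm_qa (comp_mpoly [tuple P; Q]))|]; rewrite e /= hX hY.
by etransitivity; [exact: (rm_qb (comp_mpoly [tuple P; Q]))|]; rewrite e' /= hX hY.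
Qed.

Lemma ev_phi_iter (T : comNzRingType) (c : 'I_6 -> T) x y n :
  (evXY c x y (phi_iter n).1, evXY c x y (phi_iter n).2) = orb c n (x, y).
Proof.
rewrite phi_iterE rm_orb /= evXY_X evXY_Y; congr (orb _ _ _).
by apply/funext => i /=; rewrite evXY_C ev_X.
Qed.

(** * Bihomogeneous elements *)
Section Homog.
Variable T : comNzRingType.
Implicit Types (c : 'I_6 -> T).

Lemma ev_scale c k d p : p \is d.-homog ->
  eval_coefs (fun i => k * c i) p = k ^+ d * eval_coefs c p.
Proof.
move=> /dhomogP hp; rewrite /eval_coefs /mmap big_distrr /= big_seq [RHS]big_seq.
apply: eq_bigr => m /hp hm; rewrite mulrCA; congr (_ * _).
rewrite /= in hm; rewrite /mmap1 -hm mdegE -prodrXr -big_split /=.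
by apply: eq_bigr => i _; rewrite exprMn.
Qed.

Lemma evXY_scale c x y k l d e F : bihomog d e F ->
  evXY (fun i => k * c i) (l * x) (l * y) F = k ^+ d * l ^+ e * evXY c x y F.
Proof.
move=> [/dhomogP hF hm]; rewrite /evXY /mmap big_distrr /= big_seq [RHS]big_seq.
apply: eq_bigr => m /hF he; rewrite (ev_scale _ _ (hm m)) -!mulrA; congr (_ * _).
rewrite mulrCA; congr (_ * _).
rewrite /= in he; rewrite /mmap1 -he mdegE !big_ord_recl !big_ord0 /= /pt2 /= !mulr1 !addn0 !exprMn exprD; ring.
Qed.
End Homog.

Lemma bihomogD d e F G : bihomog d e F -> bihomog d e G -> bihomog d e (F + G).
Proof.
move=> [h1 h2] [h3 h4]; split; first exact: rpredD.
by move=> m; rewrite mcoeffD rpredD.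
Qed.
Lemma bihomog0 d e : bihomog d e 0.
Proof. by split; [exact: dhomog0 | move=> m; rewrite mcoeff0 dhomog0]. Qed.
Lemma bihomogN d e F : bihomog d e F -> bihomog d e (- F).
Proof. by move=> [h1 h2]; split; [rewrite dhomogN | move=> m; rewrite mcoeffN dhomogN]. Qed.
Lemma bihomogB d e F G : bihomog d e F -> bihomog d e G -> bihomog d e (F - G).
Proof. by move=> h1 /bihomogN; exact: bihomogD. Qed.
Lemma bihomog_sum d e (I : Type) (r : seq I) (P : pred I) (F : I -> A2XY) :
  (forall i, P i -> bihomog d e (F i)) -> bihomog d e (\sum_(i <- r | P i) F i).
Proof. by move=> h; elim/big_rec: _ => [|i G /h]; [exact: bihomog0 | exact: bihomogD]. Qed.
Lemma bihomogM d e d' e' F G : bihomog d e F -> bihomog d' e' G ->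
  bihomog (d + d') (e + e') (F * G).
Proof.
move=> [h1 h2] [h3 h4]; split; first exact: dhomogM.
by move=> m; rewrite mcoeffM rpred_sum // => k _; apply: dhomogM.
Qed.
Lemma bihomogC d p : p \is d.-homog -> bihomog d 0 p%:MP.
Proof.
move=> hp; split; first by apply/dhomogP => m; rewrite msuppC; case: eqP => // _; rewrite inE => /eqP ->; rewrite /= mdeg0.
by move=> m; rewrite mcoeffC; case: (_ == _); rewrite ?mulr1 ?mulr0 ?dhomog0.
Qed.
Lemma bihomogXm m : bihomog 0 (mdeg m) 'X_[m].
Proof.
split; first by rewrite dhomogX.
by move=> k; rewrite mcoeffX; case: (_ == _); rewrite ?dhomog0 ?dhomog1.
Qed.
Lemma bihomogX : bihomog 0 1 vX.
Proof. by have := bihomogXm U_(0); rewrite mdeg1. Qed.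
Lemma bihomogY : bihomog 0 1 vY.
Proof. by have := bihomogXm U_(1); rewrite mdeg1. Qed.
Lemma bihomog1 : bihomog 0 0 1.
Proof. by rewrite -mpolyC1; apply: bihomogC; exact: dhomog1. Qed.
Lemma bihomogXn d e F k : bihomog d e F -> bihomog (d * k) (e * k) (F ^+ k).
Proof.
move=> h; elim: k => [|k IH]; first by rewrite !muln0; exact: bihomog1.
by rewrite exprS !mulnS; exact: bihomogM.
Qed.
Lemma bihomogZ d e d' p F : p \is d'.-homog -> bihomog d e F -> bihomog (d' + d) e (p *: F).
Proof. by move=> /bihomogC hp hF; rewrite -mul_mpolyC -[e]add0n; exact: bihomogM. Qed.

Lemma bihomogZXm d p m : p \is d.-homog -> bihomog d (mdeg m) (p *: 'X_[m]).
Proof. by move=> hp; have := bihomogZ hp (bihomogXm m); rewrite addn0. Qed.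

Lemma bihomog_part_bihomog d e F : bihomog d e (bihomog_part d e F).
Proof.
apply: bihomog_sum => m /eqP <-; apply: bihomogZXm.
by apply: rpred_sum => l /eqP <-; rewrite rpredZ // dhomogX.
Qed.

(** * Bigraded evaluation *)
Section Graded.
Variable T : comNzRingType.
Variables (c : 'I_6 -> T) (x y : T).

(** Evaluation at the generic rescaling of [c] and of [(x, y)]: the components
    of bidegree (d, e) of [F] are separated as the coefficients of s^d t^e
    (the inner variable is s), which is what [bihomog_part] does formally. *)
Definition gr (F : A2XY) : {poly {poly T}} :=
  evXY (fun i => 'X%:P * (c i)%:P%:P) ('X * x%:P%:P) ('X * y%:P%:P) F.
HB.instance Definition _ := GRing.RMorphism.copy gr 
  (evXY (fun i => 'X%:P * (c i)%:P%:P) ('X * x%:P%:P) ('X * y%:P%:P)).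

Lemma gr_bihomog d e F : bihomog d e F ->
  gr F = 'X%:P ^+ d * 'X ^+ e * (evXY c x y F)%:P%:P.
Proof.
move=> h; rewrite /gr (evXY_scale _ _ _ _ _ h); congr (_ * _).
pose g := GRing.RMorphism.clone _ _ (@polyC {poly T} \o @polyC T) _.
by rewrite -[RHS]/(g _) (rm_evXY g).
Qed.

Lemma gr_bihomog_coef d e F i j : bihomog d e F ->
  (gr F)`_j`_i = if (d == i) && (e == j) then evXY c x y F else 0.
Proof.
move=> /gr_bihomog ->; rewrite -polyC_exp -mulrA mulrCA -polyCM.
rewrite coefXnM; case: ltnP => [lt|le]; first by rewrite coef0 (gtn_eqF lt) andbF.
rewrite coefC subn_eq0; case: (ltngtP j e) le => // [lt _|_ _].
  by rewrite coef0 andbF.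
rewrite andbT coefXnM; case: ltnP => [lt|le]; first by rewrite (gtn_eqF lt).
by rewrite coefC subn_eq0; case: ltngtP le.
Qed.

Lemma gr_part d e F : (gr F)`_e`_d = evXY c x y (bihomog_part d e F).
Proof.
rewrite {1}[F]mpolyE raddf_sum /= coef_sum coef_sum /bihomog_part raddf_sum /=.
rewrite [RHS]big_mkcond /=; apply: eq_bigr => m _.
rewrite {1}[F@_m]mpolyE scaler_suml raddf_sum /= !coef_sum.
case: ifP => hm; last first.
  rewrite big1 // => l _.
  have h : bihomog (mdeg l) (mdeg m) ((F@_m@_l *: 'X_[l]) *: 'X_[m]).
    by apply: bihomogZXm; rewrite rpredZ // dhomogX.
  by rewrite (gr_bihomog_coef _ _ h) hm andbF.
rewrite scaler_suml raddf_sum /= [RHS]big_mkcond /=; apply: eq_bigr => l _.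
have h : bihomog (mdeg l) (mdeg m) ((F@_m@_l *: 'X_[l]) *: 'X_[m]).
  by apply: bihomogZXm; rewrite rpredZ // dhomogX.
by rewrite (gr_bihomog_coef _ _ h) hm andbT.
Qed.

End Graded.

(** * The resultant *)
Section RhoDef.
Variable T : comNzRingType.
Implicit Types (c : 'I_6 -> T) (u : T * T).
(** The 2x2 minors of the coefficient matrix. They give the resultant, and
    [jac] is half of the Jacobian determinant of the pair of forms. *)
Definition jq c : T := c 0 * c 4 - c 1 * c 3.
Definition jp c : T := c 0 * c 5 - c 2 * c 3.
Definition jr c : T := c 1 * c 5 - c 2 * c 4.
Definition rhoc c : T := jp c ^+ 2 - jq c * jr c.
Definition jac c u : T := jq c * u.1 ^+ 2 + 2 * jp c * (u.1 * u.2) + jr c * u.2 ^+ 2.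
End RhoDef.

(* The size 4 is provided by an equation, as the size of the Sylvester matrix
   is a sum of sizes of polynomials. *)
Lemma det4 (R : comNzRingType) (m : nat) (hm : m = 4) (A : 'M[R]_m) (f : nat -> nat -> R) :
  (forall i j : 'I_m, A i j = f i j) -> 
  \det A = \det (\matrix_(i < 4, j < 4) f i j).
Proof. by subst m => h; congr (\det _); apply/matrixP => i j; rewrite mxE h. Qed.

Lemma res22 (R : idomainType) (a0 a1 a2 b0 b1 b2 : R) : a0 != 0 -> b0 != 0 ->
  resultant (Poly [:: a2; a1; a0]) (Poly [:: b2; b1; b0]) =
  (a0 * b2 - a2 * b0) ^+ 2 - (a0 * b1 - a1 * b0) * (a1 * b2 - a2 * b1).
Proof.
move=> ha hb.
have sP (u v w : R) : w != 0 -> Poly [:: u; v; w] = [:: u; v; w] :> seq R.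
  by move=> hw; rewrite (PolyK (c := 0)).
have sa : size (Poly [:: a2; a1; a0]) = 3 by rewrite sP.
have sb : size (Poly [:: b2; b1; b0]) = 3 by rewrite sP.
rewrite /resultant.
pose f (i j : nat) : R := if (i < 2)%N then (if (i <= j)%N then [:: a2; a1; a0]`_(j - i) else 0) else
   (if (i - 2 <= j)%N then [:: b2; b1; b0]`_(j - (i - 2)) else 0).
rewrite (@det4 _ _ _ _ f); last first.
- move=> i j; rewrite Sylvester_mxE.
  case: splitP => k hk; rewrite hk.
    have k2 : (k < 2)%N by apply: leq_trans (ltn_ord k) _; rewrite sb.
    by rewrite coef_Poly /f k2 mulrb.
  rewrite coef_Poly; move: (nat_of_ord j) (nat_of_ord k) => j' k'.
  by rewrite sb /f add2n subn2 /= mulrb.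
- by rewrite sa sb.
do 3![rewrite !(expand_det_row _ ord0) !big_ord_recl !big_ord0 /cofactor].
rewrite !det_mx11 !mxE /= /f /= /bump /= ?addn0 ?add0n ?addn1 ?add1n /=.
ring.
Qed.

Lemma gen_coefs_neq0 i : gen_coefs i != 0.
Proof. by rewrite -msize_poly_eq0 msizeX. Qed.

Lemma rhoE : rho = rhoc gen_coefs.
Proof. by rewrite /rho res22 ?gen_coefs_neq0 // /rhoc /jp /jq /jr. Qed.

Lemma ev_rho (T : comNzRingType) (c : 'I_6 -> T) : eval_coefs c rho = rhoc c.
Proof.
by rewrite rhoE /rhoc /jp /jq /jr expr2 !(rmorphB, rmorphM) /= !ev_X -expr2.
Qed.

Lemma X_homog (n : nat) (R : nzRingType) (i : 'I_n) : ('X_i : {mpoly R[n]}) \is 1.-homog.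
Proof. by rewrite dhomogX /= mdeg1. Qed.

Lemma rho_homog : rho \is 4.-homog.
Proof.
by rewrite rhoE /rhoc /jp /jq /jr expr2 rpredB //; 
 apply: (dhomogM (d := 2) (e := 2)); rewrite rpredB //; apply: (dhomogM (d := 1) (e := 1)); exact: X_homog.
Qed.

(** The coefficient vector with the listed entries. *)
Definition mkc (T : Type) (a0 a1 a2 b0 b1 b2 : T) : 'I_6 -> T := tnth [tuple a0; a1; a2; b0; b1; b2].

Lemma rho_neq0 : rho != 0.
Proof.
apply/eqP => h; have /eqP := ev_rho (mkc 1 0 0 0 0 1 : _ -> int).
by rewrite h rmorph0 /rhoc /jp /jq /jr.
Qed.

Lemma homog_msize1 (n : nat) (R : nzRingType) d (p : {mpoly R[n]}) : p != 0 -> p \is d.-homog -> (msize p).-1 = d.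
Proof. by move=> p0 hp; apply: dhomog_uniq p0 (dhomog_msize hp) hp. Qed.

Lemma msize_rho : (msize rho).-1 = 4.
Proof. exact: homog_msize1 rho_neq0 rho_homog. Qed.

Section Nondeg.
Variable (T : idomainType).
Implicit Types (c : 'I_6 -> T) (u : T * T).
(** A map with nonzero resultant has no base point: combinations of the two
    forms give X (jp X + jr Y) and Y (jq X + jp Y), and the resultant is the
    determinant of these two linear forms. *)
Lemma step_nondeg c u : rhoc c != 0 -> u != (0, 0) -> step c u != (0, 0).
Proof.
case: u => x y hr; apply: contra; rewrite !xpair_eqE /qa /qb /= => /andP[/eqP ha /eqP hb].
have e1 : x * (jp c * x + jr c * y) = 0.
  have -> : x * (jp c * x + jr c * y) = c 5 * 0 - c 2 * 0 by rewrite -{1}ha -hb /jp /jr; ring.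
  ring.
have e2 : y * (jq c * x + jp c * y) = 0.
  have -> : y * (jq c * x + jp c * y) = c 0 * 0 - c 3 * 0 by rewrite -{1}hb -ha /jp /jq; ring.
  ring.
have [x0|x0] := eqVneq x 0.
  have [//|y0] := eqVneq y 0.
  move: ha hb; rewrite x0 expr0n !mul0r !mulr0 !add0r => /eqP; rewrite mulf_eq0 expf_eq0 /= (negbTE y0) orbF => /eqP h1.
  move=> /eqP; rewrite mulf_eq0 expf_eq0 /= (negbTE y0) orbF => /eqP h2.
  by case/eqP: hr; rewrite /rhoc /jp /jq /jr h1 h2; ring.
have [y0|y0] := eqVneq y 0.
  move: ha hb; rewrite y0 expr0n !mulr0 !addr0 => /eqP; rewrite mulf_eq0 expf_eq0 /= (negbTE x0) orbF => /eqP h1.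
  move=> /eqP; rewrite mulf_eq0 expf_eq0 /= (negbTE x0) orbF => /eqP h2.
  by case/eqP: hr; rewrite /rhoc /jp /jq /jr h1 h2; ring.
move: e1 => /eqP; rewrite mulf_eq0 (negbTE x0) /= => /eqP e1.
move: e2 => /eqP; rewrite mulf_eq0 (negbTE y0) /= => /eqP e2.
have /eqP : rhoc c * x = jp c * 0 - jr c * 0 by rewrite -{1}e1 -e2 /rhoc; ring.
by rewrite !mulr0 subr0 mulf_eq0 (negbTE hr) (negbTE x0).
Qed.

Lemma orb_nondeg c n u : rhoc c != 0 -> u != (0, 0) -> orb c n u != (0, 0).
Proof. by move=> hr hu; elim: n => // n IH; rewrite /orb iterS; exact: step_nondeg. Qed.
End Nondeg.

(** * Prime ideals avoiding an element *)
Section Prime.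
Variable A : comNzRingType.
Local Open Scope classical_set_scope.

(** Ideals as sets, and prime ideals. *)
Definition ideal_set (I : set A) := [/\ I 0, forall x y, I x -> I y -> I (x + y) & forall a x, I x -> I (a * x)].
Definition prime_set (P : set A) := [/\ ideal_set P, ~ P 1 & forall x y, P (x * y) -> P x \/ P y].


(** By Zorn, an ideal containing no power of [s] lies in a prime ideal without
    [s]. The poset is completed by the empty set, the union of the empty
    chain. *)
Lemma krull (I : set A) (s : A) : ideal_set I -> (forall k, ~ I (s ^+ k)) ->
  exists P : set A, [/\ prime_set P, I `<=` P & ~ P s].
Proof.
move=> hI hs.
pose good (J : set A) := [/\ ideal_set J, I `<=` J & forall k, ~ J (s ^+ k)].
pose Q (J : set A) := J = set0 \/ good J.
have [|M [QM Mmax]] := @Zorn_bigcup A Q.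
  move=> F FQ tot; have [h|/nonemptyPn h] := pselect ((\bigcup_(X in F) X) !=set0); last by left.
  right; case: h => z [J0 FJ0 J0z].
  have gd J x : F J -> J x -> good J by move=> /FQ [->|].
  have gJ0 := gd _ _ FJ0 J0z.
  split.
  - split; first by exists J0 => //; case: gJ0 => -[].
      move=> x y [J FJ Jx] [K FK Ky].
      have [JK|KJ] := tot _ _ FJ FK.
        exists K => //; case: (gd _ _ FK Ky) => -[_ h _ _ _]; apply: h => //; exact: JK.
      exists J => //; case: (gd _ _ FJ Jx) => -[_ h _ _ _]; apply: h => //; exact: KJ.
    by move=> a x [J FJ Jx]; exists J => //; case: (gd _ _ FJ Jx) => -[_ _ h _ _]; apply: h.
  - by move=> x Ix; exists J0 => //; case: gJ0 => _ h _; apply: h.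
  - by move=> k [J FJ Jk]; case: (gd _ _ FJ Jk) => _ _ /(_ k).
have gI : good I by split.
have gM : good M.
  case: QM => // M0; case: (Mmax I); last by right.
  by rewrite M0 properEneq; split; [apply/eqP => e; case: gI => -[h _ _ _ _]; rewrite -e in h | ].
have [iM IM sM] := gM; have [M0 MD MM] := iM.
have ext x : ~ M x -> exists k a, M (s ^+ k - a * x).
  move=> Mx; pose K : set A := [set z | exists a, M (z - a * x)].
  apply: contrapT => hk.
  have gK : good K.
    split.
    - split; first by exists 0; rewrite mul0r subr0.
        move=> z w [a ha] [b hb]; exists (a + b).
        by rewrite mulrDl opprD addrACA; apply: MD.
      by move=> b z [a ha]; exists (b * a); rewrite -mulrA -mulrBr; apply: MM.
    - by move=> z /IM Mz; exists 0; rewrite mul0r subr0.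
    - by move=> k [a ha]; apply: hk; exists k, a.
  case: (Mmax K); last by right.
  rewrite properEneq; split.
    apply/eqP => e; apply: Mx; rewrite e; exists 1; rewrite mul1r subrr //.
  by move=> z Mz; exists 0; rewrite mul0r subr0.
exists M; split => //; last by move=> h; apply: (sM 1%N).
split => //; first exact: (sM 0%N).
move=> x y Mxy; apply: contrapT => /not_orP[/ext [k [a ha]] /ext [l [b hb]]].
apply: (sM (k + l)%N).
have -> : s ^+ (k + l) = s ^+ l * (s ^+ k - a * x) + a * x * (s ^+ l - b * y) + a * b * (x * y).
  by rewrite exprD; ring.
by apply: (MD); [apply: (MD)|]; apply: (MM).
Qed.
End Prime.

(** * Quotient fields of prime ideals *)
Section QuotField.
Variables (A : comNzRingType) (P : set A) (hP : prime_set P).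
Local Open Scope quotient_scope.

Definition pI (x : A) : bool := x \in P.
Lemma pI_idealr : idealr_closed pI.
Proof.
case: hP => -[P0 PD PM] P1 _; split.
- by rewrite unfold_in /pI inE.
- by rewrite unfold_in /pI notin_setE.
- by move=> a u v; rewrite !unfold_in /pI !inE => hu hv; apply: PD => //; apply: PM.
Qed.
Lemma pI_prime : prime_idealr_closed pI.
Proof.
case: hP => _ _ h u v; rewrite !unfold_in /pI inE => /h [hu|hv]; apply/orP;
by [left; rewrite inE | right; rewrite inE].
Qed.
HB.instance Definition _ := isIdealr.Build A pI pI_idealr.
HB.instance Definition _ := isPrimeIdealrClosed.Build A pI pI_prime.

Definition pQ : prime_idealr A := PrimeIdealr.clone A pI _.
(* The quotient ring, with the inverses provided by excluded middle. *)
Definition QP := {ideal_quot pQ}.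
HB.instance Definition _ := GRing.ComNzRing.on QP.

Lemma QP_idom (x y : QP) : x * y = 0 -> (x == 0) || (y == 0).
Proof. exact: Quotient.rquot_IdomainAxiom. Qed.

Definition QP_unit (x : QP) : bool := `[< exists y, y * x = 1 >].
Definition QP_inv (x : QP) : QP := if pselect (exists y, y * x = 1) is left h then projT1 (cid h) else x.
Lemma QP_mulVx : {in QP_unit, left_inverse 1 QP_inv *%R}.
Proof. move=> x; rewrite unfold_in => /asboolP h; rewrite /QP_inv; case: pselect => // h'; by case: cid. Qed.
Lemma QP_unitPl x y : y * x = 1 -> QP_unit x.
Proof. by move=> h; apply/asboolP; exists y. Qed.
Lemma QP_inv_out : {in [predC QP_unit], QP_inv =1 id}.
Proof. by move=> x; rewrite inE unfold_in => /asboolP h; rewrite /QP_inv; case: pselect. Qed.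
HB.instance Definition _ := GRing.ComNzRing_hasMulInverse.Build QP QP_mulVx QP_unitPl QP_inv_out.
HB.instance Definition _ := GRing.ComUnitRing_isIntegral.Build QP QP_idom.

(** Every prime ideal is the kernel of a morphism to a field. *)
Lemma prime_quot_field : exists (K : fieldType) (f : {rmorphism A -> K}), forall x, P x <-> f x = 0.
Proof.
pose pi := (\pi_({ideal_quot pQ}) : {rmorphism A -> {ideal_quot pQ}}).
exists {fraction QP}.
exists (GRing.RMorphism.clone _ _ (@FracField.tofrac QP \o (pi : A -> QP)) _).
move=> x /=; rewrite -tofrac0.
have h : (pi x == 0) = (x \in pQ).
  by rewrite -(rmorph0 pi) /= -Quotient.idealrBE subr0.
have -> : P x <-> pi x = 0.
  split=> [Px|/eqP]; first by apply/eqP; rewrite h unfold_in /= /pI inE.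
  by rewrite h unfold_in /= /pI inE.
split=> [-> //|].
by move/eqP; rewrite tofrac_eq => /eqP.
Qed.
End QuotField.

(** * Geometric points of P^1 over Rat_2 *)
Section SetScope.
Local Open Scope classical_set_scope.

Lemma prime_setP (A : comNzRingType) (P : set A) :
  idealr_closed (mem P) /\ prime_idealr_closed (mem P) <-> prime_set P.
Proof.
split.
  case=> -[h0 h1 h2] h3.
  have P0 : P 0 by rewrite -in_setE.
  split; [split=> // | |].
  - by move=> x y Px Py; have := h2 1 x y; rewrite mul1r -!topredE /= !in_setE; apply.
  - by move=> a x Px; have := h2 a x 0; rewrite addr0 -!topredE /= !in_setE; apply.
  - by move: h1; rewrite -topredE /= notin_setE.
  - by move=> x y; move: (h3 x y); rewrite -!topredE /= in_setE => h /h /orP; rewrite !in_setE.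
case=> -[P0 PD PM] P1 Pp; split; [split|].
- by rewrite -topredE /= in_setE.
- by rewrite -topredE /= notin_setE.
- by move=> a u v; rewrite -!topredE /= !in_setE => hu hv; apply: (PD) => //; apply: PM.
- by move=> u v; rewrite -!topredE /= in_setE => /Pp h; apply/orP; rewrite !in_setE.
Qed.

(** [(x : y)] is a point of P^1 over the point [c] of Rat_2. *)
Definition fpt (K : fieldType) (c : 'I_6 -> K) (x y : K) := rhoc c != 0 /\ (x, y) != (0, 0).

(** [P] is the ideal of the point [(c, (x : y))], as far as bihomogeneous
    elements are concerned. *)
Definition reps (K : fieldType) (c : 'I_6 -> K) (x y : K) (P : set A2XY) : Prop :=
  forall d e F, bihomog d e F -> (P F <-> evXY c x y F = 0).

Lemma bihomog_rho : bihomog 4 0 rho%:MP.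
Proof. exact: bihomogC rho_homog. Qed.

Lemma reps_fpt (K : fieldType) (c : 'I_6 -> K) x y P : is_point P -> reps c x y P -> fpt c x y.
Proof.
move=> [_ _ Pr Pxy] h; split.
  by apply/eqP => h0; apply: Pr; apply/(h _ _ _ bihomog_rho); rewrite evXY_C ev_rho.
apply/eqP => -[x0 y0]; apply: Pxy; split; apply/(h _ _ _); first exact: bihomogX.
- by rewrite evXY_X.
- exact: bihomogY.
- by rewrite evXY_Y.
Qed.

Lemma prime_reps (P : set A2XY) : prime_set P ->
  exists (K : fieldType) (c : 'I_6 -> K) x y, forall F, P F <-> evXY c x y F = 0.
Proof.
move=> /prime_quot_field [K [f hf]]; exists K, (fun i => f ('X_i)%:MP), (f vX), (f vY).
by move=> F; rewrite -evXY_universal.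
Qed.

(** Every point is represented over a field. *)
Lemma point_reps (P : set A2XY) : is_point P ->
  exists (K : fieldType) (c : 'I_6 -> K) x y, [/\ fpt c x y, reps c x y P & forall F, P F <-> evXY c x y F = 0].
Proof.
move=> hP; case: (hP) => /prime_setP /prime_reps [K [c [x [y h]]]] _ _ _.
have h' : reps c x y P by move=> d e F _.
by exists K, c, x, y; split => //; apply: reps_fpt hP h'.
Qed.

(** The bihomogeneous prime of the point [(c, (x : y))]: the elements with all
    bihomogeneous components vanishing there. *)
Definition Pt (K : fieldType) (c : 'I_6 -> K) (x y : K) : set A2XY :=
  [set F | gr c x y F = 0].

Lemma Pt_reps (K : fieldType) (c : 'I_6 -> K) (x y : K) : reps c x y (Pt c x y).
Proof.
move=> d e F hF; rewrite /Pt /= (gr_bihomog _ _ _ hF); split=> [/eqP|->]; last by rewrite mulr0.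
rewrite !mulf_eq0 !expf_eq0 polyX_eq0 !polyC_eq0 polyX_eq0 !andbF /=.
by move/eqP.
Qed.

Lemma PtP (K : fieldType) (c : 'I_6 -> K) (x y : K) d e F : bihomog d e F ->
  (Pt c x y F <-> evXY c x y F = 0).
Proof. exact: Pt_reps. Qed.

Lemma Pt_prime (K : fieldType) (c : 'I_6 -> K) (x y : K) : prime_set (Pt c x y).
Proof.
rewrite /Pt; split; [split|..] => /=.
- by rewrite rmorph0.
- by move=> F G; rewrite rmorphD /= => -> ->; rewrite addr0.
- by move=> a F; rewrite rmorphM /= => ->; rewrite mulr0.
- by rewrite rmorph1; apply/eqP; rewrite oner_eq0.
- by move=> F G; rewrite rmorphM /= => /eqP; rewrite mulf_eq0 => /orP[/eqP|/eqP]; [left|right].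
Qed.

Lemma Pt_point (K : fieldType) (c : 'I_6 -> K) (x y : K) : fpt c x y -> is_point (Pt c x y).
Proof.
move=> [hr hxy]; split.
- exact/prime_setP/Pt_prime.
- move=> f d e hf; apply/(PtP _ _ _ (bihomog_part_bihomog d e f)).
  by rewrite -gr_part (hf : gr c x y f = 0) !coef0.
- by move/(PtP _ _ _ bihomog_rho); rewrite evXY_C ev_rho; apply/eqP.
- case=> /(PtP _ _ _ bihomogX); rewrite evXY_X => x0 /(PtP _ _ _ bihomogY); rewrite evXY_Y => y0.
  by move: hxy; rewrite x0 y0 eqxx.
Qed.

(** * Values of rational functions on P^1 over Rat_2 *)
Section Values.
Variables (K : fieldType) (c : 'I_6 -> K) (x y : K).
Local Notation E := (evXY c x y).

(** [F] is defined at the point [(c, (x : y))], with value [a]. *)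
Definition hv (F : FracA2XY) (a : K) : Prop :=
  exists d e N D, [/\ bihomog d e N, bihomog d e D, E D != 0, F = N%:F / D%:F & a = E N / E D].

Lemma E_neq0 D : E D != 0 -> D%:F != 0.
Proof. by apply: contraNneq => /eqP; rewrite tofrac_eq0 => /eqP ->; rewrite rmorph0. Qed.

Lemma hv_uniq F a b : hv F a -> hv F b -> a = b.
Proof.
move=> [d [e [N [D [h1 h2 h3 h4 ->]]]]] [d' [e' [N' [D' [h1' h2' h3' h4' ->]]]]].
have /eqP : N%:F / D%:F = N'%:F / D'%:F by rewrite -h4 -h4'.
rewrite eqr_div ?E_neq0 // -!tofracM tofrac_eq => /eqP h.
by apply/eqP; rewrite eqr_div // -!rmorphM h.
Qed.

Lemma hvD F G a b : hv F a -> hv G b -> hv (F + G) (a + b).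
Proof.
move=> [d [e [N [D [h1 h2 h3 -> ->]]]]] [d' [e' [N' [D' [h1' h2' h3' -> ->]]]]].
exists (d + d')%N, (e + e')%N, (N * D' + N' * D), (D * D'); split.
- by apply: bihomogD; [exact: bihomogM| rewrite addnC [(e + _)%N]addnC; exact: bihomogM].
- exact: bihomogM.
- by rewrite rmorphM mulf_neq0.
- by rewrite addf_div ?E_neq0 // !tofracD !tofracM.
- by rewrite addf_div // rmorphD !rmorphM.
Qed.

Lemma hvM F G a b : hv F a -> hv G b -> hv (F * G) (a * b).
Proof.
move=> [d [e [N [D [h1 h2 h3 -> ->]]]]] [d' [e' [N' [D' [h1' h2' h3' -> ->]]]]].
exists (d + d')%N, (e + e')%N, (N * N'), (D * D'); split; try exact: bihomogM.
- by rewrite rmorphM mulf_neq0.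
- by rewrite mulf_div !tofracM.
- by rewrite mulf_div !rmorphM.
Qed.

Lemma hv_div d e N D : bihomog d e N -> bihomog d e D -> E D != 0 ->
  hv (N%:F / D%:F) (E N / E D).
Proof. by move=> *; exists d, e, N, D. Qed.

Lemma hv1 : hv 1 1.
Proof.
by have := hv_div bihomog1 bihomog1; rewrite rmorph1 tofrac1 !divr1; apply; rewrite oner_neq0.
Qed.

Lemma hv0 : hv 0 0.
Proof.
by have := hv_div (bihomog0 0 0) bihomog1; rewrite !rmorph1 !rmorph0 !mul0r; apply; rewrite oner_neq0.
Qed.

Lemma hvN F a : hv F a -> hv (- F) (- a).
Proof.
move=> [d [e [N [D [h1 h2 h3 -> ->]]]]]; rewrite -mulNr -tofracN -mulNr -rmorphN.
exact: hv_div (bihomogN h1) h2 h3.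
Qed.

Lemma hvB F G a b : hv F a -> hv G b -> hv (F - G) (a - b).
Proof. by move=> hF /hvN; exact: hvD. Qed.

Lemma hvX F a k : hv F a -> hv (F ^+ k) (a ^+ k).
Proof. by move=> h; elim: k => [|k IH]; [exact: hv1 | rewrite !exprS; exact: hvM]. Qed.

Lemma hv_sum (I : Type) (r : seq I) (F : I -> FracA2XY) (a : I -> K) :
  (forall i, hv (F i) (a i)) -> hv (\sum_(i <- r) F i) (\sum_(i <- r) a i).
Proof.
by move=> h; elim: r => [|i r IH]; rewrite ?big_nil ?big_cons; [exact: hv0 | exact: hvD].
Qed.

Lemma reps_regular P F : reps c x y P -> (regular_at P F <-> exists a, hv F a).
Proof.
move=> hP; split.
  case=> d [e [N [D [h1 h2 h3 ->]]]]; exists (E N / E D); apply: hv_div (h1) (h2) _.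
  by apply/eqP => h; apply: h3; apply/(hP _ _ _ h2).
case=> a [d [e [N [D [h1 h2 h3 h4 _]]]]]; exists d, e, N, D; split => //.
by move/(hP _ _ _ h2) => h; move: h3; rewrite h eqxx.
Qed.

Lemma reps_vanishes P F : reps c x y P -> (vanishes_at P F <-> hv F 0).
Proof.
move=> hP; split.
  case=> d [e [N [D [h1 h2 h3 [-> PN]]]]].
  have <- : E N / E D = 0 by rewrite ((hP _ _ _ h1).1 PN) mul0r.
  apply: hv_div (h1) (h2) _.
  by apply/eqP => h; apply: h3; apply/(hP _ _ _ h2).
case=> [d [e [N [D [h1 h2 h3 h4 h5]]]]]; exists d, e, N, D; split => //.
  by move/(hP _ _ _ h2) => h; move: h3; rewrite h eqxx.
split=> //; apply/(hP _ _ _ h1)/eqP; move/esym/eqP: h5.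
by rewrite mulf_eq0 invr_eq0 (negbTE h3) orbF.
Qed.
End Values.
End SetScope.

(** * Periodic points *)
Section Period.
Variables (K : fieldType) (c : 'I_6 -> K).
Hypothesis hr : rhoc c != 0.
Implicit Types u v w : K * K.

(** Equality of the points of P^1 with homogeneous coordinates [u] and [v]. *)
Definition par u v := u.1 * v.2 == u.2 * v.1.

Lemma par_refl u : par u u. Proof. by rewrite /par mulrC. Qed.
Lemma par_sym u v : par u v -> par v u.
Proof. by rewrite /par => /eqP h; apply/eqP; rewrite mulrC -h mulrC. Qed.

Lemma neq00 u : u != (0, 0) -> u.1 != 0 \/ u.2 != 0.
Proof. by case: u => a b; rewrite xpair_eqE negb_and => /orP. Qed.

Lemma par_trans v u w : v != (0, 0) -> par u v -> par v w -> par u w.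
Proof.
move=> /neq00 hv /eqP h1 /eqP h2; apply/eqP.
case: hv => hv; apply: (mulfI hv).
  have e1 : v.1 * (u.1 * w.2) = u.1 * (v.1 * w.2) by ring.
  have e2 : u.1 * (v.2 * w.1) = u.1 * v.2 * w.1 by ring.
  by rewrite e1 h2 e2 h1; ring.
have e1 : v.2 * (u.1 * w.2) = u.1 * v.2 * w.2 by ring.
have e2 : u.2 * v.1 * w.2 = u.2 * (v.1 * w.2) by ring.
by rewrite e1 h1 e2 h2; ring.
Qed.

Lemma par_scale u v : v != (0, 0) -> par u v -> exists k, u = (k * v.1, k * v.2).
Proof.
case: u v => a b [x y] /neq00 /= [] hv /eqP /= h.
  by exists (a / x); congr (_, _); rewrite ?divfK // mulrAC h mulfK.
by exists (b / y); congr (_, _); rewrite ?divfK // mulrAC -h mulfK.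
Qed.

Lemma step_scale k u : step c (k * u.1, k * u.2) = (k ^+ 2 * (step c u).1, k ^+ 2 * (step c u).2).
Proof. by rewrite /step /qa /qb /=; congr (_, _); ring. Qed.

Lemma par_step u v : v != (0, 0) -> par u v -> par (step c u) (step c v).
Proof.
move=> hv /(par_scale hv) [k ->]; rewrite step_scale /par /=; apply/eqP; ring.
Qed.

Lemma par_orb n u v : v != (0, 0) -> par u v -> par (orb c n u) (orb c n v).
Proof.
move=> hv h; elim: n => // n IH; rewrite /orb !iterS; apply: par_step => //.
exact: orb_nondeg.
Qed.

Variable v : K * K.
Hypothesis hv : v != (0, 0).
(** [n] is a period of the point [v]. *)
Definition per n := par (orb c n v) v.

Lemma perD m n : per m -> per n -> per (m + n).
Proof.
move=> hm hn; rewrite /per /orb iterD; apply: par_trans hm => //; last exact: (par_orb m hv hn).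
exact: orb_nondeg.
Qed.

Lemma perB m n : (m <= n)%N -> per m -> per n -> per (n - m).
Proof.
move=> le hm hn; rewrite /per; apply: (@par_trans (orb c n v)) => //; first exact: orb_nondeg.
rewrite -{2}(subnK le) {2}/orb iterD; apply/par_sym/par_orb => //.
Qed.

Lemma per0 : per 0. Proof. exact: par_refl. Qed.

Lemma perM m k : per m -> per (k * m).
Proof. by move=> h; elim: k => [|k IH]; [exact: per0 | rewrite mulSn; exact: perD]. Qed.

(** [n] is the least positive period of [v]. *)
Definition exact_per n := [/\ (0 < n)%N, per n & forall m, (0 < m < n)%N -> ~~ per m].

Lemma exact_exists n : (0 < n)%N -> per n -> exists2 d, (d %| n)%N & exact_per d.
Proof.
move=> n0 hn; have ex : exists d, (0 < d)%N && per d by exists n; rewrite n0.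
case: (ex_minnP ex) => d /andP[d0 hd] dmin; exists d; last first.
  split=> // m /andP[m0 md]; apply: contraL md => pm; rewrite -leqNgt; apply: dmin; exact/andP.
have hq : (n %/ d * d <= n)%N by exact: leq_divM.
have := perB hq (perM (n %/ d) hd) hn.
have -> : (n - n %/ d * d = n %% d)%N by rewrite {1}(divn_eq n d) addKn.
rewrite /dvdn; case: posnP => // m0 pm; have := dmin (n %% d)%N; rewrite m0 pm => /(_ isT).
by rewrite leqNgt ltn_mod d0.
Qed.

Lemma exact_uniq m n : exact_per m -> exact_per n -> m = n.
Proof.
move=> [m0 pm hm] [n0 pn hn]; case: (ltngtP m n) => // h.
  by have := hn m; rewrite m0 h pm => /(_ isT).
by have := hm n; rewrite n0 h pn => /(_ isT).
Qed.
End Period.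

(** The equation of Per_n. *)
Definition Psi n : A2XY := vY * (phi_iter n).1 - vX * (phi_iter n).2.

Lemma phi_iter_bihomog n : bihomog (2 ^ n - 1) (2 ^ n) (phi_iter n).1 /\ bihomog (2 ^ n - 1) (2 ^ n) (phi_iter n).2.
Proof.
rewrite phi_iterE; elim: n => [|n [h1 h2]]; first by split; [exact: bihomogX | exact: bihomogY].
have hc i : bihomog 1 0 (gen_coefs i)%:MP by apply: bihomogC; exact: X_homog.
have e1 : (2 ^ n.+1 - 1 = 1 + ((2 ^ n - 1) + (2 ^ n - 1)))%N by have := expn_gt0 2 n; rewrite expnS; lia.
have e2 : (2 ^ n.+1 = 0 + (2 ^ n + 2 ^ n))%N by rewrite expnS; lia.
rewrite /orb iterS -/(orb _ _ _) /step /= /qa /qb !expr2 e1 e2.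
by split; do ![apply: bihomogD]; apply: bihomogM (hc _) _; apply: bihomogM.
Qed.

Lemma Psi_bihomog n : bihomog (2 ^ n - 1) (2 ^ n).+1 (Psi n).
Proof.
have [h1 h2] := phi_iter_bihomog n.
by apply: bihomogB; [exact: (bihomogM bihomogY h1) | exact: (bihomogM bihomogX h2)].
Qed.

Lemma ev_Psi (T : comNzRingType) (c : 'I_6 -> T) x y n :
  evXY c x y (Psi n) = y * (orb c n (x, y)).1 - x * (orb c n (x, y)).2.
Proof. rewrite -ev_phi_iter /Psi; move: (phi_iter n).1 (phi_iter n).2 => P Q.
rewrite evXYB.
rewrite (evXYM c x y vY P).
rewrite (evXYM c x y vX Q).
by rewrite evXY_X evXY_Y.
Qed.

Lemma Per_per (K : fieldType) (c : 'I_6 -> K) x y P n :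
  is_point P -> reps c x y P -> (Per n P <-> per c (x, y) n).
Proof.
move=> hP hrp; rewrite /Per /= -/(Psi n); rewrite (hrp _ _ _ (Psi_bihomog n)) ev_Psi /per /par /=.
split=> [[_ /eqP]|/eqP h]; first by rewrite subr_eq0 mulrC => /eqP ->; rewrite mulrC.
by split => //; apply/eqP; rewrite subr_eq0 mulrC h mulrC.
Qed.

Section SetScope.
Local Open Scope classical_set_scope.

(** Exact period for points in the sense of bihomogeneous primes. *)
Definition exact_pt n (P : set A2XY) := [/\ (0 < n)%N, Per n P & forall m, (0 < m < n)%N -> ~ Per m P].

Lemma exact_ptP (K : fieldType) (c : 'I_6 -> K) x y P n :
  is_point P -> reps c x y P -> (exact_pt n P <-> exact_per c (x, y) n).
Proof.
move=> hP hrp; split=> -[n0 h1 h2]; split => //.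
- exact/(Per_per _ hP hrp).
- by move=> m /h2 h; apply/negP => /(Per_per _ hP hrp).
- exact/(Per_per _ hP hrp).
- by move=> m /h2 h /(Per_per _ hP hrp); apply/negP.
Qed.

Lemma exact_pt_exists n P : (0 < n)%N -> Per n P -> exists2 d, (d %| n)%N & exact_pt d P.
Proof.
move=> n0 pn; have hP : is_point P by case: pn.
have [K [c [x [y [[h1 h2] h3 _]]]]] := point_reps hP.
have [d dn hd] := exact_exists h1 h2 n0 ((Per_per _ hP h3).1 pn).
by exists d; [exact: dn|apply: (exact_ptP d hP h3).2 hd].
Qed.

(** * Irreducible components of Per_n and points of Per*_n *)
(** The closure of the point [P]. *)
Definition Vset (P : set A2XY) : set (set A2XY) := [set Q | is_point Q /\ P `<=` Q].

Lemma is_point1 P : is_point P -> ~ P 1.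
Proof. by case=> /prime_setP []. Qed.

(** An irreducible closed set is the closure of its generic point, whose ideal
    is the intersection of its points. *)
Lemma generic_point C : Zclosed C -> Zirreducible C -> exists2 P, is_point P & C = Vset P.
Proof.
move=> [E CE] [[Q0 CQ0] irr].
have Cpt Q : C Q -> is_point Q by rewrite CE => -[].
pose P : set A2XY := [set f | forall Q, C Q -> Q f].
have PQ Q : C Q -> P `<=` Q by move=> CQ f; apply.
exists P.
  split.
  - apply/prime_setP; split; first split.
    + by move=> Q /Cpt [/prime_setP [[]]].
    + by move=> f h Pf Ph Q CQ; have [/prime_setP [[_ D _] _ _] _ _ _] := Cpt _ CQ; apply: D; [exact: Pf|exact: Ph].
    + by move=> a f Pf Q CQ; have [/prime_setP [[_ _ M] _ _] _ _ _] := Cpt _ CQ; apply: M; exact: Pf.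
    + by move=> /(PQ _ CQ0); apply: is_point1; apply: Cpt.
    + move=> f h Pfh.
      have Zc g : Zclosed [set Q | is_point Q /\ [set g] `<=` Q] by exists [set g].
      have [|h1|h1] := irr _ _ (Zc f) (Zc h).
      * move=> Q CQ; have hQ := Cpt _ CQ; have [/prime_setP [_ _ Qp] _ _ _] := hQ.
        by case: (Qp f h (Pfh _ CQ)) => Qf; [left|right]; split => // _ ->.
      * by left=> Q /h1 [_]; apply.
      * by right=> Q /h1 [_]; apply.
  - by move=> f d e Pf Q CQ; have [_ h _ _] := Cpt _ CQ; apply: h; exact: Pf.
  - by move=> /(PQ _ CQ0); have [_ _ h _] := Cpt _ CQ0.
  - by move=> [/(PQ _ CQ0) h1 /(PQ _ CQ0) h2]; have [_ _ _ h] := Cpt _ CQ0; apply: h.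
apply/seteqP; split=> [Q CQ|Q [hQ PsQ]].
  by split; [exact: Cpt|exact: PQ].
rewrite CE; split => // f Ef; apply: PsQ => R; rewrite CE => -[_]; exact.
Qed.

Lemma Vset_self P : is_point P -> Vset P P. Proof. by move=> h; split. Qed.

Lemma Vset_closed P : Zclosed (Vset P). Proof. exists P; rewrite /Vset. reflexivity. Qed.

Lemma Vset_irr P : is_point P -> Zirreducible (Vset P).
Proof.
move=> hP; split; first by exists P; exact: Vset_self.
move=> Z1 Z2 [E1 ->] [E2 ->] sub.
case: (sub P); [exact: Vset_self| |] => -[_ h]; [left|right] => Q [hQ PQ]; split => //; exact: subset_trans PQ.
Qed.

(** Below a point containing [F] there is a minimal one (Zorn). *)
Lemma minimal_point (F : A2XY) P : is_point P -> P F -> exists M, [/\ is_point M, M F, M `<=` P &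
  forall N, is_point N -> N F -> N `<=` M -> N = M].
Proof.
move=> hP PF.
pose good (M : set A2XY) := [/\ is_point M, M F & M `<=` P].
(* Zorn for unions is applied to complements, and the empty set stands for the
   union of the empty chain. *)
pose Q (U : set A2XY) := U = set0 \/ good (~` U).
have gP : good P by split.
have [|U [QU Umax]] := @Zorn_bigcup A2XY Q.
  move=> G GQ tot; have [h|/nonemptyPn h] := pselect ((\bigcup_(X in G) X) !=set0); last by left.
  right; case: h => z [J0 GJ0 J0z].
  have gd J x : G J -> J x -> good (~` J) by move=> /GQ [->|].
  have [hJ0 J0F J0P] := gd _ _ GJ0 J0z.
  have mem f : (~` \bigcup_(X in G) X) f <-> forall J, G J -> ~ J f.
    by split=> [h J GJ Jf|h [J GJ Jf]]; [apply: h; exists J | exact: h GJ Jf].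
  have pt J : G J -> (exists w, J w) -> is_point (~` J) by move=> GJ [w]; move=> /(gd _ _ GJ) [].
  split; first split.
  - apply/prime_setP; split; first split.
    + apply/mem => J GJ J0'; have [/prime_setP [[h _ _] _ _] _ _ _] := pt J GJ (ex_intro _ _ J0'); exact: h.
    + move=> f h /mem hf /mem hh; apply/mem => J GJ Jfh.
      have [/prime_setP [[_ D _] _ _] _ _ _] := pt J GJ (ex_intro _ _ Jfh).
      by apply: (D f h) => //; [exact: hf|exact: hh].
    + move=> a f /mem hf; apply/mem => J GJ Jaf.
      have [/prime_setP [[_ _ M] _ _] _ _ _] := pt J GJ (ex_intro _ _ Jaf).
      by apply: (M a f) => //; exact: hf.
    + by move=> /mem h; apply: (is_point1 hJ0); exact: h GJ0.
    + move=> f h /mem hfh; apply: contrapT => /not_orP[/contrapT [J GJ Jf] /contrapT [J' GJ' Jh]].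
      suff [L GL [Lf Lh]] : exists2 L, G L & L f /\ L h.
        have [/prime_setP [_ _ pr] _ _ _] := pt L GL (ex_intro _ _ Lf).
        by case: (pr f h (hfh _ GL)).
      by have [s|s] := tot _ _ GJ GJ'; [exists J' => //; split => //; exact: s | exists J => //; split => //; exact: s].
  - move=> f d e /mem hf; apply/mem => J GJ Jp.
    have [_ h _ _] := pt J GJ (ex_intro _ _ Jp).
    by apply: (h f d e) => //; exact: hf.
  - by move=> /mem h; have [_ _ h' _] := hJ0; apply: h'; exact: h GJ0.
  - by move=> [/mem h1 /mem h2]; have [_ _ _ h'] := hJ0; apply: h'; split; [exact: h1 GJ0|exact: h2 GJ0].
  - apply/mem => J GJ JF; have [_ h _] := gd _ _ GJ JF; exact: h.
  - by move=> f /mem h; apply: J0P; exact: h GJ0.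
have gU : good (~` U).
  case: QU => // U0; case: (Umax (~` P)); last by right; rewrite setCK.
  rewrite U0 properEneq; split; last by [].
  by apply/eqP => e; have := is_point1 hP; rewrite -[~ P 1]/((~` P) 1) -e.
exists (~` U); case: gU => hM MF MP; split => // N hN NF NM.
apply: contrapT => ne; apply: (Umax (~` N)); last first.
  by right; rewrite setCK; split => //; exact: subset_trans MP.
rewrite properEneq; split; last by rewrite -[U]setCK; exact: subsetC.
by apply/eqP => e; apply: ne; rewrite e setCK.
Qed.

Lemma Per_component n P : Per n P -> exists2 M, [/\ is_point M, Per n M & M `<=` P] & irred_component (Per n) (Vset M).
Proof.
move=> [hP PF]; have [M [hM MF MP Mmin]] := minimal_point hP PF.
exists M; first by [].
split; [exact: Vset_closed|exact: Vset_irr| |].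
  by move=> Q [hQ MQ]; split => //; exact: MQ.
move=> C' cC' iC' C'Per sub; have [N hN eC'] := generic_point cC' iC'.
have [_ NM] : Vset N M by rewrite -eC'; apply: sub; exact: Vset_self.
have [_ NF] : Per n N by apply: C'Per; rewrite eC'; exact: Vset_self.
by rewrite eC' (Mmin N hN NF NM).
Qed.

Lemma Per_star_sub k n P : Per_star_rec k n P -> Per n P.
Proof.
case: k => [//|k] /=; case: ifP => // _ [C [[_ _ h _] _] CP]; exact: h.
Qed.

Lemma Per_star_up k n P Q : Per_star_rec k n P -> is_point Q -> P `<=` Q -> Per_star_rec k n Q.
Proof.
case: k => [//|k] /=; case: ifP => [_ [hP PP] hQ PQ|_].
  by split => //; exact: PQ.
move=> [C [[cC h2 h3 h4] h5] CP] hQ PQ; exists C => //; move: CP; case: cC => E -> [hP EP].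
by split => //; exact: subset_trans PQ.
Qed.

(** A point of exact period [n] lies on a component of Per_n with generic point
    of exact period [n]: the periods of a point persist under specialization,
    and so no smaller Per*_m contains the component. *)
Lemma exact_Per_star k n P : (n <= k)%N -> exact_pt n P -> Per_star_rec k n P.
Proof.
move=> nk [n0 pn hn]; case: k nk => [|k nk]; first by lia.
rewrite /=; case: ifP => // n1.
have [M [hM MF MP] comp] := Per_component pn.
exists (Vset M); last by split => //; case: pn.
split => //; move=> /(_ P) [|m [mn ml] /Per_star_sub pm]; first by split => //; case: pn.
by apply: (hn m) => //; rewrite ml andbT; apply: dvdn_gt0 mn.
Qed.

(** A point of Per*_n specializes a point of exact period [n]; its own exact
    period can be smaller. *)
Lemma Per_star_exact n P : (0 < n)%N -> Per_star n P -> exists M, [/\ is_point M, M `<=` P & exact_pt n M].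
Proof.
move=> n0; rewrite /Per_star; case: n n0 => // n _; rewrite [Per_star_rec _ _]/=.
case: ifP => [n1 pn|n1].
  have n_0 : n = 0%N by lia.
  subst n; exists P; split => //; [by case: pn| split => // m; lia].
move=> [C [[cC iC CP _] nsub] CPP].
have [M hM eC] := generic_point cC iC.
have CM : C M by rewrite eC; exact: Vset_self.
exists M; split => //; first by move: CPP; rewrite eC => -[].
have [d dn hd] := exact_pt_exists (ltn0Sn n) (CP _ CM).
have [<- //|ne] := eqVneq d n.+1.
have dl : (d < n.+1)%N by rewrite ltn_neqAle ne (dvdn_leq _ dn).
case: nsub => Q; rewrite eC => -[hQ MQ]; exists d => //.
by apply: Per_star_up (MQ) => //; apply: exact_Per_star.
Qed.
End SetScope.

(** * Moebius inversion *)
Lemma moebius_coprime_prime p e : prime p -> (0 < e)%N -> ~~ (p %| e)%N ->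
  moebius (p * e) = - moebius e.
Proof.
move=> pp e0 npe; have p0 := prime_gt0 pp.
have pe : perm_eq (primes (p * e)) (p :: primes e).
  apply: uniq_perm; rewrite ?primes_uniq //= ?primes_uniq ?andbT.
    by rewrite mem_primes pp e0.
  by move=> q; rewrite primesM // primes_prime // !inE.
rewrite /moebius (perm_all _ pe) (perm_size pe) /=.
rewrite lognM // logn_prime // eqxx lognE pp e0 (negbTE npe) /=.
rewrite (_ : all _ (primes e) = all (fun q => logn q e == 1%N) (primes e)); last first.
  apply: eq_in_all => q; rewrite mem_primes => /and3P[pq _ qe].
  rewrite lognM // logn_prime // (_ : (q == p) = false) //.
  by apply: contraNF npe => /eqP <-.
by case: ifP => _; rewrite ?oppr0 // exprS mulN1r.
Qed.

Lemma moebius_sq p e : prime p -> (0 < e)%N -> (p ^ 2 %| e)%N -> moebius e = 0.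
Proof.
move=> pp e0 h; rewrite /moebius; case: allP => // /(_ p).
rewrite mem_primes pp e0 (dvdn_trans _ h) ?dvdn_exp // => /(_ isT) /eqP h1.
by move: h; rewrite pfactor_dvdn // h1.
Qed.

Lemma sum_moebius m : (0 < m)%N -> \sum_(e <- divisors m) moebius e = (m == 1)%N%:R.
Proof.
move=> m0; case: (ltngtP m 1) => [|m1|->]; [by lia| |]; last first.
  by rewrite (_ : divisors 1 = [:: 1%N]) // big_seq1.
set p := pdiv m; have pp : prime p by exact: pdiv_prime.
have pm : (p %| m)%N by exact: pdiv_dvd.
have p0 := prime_gt0 pp.
rewrite (bigID (fun e => p %| e)%N) /=.
have -> : \sum_(e <- divisors m | (p %| e)%N) moebius e =
  \sum_(e <- divisors m | ~~ (p %| e)%N) moebius (p * e).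
  transitivity (\sum_(e <- [seq e <- divisors m | (p %| e)%N && ~~ (p ^ 2 %| e)%N]) moebius e).
    rewrite big_filter big_mkcondr [LHS]big_seq_cond [RHS]big_seq_cond.
    apply: eq_bigr => e /andP[]; rewrite -dvdn_divisors // => em _; case: ifP => // /negbFE h.
    by apply: moebius_sq pp _ h; exact: dvdn_gt0 em.
  rewrite -[RHS]big_filter -(big_map (muln p) xpredT).
  apply: perm_big; apply: uniq_perm.
  - by rewrite filter_uniq // divisors_uniq.
  - rewrite map_inj_uniq ?filter_uniq ?divisors_uniq // => a b /eqP.
    by rewrite eqn_pmul2l // => /eqP.
  move=> e; rewrite mem_filter -dvdn_divisors //; apply/idP/mapP.
    move=> /andP[/andP[/dvdnP [k ek] np2] em]; exists k; last by rewrite ek mulnC.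
    rewrite mem_filter -dvdn_divisors //; apply/andP; split.
      apply: contra np2 => /dvdnP [l kl]; apply/dvdnP; exists l; rewrite ek kl expnS expn1 mulnA //.
    by apply: dvdn_trans em; rewrite ek dvdn_mulr.
  move=> [k]; rewrite mem_filter -dvdn_divisors // => /andP[nk km] ->.
  rewrite dvdn_mulr //= expnS expn1 dvdn_pmul2l // nk /=.
  by rewrite Gauss_dvd ?pm // prime_coprime.
rewrite -big_split /= big_seq_cond big1 // => e /andP[]; rewrite -dvdn_divisors // => em npe.
by rewrite moebius_coprime_prime ?addNr // (dvdn_gt0 m0).
Qed.

Lemma sum_nu n : (0 < n)%N -> \sum_(d <- divisors n) nu d = (2 ^ n + 1)%N%:Z.
Proof.
move=> n0; rewrite /nu.
transitivity (\sum_(d <- divisors n) \sum_(r <- divisors n | (r %| d)%N) moebius (d %/ r) * (2 ^ r + 1)%N%:Z).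
  rewrite big_seq [RHS]big_seq; apply: eq_bigr => d; rewrite -dvdn_divisors // => dn.
  rewrite -[RHS]big_filter; apply: perm_big; apply: uniq_perm; rewrite ?filter_uniq ?divisors_uniq //.
  have d0 := dvdn_gt0 n0 dn.
  move=> r; rewrite mem_filter -!dvdn_divisors //.
  by case: (boolP (r %| d)%N) => // rd; rewrite (dvdn_trans rd dn).
rewrite (exchange_big_dep xpredT) //=.
transitivity (\sum_(r <- divisors n) (n == r)%:R * (2 ^ r + 1)%N%:Z).
  rewrite big_seq [RHS]big_seq; apply: eq_bigr => r; rewrite -dvdn_divisors // => rn.
  rewrite -big_distrl /=; congr (_ * _).
  have r0 := dvdn_gt0 n0 rn.
  have q0 : (0 < n %/ r)%N by rewrite divn_gt0 // dvdn_leq.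
  have -> : (n == r) = (n %/ r == 1)%N.
    by rewrite -[RHS](eqn_pmul2r r0) divnK // mul1n.
  rewrite -sum_moebius // -[LHS]big_filter.
  transitivity (\sum_(e <- [seq (d %/ r)%N | d <- [seq d <- divisors n | (r %| d)%N]]) moebius e).
    by rewrite big_map.
  apply: perm_big; apply: uniq_perm; rewrite ?divisors_uniq //.
    rewrite map_inj_in_uniq ?filter_uniq ?divisors_uniq // => a b.
    rewrite !mem_filter => /andP[ra _] /andP[rb _] /(congr1 (muln^~ r)) /=.
    by rewrite !divnK.
  move=> e; rewrite -dvdn_divisors //; apply/mapP/idP.
    move=> [d]; rewrite mem_filter -dvdn_divisors // => /andP[rd dn] ->.
    by rewrite -(dvdn_pmul2r r0) !divnK.
  move=> en; exists (e * r)%N; last by rewrite mulnK.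
  by rewrite mem_filter dvdn_mull //= -dvdn_divisors // -(divnK rn) dvdn_pmul2r.
rewrite (bigD1_seq n) ?divisors_uniq -?dvdn_divisors //= eqxx mul1r big1 ?addr0 // => r.
by rewrite eq_sym => /negbTE ->; rewrite mul0r.
Qed.

(** * Density of integral points *)
Section Dense.
Variable n : nat.
(* Polynomials in n+1 variables as univariate polynomials over polynomials in
   n variables. *)
Definition uni_var (i : 'I_n.+1) : {poly {mpoly int[n]}} :=
  if unlift ord0 i is Some j then ('X_j)%:P else 'X.
Definition mp_uni (p : {mpoly int[n.+1]}) : {poly {mpoly int[n]}} :=
  mmap (polyC \o @mpolyC n _) uni_var p.
HB.instance Definition _ := GRing.RMorphism.copy mp_uni (mmap (polyC \o @mpolyC n _) uni_var).
Definition mp_wid (p : {mpoly int[n]}) : {mpoly int[n.+1]} :=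
  mmap (@mpolyC n.+1 _) (fun j => 'X_(lift ord0 j)) p.
HB.instance Definition _ := GRing.RMorphism.copy mp_wid (mmap (@mpolyC n.+1 _) (fun j => 'X_(lift ord0 j))).
Definition mp_mul (q : {poly {mpoly int[n]}}) : {mpoly int[n.+1]} :=
  (map_poly mp_wid q).['X_ord0].

Lemma mp_uniK p : mp_mul (mp_uni p) = p.
Proof.
have -> : mp_mul (mp_uni p) = (horner_eval 'X_ord0 \o map_poly mp_wid \o mp_uni) p by [].
apply: (@mpoly_rm_eq _ _ _ (GRing.RMorphism.clone _ _ (horner_eval 'X_ord0 \o map_poly mp_wid \o mp_uni) _) (GRing.RMorphism.clone _ _ idfun _)) => [r|i] /=.
  by rewrite /horner_eval /mp_uni mmapC /= map_polyC /= hornerC /mp_wid mmapC.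
rewrite /horner_eval /mp_uni mmapX mmap1U /uni_var; case: unliftP => [j ->|->].
  by rewrite map_polyC /= hornerC /mp_wid mmapX mmap1U.
by rewrite map_polyX hornerX.
Qed.

Lemma mp_uni_eval (t : int) (v : 'I_n -> int) p :
  p.@[fun i => if unlift ord0 i is Some j then v j else t] = (map_poly (meval v) (mp_uni p)).[t].
Proof.
apply: (@mpoly_rm_eq _ _ _ (GRing.RMorphism.clone _ _ (meval (fun i => if unlift ord0 i is Some j then v j else t)) _) (GRing.RMorphism.clone _ _ (horner_eval t \o map_poly (meval v) \o mp_uni) _)) => [r|i] /=.
  by rewrite mevalC /horner_eval /mp_uni mmapC /= map_polyC /= hornerC mevalC.
rewrite mevalXU /horner_eval /mp_uni mmapX mmap1U /uni_var; case: unliftP => [j _|_].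
  by rewrite map_polyC /= hornerC mevalXU.
by rewrite map_polyX hornerX.
Qed.
End Dense.

Lemma poly_nonroot (q : {poly int}) : q != 0 -> exists t : int, q.[t] != 0.
Proof.
move=> q0; apply: contrapT => h.
have := @max_poly_roots _ q [seq i%:Z | i <- iota 0 (size q)] q0.
rewrite size_map size_iota ltnn map_inj_uniq ?iota_uniq; last by move=> a b [].
move=> /(_ _ isT) H; suff : false by []; apply: H.
apply/allP => _ /mapP [i _ ->]; apply/negPn/negP => /negP hi; apply: h; exists i%:Z; exact/negP.
Qed.

Lemma mpoly_nonzero_pt n (p : {mpoly int[n]}) : p != 0 -> exists v : 'I_n -> int, p.@[v] != 0.
Proof.
elim: n p => [|n IH] p p0.
  exists (fun _ => 0); rewrite (nvar0_mpolyC p) mevalC.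
  by apply: contra p0 => /eqP h; rewrite (nvar0_mpolyC p) h mpolyC0.
have q0 : mp_uni p != 0.
  by apply: contra p0 => /eqP h; rewrite -[p]mp_uniK h /mp_mul rmorph0 horner0.
have [|v hv] := IH (lead_coef (mp_uni p)); first by rewrite lead_coef_eq0.
have [t ht] : exists t, (map_poly (meval v) (mp_uni p)).[t] != 0.
  by apply: poly_nonroot; rewrite map_poly_eq0_id0.
by exists (fun i => if unlift ord0 i is Some j then v j else t); rewrite mp_uni_eval.
Qed.

(** An integral coefficient vector in the ring [K]. *)
Definition castc (K : nzRingType) (v : 'I_6 -> int) : 'I_6 -> K := fun i => (v i)%:~R.

Lemma ev_castc (K : comNzRingType) v (p : A2) : eval_coefs (castc K v) p = (p.@[v])%:~R.
Proof.
apply: (@mpoly_rm_eq _ _ _ (GRing.RMorphism.clone _ _ (eval_coefs (castc K v)) _) (GRing.RMorphism.clone _ _ (intr \o meval v) _)) => [r|i] /=.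
  by rewrite /eval_coefs mmapC mevalC.
by rewrite ev_X mevalXU.
Qed.

Lemma A2_dense (p : A2) : p != 0 -> exists c : 'I_6 -> algC, eval_coefs c p != 0.
Proof.
by move=> /mpoly_nonzero_pt [v hv]; exists (castc _ v); rewrite ev_castc intr_eq0.
Qed.

Lemma A2_eq0 (g p : A2) : g != 0 -> (forall c : 'I_6 -> algC, eval_coefs c g != 0 -> eval_coefs c p = 0) -> p = 0.
Proof.
move=> g0 h; apply/eqP/negPn/negP => p0.
have [c] := A2_dense (mulf_neq0 g0 p0).
by rewrite evM mulf_eq0 negb_or => /andP[hg /eqP]; rewrite h.
Qed.

(** * Polynomials with homogeneous coefficients *)
(* Polynomials over A_2 in the affine coordinate x = X/Y. *)
Notation PA := {poly {mpoly int[6]}}.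
(** All coefficients of [p] are homogeneous of degree [D]. *)
Definition homc D (p : PA) := forall i, p`_i \is D.-homog.

Lemma homcD D p q : homc D p -> homc D q -> homc D (p + q).
Proof. by move=> hp hq i; rewrite coefD rpredD. Qed.
Lemma homcN D p : homc D p -> homc D (- p).
Proof. by move=> hp i; rewrite coefN rpredN. Qed.
Lemma homcB D p q : homc D p -> homc D q -> homc D (p - q).
Proof. by move=> hp hq; apply: homcD => //; exact: homcN. Qed.
Lemma homc0 D : homc D 0.
Proof. by move=> i; rewrite coef0 dhomog0. Qed.
Lemma homcM D E p q : homc D p -> homc E q -> homc (D + E) (p * q).
Proof. by move=> hp hq i; rewrite coefM rpred_sum // => j _; apply: dhomogM. Qed.
Lemma homcC D a : a \is D.-homog -> homc D a%:P.
Proof. by move=> ha i; rewrite coefC; case: eqP => // _; exact: dhomog0. Qed.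
Lemma homcXn n : homc 0 'X^n.
Proof. by move=> i; rewrite coefXn; case: eqP => _; [exact: dhomog1|exact: dhomog0]. Qed.
Lemma homcX : homc 0 'X. Proof. exact: (homcXn 1). Qed.
Lemma homc1 : homc 0 1. Proof. exact: (homcXn 0). Qed.
Lemma homcZ D E a p : a \is E.-homog -> homc D p -> homc (E + D) (a *: p).
Proof. by move=> ha hp i; rewrite coefZ; apply: dhomogM. Qed.

Lemma homogX D k (p : A2) : p \is D.-homog -> p ^+ k \is (D * k)%N.-homog.
Proof. exact: dhomogMn. Qed.

(** Pseudo-division preserves homogeneity of the coefficients. *)
Lemma pdiv_hom D0 m (Phi : PA) d (p : PA) : homc D0 Phi -> (size Phi <= m.+1)%N -> homc d p ->
  exists k q r, [/\ Phi`_m ^+ k.+1 *: p = q * Phi + r, (size r <= m)%N,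
     homc (d + D0 * k) q & homc (d + D0 * k.+1) r].
Proof.
move=> hPhi sPhi; have hl : Phi`_m \is D0.-homog := hPhi m.
have [s] := ubnP (size p); elim: s => // s IH in d p * => ps hp.
have [le|gt] := leqP (size p) m.
  exists 0%N, 0, (Phi`_m *: p); rewrite expr1 mul0r add0r; split => //.
  - exact: leq_trans (size_scale_leq _ _) le.
  - exact: homc0.
  - by rewrite muln1 addnC; exact: homcZ.
set e := (size p).-1; have se : size p = e.+1 by rewrite /e prednK //; lia.
pose t := (p`_e)%:P * 'X^(e - m).
have ht : homc d t by rewrite -[d]addn0; apply: homcM; [exact: homcC (hp e)|exact: homcXn].
pose p' := Phi`_m *: p - t * Phi.
have hp' : homc (d + D0) p'.
  by apply: homcB; [rewrite addnC; exact: homcZ | exact: homcM].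
have sp' : (size p' < s)%N.
  apply: leq_trans (_ : size p' < e.+1)%N _; last by rewrite -se; lia.
  apply/leq_sizeP => j; rewrite leq_eqVlt => /orP[/eqP <-|ej].
    rewrite /p' coefB coefZ /t mulrAC coefMXn ltnNge leq_subr /= subKn ?coefCM; last by lia.
    by rewrite mulrC subrr.
  have pj : p`_j = 0 by rewrite nth_default // se.
  rewrite /p' coefB coefZ /t mulrAC coefMXn coefCM pj mulr0.
  case: ifP => _; rewrite ?subrr // (nth_default 0 (s := Phi)) ?mulr0 ?subrr //.
  by apply: leq_trans sPhi _; lia.
have [k [q [r [e1 sr hq hr]]]] := IH _ _ sp' hp'.
exists k.+1, (q + Phi`_m ^+ k.+1 *: t), r; split => //.
- rewrite exprSr -scalerA -[Phi`_m *: p](subrK (t * Phi)) -/p' scalerDr e1 mulrDl.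
  by rewrite -scalerAl; ring.
- apply: homcD; first by move: hq; rewrite -addnA mulnS.
  by rewrite addnC; apply: homcZ => //; exact: homogX.
- by move: hr; rewrite -addnA -mulnS.
Qed.

(** The universal coefficients, the orbit of the point (x : 1), and the equation
    of the affine part of Per_n. *)
Definition fcP : 'I_6 -> PA := fun i => (gen_coefs i)%:P.
Definition orbP n : PA * PA := orb fcP n ('X, 1).
Definition psi n : PA := (orbP n).1 - 'X * (orbP n).2.

Lemma orbP_hom n : homc (2 ^ n - 1) (orbP n).1 /\ homc (2 ^ n - 1) (orbP n).2.
Proof.
rewrite /orbP; elim: n => [|n [h1 h2]]; first by split; [exact: homcX | exact: homc1].
have hc i : homc 1 (fcP i) by apply: homcC; exact: X_homog.
have e1 : (2 ^ n.+1 - 1 = 1 + ((2 ^ n - 1) + (2 ^ n - 1)))%N by have := expn_gt0 2 n; rewrite expnS; lia.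
rewrite /orb iterS -/(orb _ _ _) /step /= /qa /qb !expr2 e1.
by split; do ![apply: homcD]; apply: homcM (hc _) _; apply: homcM.
Qed.

Lemma orbP_size n : (size (orbP n).1 <= (2 ^ n).+1)%N /\ (size (orbP n).2 <= (2 ^ n).+1)%N.
Proof.
rewrite /orbP; elim: n => [|n [h1 h2]]; first by rewrite /= size_polyX size_poly1.
have hM (p q : PA) : (size p <= (2 ^ n).+1)%N -> (size q <= (2 ^ n).+1)%N -> (size (p * q)%R <= (2 ^ n.+1).+1)%N.
  by move=> hp hq; apply: leq_trans (size_polyMleq _ _) _; rewrite expnS; lia.
have hc i (p : PA) b : (size p <= b)%N -> (size (fcP i * p)%R <= b)%N.
  by rewrite /fcP mul_polyC; apply: leq_trans; exact: size_scale_leq.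
have hD (p q : PA) b : (size p <= b)%N -> (size q <= b)%N -> (size (p + q)%R <= b)%N.
  by move=> hp hq; apply: leq_trans (size_polyD _ _) _; rewrite geq_max hp.
rewrite /orb iterS -/(orb _ _ _) /step /= /qa /qb !expr2.
by split; do ![apply: (hD)]; apply: (hc); apply: (hM).
Qed.

Lemma psi_hom n : homc (2 ^ n - 1) (psi n).
Proof.
have [h1 h2] := orbP_hom n; apply: homcB => //.
by rewrite -[X in homc X]add0n; apply: homcM => //; exact: homcX.
Qed.

Lemma psi_size_le n : (size (psi n) <= (2 ^ n).+2)%N.
Proof.
have [h1 h2] := orbP_size n; apply: leq_trans (size_polyD _ _) _.
rewrite geq_max size_polyN (leq_trans h1) //=.
apply: leq_trans (size_polyMleq _ _) _; by rewrite size_polyX add2n /= ltnS.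
Qed.

Section Spec.
Variables (K : comNzRingType) (c : 'I_6 -> K).
(** Specialization of the coefficients. *)
Definition pc (p : PA) : {poly K} := map_poly (eval_coefs c) p.
HB.instance Definition _ := GRing.RMorphism.copy pc (map_poly (eval_coefs c)).
Lemma pcM p q : pc (p * q) = pc p * pc q. Proof. exact: rmorphM. Qed.
Lemma pcD p q : pc (p + q) = pc p + pc q. Proof. exact: rmorphD. Qed.
Lemma pcZ a p : pc (a *: p) = eval_coefs c a *: pc p. Proof. exact: map_polyZ. Qed.
Lemma pc_prod (I : Type) (r : seq I) (F : I -> PA) : pc (\prod_(i <- r) F i) = \prod_(i <- r) pc (F i).
Proof. exact: rmorph_prod. Qed.

Lemma pc_orb n : (pc (orbP n).1, pc (orbP n).2) = orb (fun i => (c i)%:P) n ('X, 1).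
Proof.
rewrite /orbP (rm_orb pc) /= rmorph1 /pc map_polyX; congr (orb _ _ _).
by apply/funext => i /=; rewrite /fcP map_polyC /= ev_X.
Qed.

Lemma pc_psi n : pc (psi n) = (orb (fun i => (c i)%:P) n ('X, 1)).1 - 'X * (orb (fun i => (c i)%:P) n ('X, 1)).2.
Proof.
rewrite -pc_orb /psi /= /pc rmorphB rmorphM /= map_polyX //.
Qed.

Lemma pc_psi_eval n x : (pc (psi n)).[x] = (orb c n (x, 1)).1 - x * (orb c n (x, 1)).2.
Proof.
rewrite pc_psi hornerD hornerN hornerM hornerX.
have := rm_orb (horner_eval x) (fun i => (c i)%:P) n ('X, 1).
rewrite /= /horner_eval hornerX hornerC.
have -> : (horner_eval x \o (fun i => (c i)%:P)) = c by apply/funext => i /=; rewrite /horner_eval hornerC.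
by move=> <-.
Qed.
End Spec.

Lemma root_psi (K : fieldType) (c : 'I_6 -> K) n x : root (pc c (psi n)) x = per c (x, 1) n.
Proof. by rewrite rootE pc_psi_eval /per /par /= mulr1 mulrC subr_eq0 mulrC. Qed.

(** * Generic periodic points are distinct and finite *)
(** The reference map is u -> u^2 in the coordinate u = X/(2X + Y), in which
    X/Y = infinity becomes u = 1/2 and is not periodic. *)
Lemma orb_ref (T : comNzRingType) (c : 'I_6 -> T) n u :
  [/\ c 0 = 1, c 1 = 0, c 2 = 0, c 3 = 2 & c 4 = 4 /\ c 5 = 1] ->
  orb c n u = (u.1 ^+ (2 ^ n), (2 * u.1 + u.2) ^+ (2 ^ n) - 2 * u.1 ^+ (2 ^ n)).
Proof.
move=> [h0 h1 h2 h3 [h4 h5]]; elim: n => [|n IH].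
  by rewrite expn0 !expr1 addrC addKr; case: u.
rewrite /orb iterS -/(orb _ _ _) IH /step /qa /qb h0 h1 h2 h3 h4 h5 /= expnSr !exprM.
by congr (_, _); ring.
Qed.

Definition cref (K : nzRingType) : 'I_6 -> K := mkc 1 0 0 2 4 1.


Lemma psi_ref (K : comNzRingType) n :
  pc (cref K) (psi n) = 'X ^+ (2 ^ n) - 'X * ((2 * 'X + 1) ^+ (2 ^ n) - 2 * 'X ^+ (2 ^ n)).
Proof.
rewrite pc_psi orb_ref //=; split; rewrite /cref /mkc /tnth /= ?polyC0 ?polyC1 //.
- by rewrite rmorph_nat.
- by split; rewrite ?polyC1 // rmorph_nat.
Qed.

Lemma psi_ref_coef n : (0 < n)%N -> (pc (cref algC) (psi n))`_(2 ^ n).+1 != 0.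
Proof.
move=> n0; rewrite psi_ref; set N := (2 ^ n)%N.
have s1 : size (2 * 'X + 1 : {poly algC}) = 2.
  by rewrite -polyC1 size_MXaddC -(rmorph_nat (@polyC algC)) polyC_eq0 pnatr_eq0 /= size_polyC pnatr_eq0.
have l1 : lead_coef (2 * 'X + 1 : {poly algC}) = 2.
  by rewrite lead_coefE s1 /= coefD coefMX coef1 /= -(rmorph_nat (@polyC algC)) coefC addr0.
have c2 : ((2 * 'X + 1 : {poly algC}) ^+ N)`_N = 2 ^+ N.
  rewrite -l1 -lead_coef_exp lead_coefE size_exp s1 mul1n //.
have ->: ('X ^+ N - 'X * ((2 * 'X + 1) ^+ N - 2 * 'X ^+ N) : {poly algC})`_N.+1 = 2 - 2 ^+ N.
  rewrite coefB coefXn coefXM /= coefB c2 -(rmorph_nat (@polyC algC)) coefCM coefXn eqxx.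
  by rewrite (gtn_eqF (ltnSn N)) mulr1 sub0r opprB.
rewrite subr_eq0 -natrX eqr_nat; apply/eqP => h.
have N2 : (2 <= N)%N by rewrite /N -{1}(expn1 2) leq_exp2l.
by have := ltn_expl N (isT : (1 < 2)%N); rewrite -h ltnNge N2.
Qed.

(** The fixed points of the iterate of u -> u^2 are simple. *)
Lemma psi_ref_sep n x : (0 < n)%N -> root (pc (cref algC) (psi n)) x -> ~~ root (pc (cref algC) (psi n))^`() x.
Proof.
move=> n0; rewrite psi_ref.
have [M [M0 ->]] : exists M, (0 < M)%N /\ (2 ^ n = M.+1)%N.
  exists (2 ^ n).-1; rewrite prednK ?expn_gt0 //; split=> //.
  by have := leq_exp2l 1 n (isT : (1 < 2)%N); rewrite n0 expn1; lia.
have two : (2 : {poly algC}) = 2%:P by rewrite rmorph_nat.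
rewrite !rootE two derivB derivXn derivM derivX derivB deriv_exp derivD deriv_mulC derivX -polyC1 derivC deriv_mulC derivXn !(hornerE, hornerMn) /=.
set u := 2 * x + 1.
have uE : u = 2 * x + 1 by [].
move=> /eqP h; apply/eqP => h'.
have hM : (M%:R : algC) != 0 by rewrite pnatr_eq0 -lt0n.
have e1 : x * u * (x ^+ M - u ^+ M) = 0.
  by rewrite -[RHS]h !exprS uE; ring.
have e2 : (M.+1)%:R * x ^+ M * u + 2 * x ^+ M * x - u ^+ M * u - 2 * M.+1%:R * x * u ^+ M = 0.
  rewrite -[RHS]h' uE !exprS; ring.
have [x0|x0] := eqVneq x 0.
  have u1 : u = 1 by rewrite uE x0 mulr0 add0r.
  move: e2; rewrite x0 u1 expr0n (gtn_eqF M0) expr1n !mulr0 !mul0r !mulr1 add0r sub0r subr0.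
  by move/eqP; rewrite oppr_eq0 oner_eq0.
have [u0|u0] := eqVneq u 0.
  move: e2; rewrite u0 expr0n (gtn_eqF M0) !mulr0 !subr0 add0r => /eqP.
  by rewrite !mulf_eq0 expf_eq0 (negbTE x0) pnatr_eq0 andbF.
move: e1 => /eqP; rewrite !mulf_eq0 (negbTE x0) (negbTE u0) /= subr_eq0 => /eqP e1.
have /eqP : x ^+ M * M%:R = 0 by rewrite -[RHS]e2 -e1 uE; ring.
by rewrite mulf_eq0 expf_eq0 (negbTE x0) (negbTE hM) andbF.
Qed.

Lemma alg_coprime (p q : {poly algC}) : (forall x, root p x -> ~~ root q x) -> coprimep p q.
Proof.
move=> h; rewrite coprimep_def; apply/negPn/negP => /closed_rootP [x].
by rewrite root_gcd => /andP[/h /negP].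
Qed.

Lemma psi_size n : (0 < n)%N -> size (psi n) = (2 ^ n).+2.
Proof.
move=> n0; apply/eqP; rewrite eqn_leq psi_size_le /= ltnNge; apply/negP => le.
have := psi_ref_coef n0; rewrite coef_map /= nth_default ?rmorph0 ?eqxx //.
Qed.

Lemma psi_lead_ref n : (0 < n)%N -> eval_coefs (cref algC) (lead_coef (psi n)) != 0.
Proof. by move=> n0; rewrite lead_coefE psi_size //= -coef_map; exact: psi_ref_coef. Qed.

(** The resultant commutes with specializations that preserve both degrees. *)
Lemma spec_resultant (R S : nzRingType) (f : {rmorphism R -> S}) (p q : {poly R}) :
  f (lead_coef p) != 0 -> f (lead_coef q) != 0 ->
  f (resultant p q) = resultant (map_poly f p) (map_poly f q).
Proof.
move=> hp hq; rewrite /resultant /Sylvester_mx !size_map_poly_id0 //.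
rewrite -det_map_mx /= map_col_mx; congr (\det (col_mx _ _));
  by apply: map_lin1_mx => v; rewrite map_poly_rV rmorphM /= map_rVpoly.
Qed.

Lemma prod_homog (I : Type) (r : seq I) (F : I -> A2) d : (forall i, F i \is d.-homog) ->
  \prod_(i <- r) F i \is (d * size r)%N.-homog.
Proof.
move=> h; elim: r => [|i r IH]; first by rewrite big_nil muln0 dhomog1.
by rewrite big_cons /= mulnS; apply: dhomogM.
Qed.

Lemma det_homog m (A : 'M[A2]_m) d : (forall i j, A i j \is d.-homog) ->
  \det A \is (d * size (index_enum 'I_m))%N.-homog.
Proof.
move=> h; apply: rpred_sum => s _; rewrite mulr_sign.
have hp : \prod_i A i (s i) \is (d * size (index_enum 'I_m))%N.-homog by exact: prod_homog.
by case: (odd_perm s) => //; rewrite rpredN.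
Qed.

(** A multiple of the discriminant of the equation of Per_n. *)
Definition disc n : A2 := resultant (psi n) (psi n)^`().

Lemma homc_deriv D p : homc D p -> homc D p^`().
Proof. by move=> h i; rewrite coef_deriv; apply: rpredMn. Qed.

Lemma disc_homog n : exists d, disc n \is d.-homog.
Proof.
exists ((2 ^ n - 1) * size (index_enum 'I_((size (psi n)^`()).-1 + (size (psi n)).-1)))%N.
rewrite /disc /resultant; apply: det_homog => i j.
rewrite Sylvester_mxE; have h := psi_hom n; have h' := homc_deriv h.
by case: split => k; apply: rpredMn; [exact: h|exact: h'].
Qed.

Lemma psi_deriv_lead n : (0 < n)%N -> lead_coef (psi n)^`() = lead_coef (psi n) *+ (2 ^ n).+1 /\ size (psi n)^`() = (2 ^ n).+1.
Proof.
move=> n0.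
have lp : lead_coef (psi n) != 0 by rewrite lead_coef_eq0 -size_poly_gt0 psi_size.
have e : (psi n)^`()`_(2 ^ n) = lead_coef (psi n) *+ (2 ^ n).+1.
  by rewrite coef_deriv lead_coefE psi_size.
have sz : size (psi n)^`() = (2 ^ n).+1.
  apply/eqP; rewrite eqn_leq; apply/andP; split.
    by have := lt_size_deriv (_ : psi n != 0); rewrite psi_size // ltnS; apply; rewrite -size_poly_gt0 psi_size.
  rewrite ltnNge; apply/negP => le; move/eqP: e; rewrite nth_default // eq_sym.
  rewrite -mulr_natr mulf_eq0 (negbTE lp) /= => /eqP h.
  have := congr1 (eval_coefs (cref algC)) h; rewrite rmorph0 rmorph_nat => /eqP.
  by rewrite pnatr_eq0.
by rewrite lead_coefE sz /= e.
Qed.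

Lemma disc_neq0 n : (0 < n)%N -> disc n != 0.
Proof.
move=> n0; have [l1 s1] := psi_deriv_lead n0.
have hl := psi_lead_ref n0.
have hl' : eval_coefs (cref algC) (lead_coef (psi n)^`()) != 0.
  by rewrite l1 rmorphMn /= mulrn_eq0.
apply: contraTneq isT => h; have := spec_resultant hl hl'.
rewrite -/(disc n) h rmorph0 => /esym /eqP; rewrite resultant_eq0 => /negPn; case/negP.
have : coprimep (pc (cref algC) (psi n)) (pc (cref algC) (psi n))^`().
  by apply: alg_coprime => x; exact: psi_ref_sep.
by rewrite /coprimep /pc -deriv_map => /eqP ->.
Qed.

(** Where the discriminant does not vanish, the equation of Per_n is separable. *)
Lemma disc_common (K : fieldType) (c : 'I_6 -> K) n x : (0 < n)%N -> eval_coefs c (disc n) != 0 ->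
  root (pc c (psi n)) x -> ~~ root (pc c (psi n))^`() x.
Proof.
move=> n0 hd rx; apply: contra hd => rx'; have [l1 s1] := psi_deriv_lead n0.
have [||[u v] /= _ e] := @resultant_in_ideal _ (psi n) (psi n)^`().
- by rewrite psi_size.
- by rewrite s1 ltnS expn_gt0.
have := congr1 (fun p => (pc c p).[x]) e; rewrite -/(disc n) /= pcD !pcM.
rewrite /pc map_polyC /= hornerC hornerD !hornerM => ->.
move: rx rx'; rewrite /pc deriv_map => /rootP -> /rootP ->.
by rewrite !mulr0 addr0.
Qed.

Lemma coefM_top (R : comNzRingType) (p q : {poly R}) a b :
  (size p <= a.+1)%N -> (size q <= b.+1)%N -> (p * q)`_(a + b) = p`_a * q`_b.
Proof.
move=> hp hq; rewrite coefM.
have ha : (a < (a + b).+1)%N by rewrite ltnS leq_addr.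
rewrite (bigD1 (Ordinal ha)) //= addKn big1 ?addr0 // => i ne.
have [lt|] := ltnP a i; first by rewrite nth_default ?mul0r // (leq_trans hp).
rewrite leq_eqVlt => /orP[/eqP e|lt]; first by case/eqP: ne; apply/val_inj.
by rewrite [q`__]nth_default ?mulr0 //; apply: leq_trans hq _; lia.
Qed.

Lemma orbP_top n : ((orbP n).1`_(2 ^ n), (orbP n).2`_(2 ^ n)) = orb gen_coefs n (1, 0).
Proof.
elim: n => [|n IH]; first by rewrite /= coefX coef1.
have [h1 h2] := orbP_size n.
have hc i (p : PA) k : (fcP i * p)`_k = gen_coefs i * p`_k by rewrite /fcP coefCM.
have -> : orb gen_coefs n.+1 (1, 0) = step gen_coefs (orb gen_coefs n (1, 0)) by [].
have -> : orbP n.+1 = step fcP (orbP n) by [].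
rewrite -IH; move: h1 h2; case: (orbP n) => P Q /= h1 h2.
have e : (2 ^ n.+1 = 2 ^ n + 2 ^ n)%N by rewrite expnS mul2n addnn.
have hq (a0 a1 a2 : 'I_6) : (fcP a0 * (P * P) + fcP a1 * (P * Q) + fcP a2 * (Q * Q))`_(2 ^ n.+1) =
  gen_coefs a0 * (P`_(2 ^ n) * P`_(2 ^ n)) + gen_coefs a1 * (P`_(2 ^ n) * Q`_(2 ^ n)) + gen_coefs a2 * (Q`_(2 ^ n) * Q`_(2 ^ n)).
  rewrite coefD coefD hc hc hc e.
  by rewrite (coefM_top h1 h1) (coefM_top h1 h2) (coefM_top h2 h2).
by congr (_, _); exact: hq.
Qed.

Lemma psi_lead n : (0 < n)%N -> lead_coef (psi n) = - (orb gen_coefs n (1, 0)).2.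
Proof.
move=> n0; rewrite lead_coefE psi_size //= -orbP_top /= /psi coefB coefXM /=.
by rewrite nth_default ?sub0r //; case: (orbP_size n).
Qed.

(** Where the leading coefficient of the equation of Per_n does not vanish,
    infinity is not n-periodic. *)
Lemma lead_inf (K : fieldType) (c : 'I_6 -> K) n : (0 < n)%N ->
  eval_coefs c (lead_coef (psi n)) != 0 -> ~~ per c (1, 0) n.
Proof.
move=> n0; rewrite psi_lead // rmorphN oppr_eq0.
have := rm_orb (eval_coefs c) gen_coefs n (1, 0); rewrite /= rmorph1 rmorph0.
have -> : eval_coefs c \o gen_coefs = c by apply/funext => i /=; rewrite ev_X.
move=> e; rewrite /per /par -e /= mulr0 mulr1 eq_sym //.
Qed.

(** * Dynatomic polynomials *)
(** [Phi] is a dynatomic polynomial over the open set [g <> 0]: its roots are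
    exactly the points of exact period [n], over any field, and it is separable
    at algebraic points. The leading coefficient divides [g], and infinity is
    not n-periodic over this set. *)
Record dyn (n : nat) (Phi : PA) (g : A2) : Prop := Dyn {
  dyn_hom : exists D, homc D Phi;
  dyn_size : (size Phi)%:Z = nu n + 1;
  dyn_g0 : g != 0;
  dyn_ghom : exists d, g \is d.-homog;
  dyn_lead : exists m, (exists d, m \is d.-homog) /\ g = lead_coef Phi * m;
  dyn_root : forall (K : fieldType) (c : 'I_6 -> K), rhoc c != 0 -> eval_coefs c g != 0 ->
    forall x, root (pc c Phi) x <-> exact_per c (x, 1) n;
  dyn_inf : forall (K : fieldType) (c : 'I_6 -> K), eval_coefs c g != 0 -> ~~ per c (1, 0) n;
  dyn_sep : forall (c : 'I_6 -> algC), eval_coefs c g != 0 -> separable_poly (pc c Phi)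
}.

Lemma dyn_Phi0 n Phi g : dyn n Phi g -> Phi != 0.
Proof.
move=> h; have [m [_ e]] := dyn_lead h; apply: contraNneq (dyn_g0 h) => p0.
by rewrite e p0 lead_coef0 mul0r.
Qed.

Lemma dyn_lead_neq0 n Phi g (K : fieldType) (c : 'I_6 -> K) : dyn n Phi g ->
  eval_coefs c g != 0 -> eval_coefs c (lead_coef Phi) != 0.
Proof. by move=> /dyn_lead [m [_ ->]]; rewrite evM; apply: contraNneq => ->; rewrite mul0r. Qed.

Lemma homogM_ex (p q : A2) : (exists d, p \is d.-homog) -> (exists d, q \is d.-homog) -> exists d, p * q \is d.-homog.
Proof. by move=> [d hp] [e hq]; exists (d + e)%N; apply: dhomogM. Qed.

Lemma alg_dvdp (p q : {poly algC}) : p != 0 -> separable_poly p -> (forall x, root p x -> root q x) -> p %| q.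
Proof.
move=> p0 sp h; have [r er] := closed_field_poly_normal p.
have l0 : lead_coef p != 0 by rewrite lead_coef_eq0.
rewrite er dvdpZl //.
have ur : uniq r.
  rewrite -separable_prod_XsubC; apply: dvdp_separable sp.
  by rewrite [in X in _ %| X]er dvdpZr.
apply: uniq_roots_dvdp; last by rewrite uniq_rootsE.
apply/allP => x xr; apply: h; rewrite er rootZ // root_prod_XsubC //.
Qed.

Lemma root_prod (K : fieldType) (I : eqType) (r : seq I) (F : I -> {poly K}) x :
  root (\prod_(i <- r) F i) x -> exists2 i, i \in r & root (F i) x.
Proof.
elim: r => [|i r IH]; first by rewrite big_nil (negbTE (root1 _)).
rewrite big_cons rootM => /orP[h|/IH [j jr hj]]; first by exists i; rewrite ?inE ?eqxx.
by exists j; rewrite // inE jr orbT.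
Qed.

Lemma size_pc_lead (K : fieldType) (c : 'I_6 -> K) (p : PA) : eval_coefs c (lead_coef p) != 0 -> size (pc c p) = size p.
Proof. by move=> h; rewrite /pc size_map_poly_id0. Qed.

Lemma prod_neq0 (R : idomainType) (I : eqType) (r : seq I) (F : I -> R) :
  (forall i, i \in r -> F i != 0) -> \prod_(i <- r) F i != 0.
Proof. by move=> h; rewrite prodf_seq_neq0; apply/allP => i /h. Qed.

(** The equation of Per_n is divided by the product of the dynatomic polynomials
    of the proper divisors of [n]. The remainder of the pseudo-division vanishes
    because it does at a dense set of points; the degrees add up to [nu n] by
    Moebius inversion. *)
Lemma dyn_exists n : (0 < n)%N -> exists Pg : PA * A2, dyn n Pg.1 Pg.2.
Proof.
have [k] := ubnP n; elim: k n => // k IH n nk n0.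
have [F hF] : exists F : nat -> PA * A2, forall d, (0 < d < n)%N -> dyn d (F d).1 (F d).2.
  suff h d : exists Pg : PA * A2, (0 < d < n)%N -> dyn d Pg.1 Pg.2 by have [F hF] := choice h; exists F.
  case: (boolP (0 < d < n)%N) => [/andP[d0 dn]|_]; last by exists (0, 0).
  by have [|Pg h] := IH d _ d0; [lia|exists Pg].
pose ds := [seq d <- divisors n | (d < n)%N].
have dsP d : d \in ds -> [/\ (d %| n)%N, (0 < d < n)%N & dyn d (F d).1 (F d).2].
  rewrite mem_filter -dvdn_divisors // => /andP[dl dn].
  have d0 : (0 < d < n)%N by rewrite dl (dvdn_gt0 n0 dn).
  by split => //; exact: hF.
have uds : uniq ds by rewrite filter_uniq // divisors_uniq.
pose q := \prod_(d <- ds) (F d).1; pose G := \prod_(d <- ds) (F d).2.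
have q0 : q != 0.
  by rewrite /q; apply: prod_neq0 => d /dsP [_ _ /dyn_Phi0].
have hq : exists D, homc D q.
  rewrite /q; elim: (ds) dsP => [|d s IHs] h; first by exists 0%N; rewrite big_nil; exact: homc1.
  have [|D1 h1] := IHs; first by move=> e es; apply: h; rewrite inE es orbT.
  have [_ _ /dyn_hom [D2 h2]] := h d (mem_head _ _).
  by exists (D2 + D1)%N; rewrite big_cons; exact: homcM.
have hG : exists D, G \is D.-homog.
  rewrite /G; elim: (ds) dsP => [|d s IHs] h; first by exists 0%N; rewrite big_nil dhomog1.
  rewrite big_cons; apply: homogM_ex; first by have [_ _ /dyn_ghom] := h d (mem_head _ _).
  by apply: IHs => e es; apply: h; rewrite inE es orbT.
have G0 : G != 0.
  by rewrite /G; apply: prod_neq0 => d /dsP [_ _ /dyn_g0].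
have Gd (K : fieldType) (c : 'I_6 -> K) d : eval_coefs c G != 0 -> d \in ds -> eval_coefs c (F d).2 != 0.
  by move=> h dd; apply: contraNneq h => e; rewrite /G (big_rem d) //= evM e mul0r.
pose m := (size q).-1.
have sq : size q = m.+1 by rewrite /m prednK // size_poly_gt0.
have [Dq hDq] := hq.
have lq : q`_m = lead_coef q by rewrite lead_coefE.
have Gl (K : fieldType) (c : 'I_6 -> K) : eval_coefs c G != 0 -> eval_coefs c (q`_m) != 0.
  move=> h; rewrite lq /q lead_coef_prod rmorph_prod /=.
  apply: prod_neq0 => d dd.
  by have [_ _ /dyn_lead_neq0] := dsP d dd; apply; exact: Gd.
have [kk [Phi [r [e sr hPhi hr]]]] := pdiv_hom hDq (eq_leq sq) (psi_hom n).
(* Where [B] does not vanish, specialization preserves the degrees and the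
   equation of Per_n is separable. *)
pose B := rho * G * disc n * lead_coef (psi n).
have lpsi0 : lead_coef (psi n) != 0 by rewrite lead_coef_eq0 -size_poly_gt0 psi_size.
have B0 : B != 0 by rewrite /B !mulf_neq0 // ?rho_neq0 ?disc_neq0.
have Bparts (K : fieldType) (c : 'I_6 -> K) : eval_coefs c B != 0 ->
  [/\ rhoc c != 0, eval_coefs c G != 0, eval_coefs c (disc n) != 0 & eval_coefs c (lead_coef (psi n)) != 0].
  by rewrite /B !evM ev_rho !mulf_eq0 !negb_or => /andP[/andP[/andP[]]].
have r0 : r = 0.
  apply/polyP => i; rewrite coef0; apply: (A2_eq0 B0) => c /Bparts [hr0 hGc _ _].
  have -> : eval_coefs c r`_i = (pc c r)`_i by rewrite /pc coef_map.
  suff -> : pc c r = 0 by rewrite coef0.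
  have dvq : pc c q %| pc c (psi n).
    rewrite /q pc_prod; elim: (ds) dsP uds (fun d => Gd _ c d hGc) => [|d s IHs] h us hg; first by rewrite big_nil dvd1p.
    have [dn /andP[d0 dl] hd] := h d (mem_head _ _).
    have gd := hg d (mem_head _ _).
    have h' e0 : e0 \in s -> [/\ (e0 %| n)%N, (0 < e0 < n)%N & dyn e0 (F e0).1 (F e0).2].
      by move=> es; apply: h; rewrite inE es orbT.
    have hg' e0 : e0 \in s -> eval_coefs c (F e0).2 != 0 by move=> es; apply: hg; rewrite inE es orbT.
    rewrite big_cons Gauss_dvdp.
      apply/andP; split; last by apply: IHs => //; case/andP: us.
      apply: alg_dvdp.
      - rewrite -size_poly_gt0 size_pc_lead ?size_poly_gt0 ?(dyn_Phi0 hd) //.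
        exact: dyn_lead_neq0 hd gd.
      - exact: dyn_sep hd _ gd.
      - move=> x /(dyn_root hd hr0 gd) [_ pd _]; rewrite root_psi -(divnK dn).
        by apply: perM => //; rewrite xpair_eqE oner_eq0 andbF.
    apply: alg_coprime => x /(dyn_root hd hr0 gd) ed; apply/negP => /root_prod [e0 es].
    have [_ _ he] := h' _ es; move=> /(dyn_root he hr0 (hg' _ es)) ee.
    by move: us; rewrite /= (exact_uniq ed ee) es.
  apply/eqP/negPn/negP => rn0.
  have : pc c q %| pc c r.
    have -> : pc c r = pc c (q`_m ^+ kk.+1 *: psi n) - pc c (Phi * q).
      by rewrite e pcD addrC addKr.
    rewrite pcZ pcM; apply: dvdp_sub; last exact: dvdp_mulIr.
    by rewrite dvdpZr // evXn expf_neq0 // Gl.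
  move=> /(dvdp_leq rn0); rewrite size_pc_lead ?sq; last by rewrite -lq; exact: Gl.
  apply/negP; rewrite -ltnNge ltnS; apply: leq_trans sr; exact: size_poly.
rewrite r0 addr0 in e.
have lm0 : q`_m ^+ kk.+1 != 0 by rewrite expf_neq0 // lq lead_coef_eq0.
have Phi0 : Phi != 0.
  apply: contraNneq lpsi0 => p0; move/eqP: e; rewrite p0 mul0r scale_poly_eq0 (negbTE lm0) /=.
  by move/eqP => ->; rewrite lead_coef0.
have sPhi : (size Phi)%:Z = nu n + 1.
  have := congr1 (fun p : PA => size p) e; rewrite size_scale // psi_size // size_mul // sq addnS /=.
  have hm : (m%:Z = \sum_(d <- ds) nu d)%R.
    rewrite /m /q; elim: (ds) dsP => [|d s IHs] h; first by rewrite !big_nil size_poly1.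
    rewrite !big_cons.
    have [_ _ hd] := h d (mem_head _ _).
    have h' e0 : e0 \in s -> [/\ (e0 %| n)%N, (0 < e0 < n)%N & dyn e0 (F e0).1 (F e0).2].
      by move=> es; apply: h; rewrite inE es orbT.
    have s0 : \prod_(j <- s) (F j).1 != 0.
      by apply: prod_neq0 => j /h' [_ _ /dyn_Phi0].
    have d0 := dyn_Phi0 hd.
    rewrite size_mul // -IHs //.
    move: (dyn_size hd) d0 s0; rewrite -!size_poly_gt0; move: (size _) (size _) => a b; lia.
  have := sum_nu n0; rewrite (bigD1_seq n) ?divisors_uniq -?dvdn_divisors //=.
  have -> : \sum_(i <- divisors n | i != n) nu i = m%:Z.
    rewrite hm /ds big_filter; rewrite big_seq_cond [RHS]big_seq_cond; apply: eq_bigl => d.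
    case: (boolP (d \in divisors n)) => //=; rewrite -dvdn_divisors // => dn.
    by rewrite ltn_neqAle (dvdn_leq n0 dn) andbT.
  move: (size Phi) => a; move: (nu n) => b; lia.
exists (Phi, lead_coef Phi * B) => /=.
have gparts (K : fieldType) (c : 'I_6 -> K) : eval_coefs c (lead_coef Phi * B) != 0 ->
  [/\ eval_coefs c G != 0, eval_coefs c (disc n) != 0 & eval_coefs c (lead_coef (psi n)) != 0].
  by rewrite evM mulf_eq0 negb_or => /andP[_ /Bparts []].
(* The equation of Per_n has no double roots over the open set. *)
have dbl (K : fieldType) (c : 'I_6 -> K) x (a b : {poly K}) : eval_coefs c (lead_coef Phi * B) != 0 ->
   pc c (q`_m ^+ kk.+1 *: psi n) = a * b -> root a x -> (root a^`() x \/ root b x) -> False.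
  move=> /gparts [hg hd _] eab ra rb.
  have l0 := Gl _ _ hg.
  have e1 : root (pc c (psi n)) x.
    have : root (pc c (q`_m ^+ kk.+1 *: psi n)) x by rewrite eab rootM ra.
    by rewrite pcZ rootZ // evXn expf_neq0.
  apply: (negP (disc_common n0 hd e1)).
  have : root (pc c (q`_m ^+ kk.+1 *: psi n))^`() x.
    rewrite eab derivM rootE hornerD !hornerM (rootP ra) mul0r addr0 mulf_eq0.
    by case: rb => /rootP ->; rewrite ?eqxx ?orbT.
  by rewrite pcZ derivZ rootZ // evXn expf_neq0.
split.
- by eexists; exact: hPhi.
- exact: sPhi.
- by rewrite mulf_neq0 // lead_coef_eq0.
- apply: homogM_ex; first by eexists; rewrite lead_coefE; exact: hPhi.
  apply: homogM_ex; last by eexists; rewrite lead_coefE; exact: psi_hom.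
  apply: homogM_ex; last exact: disc_homog.
  by apply: homogM_ex => //; exists 4; exact: rho_homog.
- exists B; split => //.
  apply: homogM_ex; last by eexists; rewrite lead_coefE; exact: psi_hom.
  apply: homogM_ex; last exact: disc_homog.
  by apply: homogM_ex => //; exists 4; exact: rho_homog.
- move=> K c hr0 hc x; have [hg hd hl] := gparts _ _ hc; have l0 := Gl _ _ hg.
  have nz : ((x, 1) : K * K) != (0, 0) by rewrite xpair_eqE oner_eq0 andbF.
  have e' : pc c (q`_m ^+ kk.+1 *: psi n) = pc c Phi * pc c q by rewrite e pcM.
  have rpsi y : root (pc c (psi n)) y = root (pc c Phi) y || root (pc c q) y.
    by rewrite -rootM -e' pcZ rootZ // evXn expf_neq0.
  split.
    move=> rx; have pn : per c (x, 1) n by rewrite -root_psi rpsi rx.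
    have [d dn ed] := exact_exists hr0 nz n0 pn.
    have [<- //|ne] := eqVneq d n.
    have dd : d \in ds by rewrite mem_filter -dvdn_divisors // dn andbT ltn_neqAle ne dvdn_leq.
    have [_ _ hdd] := dsP d dd.
    have rd := (dyn_root hdd hr0 (Gd _ _ _ hg dd) x).2 ed.
    exfalso; apply: (dbl _ _ _ _ _ hc e' rx); right.
    by rewrite /q pc_prod (big_rem d) //= rootM rd.
  move=> en; have pn : per c (x, 1) n by case: en.
  move: pn; rewrite -root_psi rpsi => /orP[//|].
  rewrite /q pc_prod => /root_prod [d dd rd].
  have [_ /andP[_ dl] hdd] := dsP d dd.
  have ed := (dyn_root hdd hr0 (Gd _ _ _ hg dd) x).1 rd.
  by move: dl; rewrite (exact_uniq ed en) ltnn.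
- by move=> K c /gparts [_ _ hl]; exact: lead_inf.
- move=> c hc; rewrite unlock.
  apply: alg_coprime => x rx; apply/negP => rx'.
  by apply: (dbl _ _ _ _ (pc c q) hc _ rx (or_introl rx')); rewrite e pcM.
Qed.

(** * Values of rational functions on Rat_2 *)
Section RV.
Variables (K : fieldType) (c : 'I_6 -> K).
Local Notation E := (eval_coefs c).

(** [r] is defined at the point [c] of Rat_2, with value [a]. *)
Definition rv (r : FracA2) (a : K) : Prop :=
  exists d N D, [/\ N \is d.-homog, D \is d.-homog, E D != 0, r = N%:F / D%:F & a = E N / E D].

Lemma Ea_neq0 D : E D != 0 -> D%:F != 0.
Proof. by apply: contraNneq => /eqP; rewrite tofrac_eq0 => /eqP ->; rewrite rmorph0. Qed.

Lemma rv_div d N D : N \is d.-homog -> D \is d.-homog -> E D != 0 -> rv (N%:F / D%:F) (E N / E D).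
Proof. by move=> *; exists d, N, D. Qed.

Lemma rv_uniq F a b : rv F a -> rv F b -> a = b.
Proof.
move=> [d [N [D [h1 h2 h3 h4 ->]]]] [d' [N' [D' [h1' h2' h3' h4' ->]]]].
have /eqP : N%:F / D%:F = N'%:F / D'%:F by rewrite -h4 -h4'.
rewrite eqr_div ?Ea_neq0 // -!tofracM tofrac_eq => /eqP h.
by apply/eqP; rewrite eqr_div // -!evM h.
Qed.

Lemma rvD F G a b : rv F a -> rv G b -> rv (F + G) (a + b).
Proof.
move=> [d [N [D [h1 h2 h3 -> ->]]]] [d' [N' [D' [h1' h2' h3' -> ->]]]].
exists (d + d')%N, (N * D' + N' * D), (D * D'); split.
- by apply: rpredD; [exact: dhomogM| rewrite addnC; exact: dhomogM].
- exact: dhomogM.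
- by rewrite evM mulf_neq0.
- by rewrite addf_div ?Ea_neq0 // !tofracD !tofracM.
- by rewrite addf_div // rmorphD /= !evM.
Qed.

Lemma rvM F G a b : rv F a -> rv G b -> rv (F * G) (a * b).
Proof.
move=> [d [N [D [h1 h2 h3 -> ->]]]] [d' [N' [D' [h1' h2' h3' -> ->]]]].
exists (d + d')%N, (N * N'), (D * D'); split; try exact: dhomogM.
- by rewrite evM mulf_neq0.
- by rewrite mulf_div !tofracM.
- by rewrite mulf_div !evM.
Qed.

Lemma rv_nat k : rv k%:R k%:R.
Proof.
have h : (k%:R : A2) \is 0.-homog by rewrite -mpolyC_nat; apply/dhomogP => m /=; rewrite msuppC; case: eqP => // _; rewrite inE => /eqP ->; rewrite mdeg0.
have := @rv_div 0 k%:R 1 h (dhomog1 _ _); rewrite !rmorph1 !divr1 !rmorph_nat; apply.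
exact: oner_neq0.
Qed.
Lemma rv0 : rv 0 0. Proof. exact: (rv_nat 0). Qed.
Lemma rv1 : rv 1 1. Proof. exact: (rv_nat 1). Qed.

Lemma rvN F a : rv F a -> rv (- F) (- a).
Proof.
move=> [d [N [D [h1 h2 h3 -> ->]]]]; rewrite -mulNr -tofracN -mulNr -rmorphN.
by apply: (rv_div (d := d)) => //; rewrite rpredN.
Qed.
Lemma rvB F G a b : rv F a -> rv G b -> rv (F - G) (a - b).
Proof. by move=> hF /rvN; exact: rvD. Qed.
Lemma rvX F a k : rv F a -> rv (F ^+ k) (a ^+ k).
Proof. by move=> h; elim: k => [|k IH]; [exact: rv1 | rewrite !exprS; exact: rvM]. Qed.
Lemma rv_sum (I : Type) (r : seq I) (F : I -> FracA2) (a : I -> K) :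
  (forall i, rv (F i) (a i)) -> rv (\sum_(i <- r) F i) (\sum_(i <- r) a i).
Proof. by move=> h; elim: r => [|i r IH]; rewrite ?big_nil ?big_cons; [exact: rv0 | exact: rvD]. Qed.

(** The coefficients of [p] have the coefficients of [q] as values. *)
Definition pv (p : {poly FracA2}) (q : {poly K}) := forall i, rv p`_i q`_i.
Lemma pvC r a : rv r a -> pv r%:P a%:P.
Proof. by move=> h i; rewrite !coefC; case: eqP => // _; exact: rv0. Qed.
Lemma pvXn k : pv 'X^k 'X^k.
Proof. by move=> i; rewrite !coefXn; exact: rv_nat. Qed.
Lemma pvD p q p' q' : pv p p' -> pv q q' -> pv (p + q) (p' + q').
Proof. by move=> h h' i; rewrite !coefD; exact: rvD. Qed.
Lemma pvN p p' : pv p p' -> pv (- p) (- p').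
Proof. by move=> h i; rewrite !coefN; exact: rvN. Qed.
Lemma pvM p q p' q' : pv p p' -> pv q q' -> pv (p * q) (p' * q').
Proof. by move=> h h' i; rewrite !coefM; apply: rv_sum => j; exact: rvM. Qed.
Lemma pv0 : pv 0 0. Proof. by move=> i; rewrite !coef0; exact: rv0. Qed.
Lemma pv1 : pv 1 1. Proof. exact: (pvXn 0). Qed.
Lemma pv_sum (I : Type) (r : seq I) (F : I -> {poly FracA2}) (a : I -> {poly K}) :
  (forall i, pv (F i) (a i)) -> pv (\sum_(i <- r) F i) (\sum_(i <- r) a i).
Proof. by move=> h; elim: r => [|i r IH]; rewrite ?big_nil ?big_cons; [exact: pv0 | exact: pvD]. Qed.
Lemma pv_prod (I : Type) (r : seq I) (F : I -> {poly FracA2}) (a : I -> {poly K}) :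
  (forall i, pv (F i) (a i)) -> pv (\prod_(i <- r) F i) (\prod_(i <- r) a i).
Proof. by move=> h; elim: r => [|i r IH]; rewrite ?big_nil ?big_cons; [exact: pv1 | exact: pvM]. Qed.

Lemma pv_det n (M : 'M[{poly FracA2}]_n) (M' : 'M[{poly K}]_n) :
  (forall i j, pv (M i j) (M' i j)) -> pv (\det M) (\det M').
Proof.
move=> h; apply: pv_sum => s; rewrite !mulr_sign.
have hp : pv (\prod_i M i (s i)) (\prod_i M' i (s i)) by apply: pv_prod => i.
by case: (odd_perm s) => //; exact: pvN.
Qed.

(** A function over the open set [h <> 0] has a value at each point of it. *)
Lemma rv_degree0 h r : (exists d, h \is d.-homog) -> E h != 0 -> degree0_loc h r -> exists a, rv r a.
Proof.
move=> [d hd] hc [k [N [hN ->]]].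
have h0 : h != 0 by apply: contraNneq hc => ->; rewrite rmorph0.
rewrite (homog_msize1 h0 hd) in hN.
exists (E N / E (h ^+ k)); rewrite -tofracXn; apply: (rv_div hN); last by rewrite evXn expf_neq0.
by rewrite mulnC; exact: homogX.
Qed.

End RV.

(** Rational functions on Rat_2 are determined by their values on a dense set. *)
Lemma rv_dense (h : A2) r r' : h != 0 ->
  (forall c : 'I_6 -> algC, eval_coefs c h != 0 -> exists2 a, rv c r a & rv c r' a) -> r = r'.
Proof.
move=> h0 H; have [c0 hc0] := A2_dense h0; have [a0 ha hb] := H c0 hc0.
have [d [N [D [hN hD D0 rE _]]]] := ha.
have [d' [N' [D' [hN' hD' D0' rE' _]]]] := hb.
have nz (P : A2) : eval_coefs c0 P != 0 -> P != 0 by apply: contraNneq => ->; rewrite rmorph0.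
rewrite rE rE'; apply/eqP; rewrite eqr_div ?tofrac_eq0 ?nz // -!tofracM tofrac_eq -subr_eq0; apply/eqP.
apply: (A2_eq0 (mulf_neq0 h0 (mulf_neq0 (nz _ D0) (nz _ D0')))) => c.
rewrite !evM !mulf_eq0 !negb_or => /and3P[hc Dc Dc'].
have [a ra ra'] := H c hc; rewrite rE in ra; rewrite rE' in ra'.
rewrite rmorphB /= !evM; apply/eqP; rewrite subr_eq0 -eqr_div //.
by rewrite (rv_uniq (rv_div hN hD Dc) ra) (rv_uniq (rv_div hN' hD' Dc') ra').
Qed.

Lemma frac_repr (R : idomainType) (x : {fraction R}) :
  x = (frac (generic_quotient.repr x)).1%:F / (frac (generic_quotient.repr x)).2%:F.
Proof.
set r := generic_quotient.repr x.
have r2 : (frac r).2 != 0 := denom_ratioP r.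
have r2' : (frac r).2%:F != 0 by rewrite tofrac_eq0.
apply: (mulIf r2'); rewrite divfK //.
unlock FracField.tofrac; rewrite -{1}[x]reprK -/r.
rewrite -[LHS]FracField.pi_mul; apply/eqmodP; rewrite /= FracField.equivfE /FracField.mulf /=.
rewrite !numden_Ratio ?mulf_neq0 ?oner_neq0 //.
by rewrite !mulr1 mulrC.
Qed.

Lemma frac_inclE (N D : A2) : D != 0 -> frac_incl (N%:F / D%:F) = N%:MP%:F / D%:MP%:F.
Proof.
move=> D0; rewrite /frac_incl.
have e := frac_repr (N%:F / D%:F); move: (generic_quotient.repr _) (denom_ratioP (generic_quotient.repr (N%:F / D%:F))) e => r r2 /eqP.
rewrite eqr_div ?tofrac_eq0 // -!tofracM tofrac_eq => /eqP e.
by apply/eqP; rewrite eqr_div ?tofrac_eq0 ?mpolyC_eq0 // -!tofracM -!mpolyCM e mulrC.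
Qed.

Lemma hv_incl (K : fieldType) (c : 'I_6 -> K) x y r a : rv c r a -> hv c x y (frac_incl r) a.
Proof.
move=> [d [N [D [h1 h2 h3 -> ->]]]].
have D0 : D != 0 by apply: contraNneq h3 => ->; rewrite rmorph0.
rewrite frac_inclE // -(evXY_C c x y N) -(evXY_C c x y D).
by apply: (hv_div (bihomogC h1) (bihomogC h2)); rewrite evXY_C.
Qed.

(** * Dehomogenization and bihomogeneous components *)
(** Dehomogenization, X = x and Y = 1. *)
Definition dehom (F : A2XY) : PA := evXY fcP 'X 1 F.

Lemma dehom_eval (K : fieldType) (c : 'I_6 -> K) d e F (x y : K) : y != 0 -> bihomog d e F ->
  evXY c x y F = y ^+ e * (pc c (dehom F)).[x / y].
Proof.
move=> y0 hF.
have -> : evXY c x y F = evXY (fun i => 1 * c i) (y * (x / y)) (y * 1) F.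
  by rewrite mulrCA divff // !mulr1; congr (evXY _ _ _ F); apply/funext => i; rewrite mul1r.
rewrite (evXY_scale _ _ _ _ _ hF) expr1n mul1r; congr (_ * _).
have := rm_evXY (GRing.RMorphism.clone _ _ (horner_eval (x / y) \o pc c) _) fcP 'X 1 F.
rewrite /= /horner_eval /pc map_polyX hornerX rmorph1 hornerC => ->.
by congr (evXY _ _ _ F); apply/funext => i /=; rewrite /fcP map_polyC hornerC /= ev_X.
Qed.

Lemma evfcP (p : A2) : eval_coefs fcP p = p%:P.
Proof. by rewrite -(ev_universal (GRing.RMorphism.clone _ _ (@polyC A2) _)). Qed.

Lemma homc_dehom d e F : bihomog d e F -> homc d (dehom F).
Proof.
move=> [_ h]; rewrite /dehom /evXY /mmap => i; rewrite coef_sum; apply: rpred_sum => m _.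
move: i; rewrite -/(homc _ _) -[d]addn0; apply: homcM; first by rewrite evfcP; exact: homcC (h m).
rewrite /mmap1 !big_ord_recl big_ord0 /pt2 /= mulr1 expr1n mulr1; exact: homcXn.
Qed.

(** Homogenization in degree [e]. *)
Definition hz e (p : PA) : A2XY := \sum_(i < e.+1) p`_i *: (vX ^+ i * vY ^+ (e - i)).

Lemma hz_bihomog D e p : homc D p -> bihomog D e (hz e p).
Proof.
move=> h; apply: bihomog_sum => i _.
have := bihomogZ (h i) (bihomogM (bihomogXn i bihomogX) (bihomogXn (e - i) bihomogY)).
by rewrite !mul0n !mul1n !addn0 subnKC // -ltnS.
Qed.

Lemma hz_eval (K : fieldType) (c : 'I_6 -> K) e p x y :
  evXY c x y (hz e p) = \sum_(i < e.+1) eval_coefs c p`_i * (x ^+ i * y ^+ (e - i)).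
Proof.
rewrite /hz raddf_sum /=; apply: eq_bigr => i _.
by rewrite evXYZ evXYM !evXYXn evXY_X evXY_Y.
Qed.

Lemma hz_eval_y (K : fieldType) (c : 'I_6 -> K) e (p : PA) (x y : K) : y != 0 -> (size p <= e.+1)%N ->
  evXY c x y (hz e p) = y ^+ e * (pc c p).[x / y].
Proof.
move=> y0 sp; rewrite hz_eval.
have sp' : (size (pc c p) <= e.+1)%N by apply: leq_trans sp; exact: size_poly.
rewrite (horner_coef_wide _ sp') big_distrr /=; apply: eq_bigr => i _.
rewrite /pc coef_map /= [RHS]mulrCA; congr (_ * _).
have ie : (i <= e)%N by rewrite -ltnS.
have -> : y ^+ e = y ^+ (e - i) * y ^+ i by rewrite -exprD subnK.
by rewrite expr_div_n -mulrA [y ^+ i * _]mulrC divfK ?expf_neq0 // mulrC.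
Qed.

Definition genC : 'I_6 -> A2XY := fun i => (gen_coefs i)%:MP.
Lemma evXY_gen F : evXY genC vX vY F = F.
Proof. by rewrite -(evXY_universal (GRing.RMorphism.clone _ _ idfun _)). Qed.

(** Taking bihomogeneous components is linear over bihomogeneous elements. *)
Lemma bihomog_part_mul d e d1 e1 (A F : A2XY) : bihomog d1 e1 F ->
  bihomog_part (d + d1) (e + e1) (A * F) = bihomog_part d e A * F.
Proof.
move=> hF; rewrite -[LHS]evXY_gen -gr_part.
have -> : gr genC vX vY (A * F) = gr genC vX vY A * gr genC vX vY F by exact: rmorphM.
rewrite (gr_bihomog _ _ _ hF) evXY_gen.
set G := gr genC vX vY A.
have -> : G * ('X%:P ^+ d1 * 'X ^+ e1 * F%:P%:P) = ('X^d1 * F%:P)%:P * (G * 'X^e1).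
  by rewrite polyCM -polyC_exp; ring.
rewrite coefCM coefMXn ltnNge leq_addl /= addnK -mulrA coefXnM ltnNge leq_addl /= addnK.
by rewrite coefCM gr_part evXY_gen mulrC.
Qed.

Lemma bihomog_partD d e (A B : A2XY) : bihomog_part d e (A + B) = bihomog_part d e A + bihomog_part d e B.
Proof.
rewrite -[LHS]evXY_gen -[X in _ = X + _]evXY_gen -[X in _ = _ + X]evXY_gen -!gr_part.
by rewrite -!coefD; congr (nth 0 (polyseq (nth 0 (polyseq _) _)) _); exact: rmorphD.
Qed.

Lemma bihomog_part_id d e F : bihomog d e F -> bihomog_part d e F = F.
Proof. by move=> h; rewrite -[LHS]evXY_gen -gr_part (gr_bihomog_coef _ _ _ _ _ h) !eqxx /= evXY_gen. Qed.

(** * The pullback by the iterate and the multiplier *)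
Lemma wronsk_ident (R : comNzRingType) (a0 a1 a2 b0 b1 b2 P Q p q : R) :
  (a0 * (p * P + P * p) + a1 * (p * Q + P * q) + a2 * (q * Q + Q * q)) * (b0 * (P * P) + b1 * (P * Q) + b2 * (Q * Q)) -
  (a0 * (P * P) + a1 * (P * Q) + a2 * (Q * Q)) * (b0 * (p * P + P * p) + b1 * (p * Q + P * q) + b2 * (q * Q + Q * q)) =
  ((a0 * b1 - a1 * b0) * (P * P) + 2 * (a0 * b2 - a2 * b0) * (P * Q) + (a1 * b2 - a2 * b1) * (Q * Q)) * (p * Q - P * q).
Proof. ring. Qed.

Section Wronskian.
Variables (R : comNzRingType) (i : 'I_2).
Implicit Types (u : {mpoly R[2]} * {mpoly R[2]}).
(** The Wronskian of a pair of forms for one of the two variables. *)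
Definition wrg u : {mpoly R[2]} := u.1^`M(i) * u.2 - u.1 * u.2^`M(i).

(** Chain rule. *)
Lemma wrg_step (c : 'I_6 -> R) u (C := fun j => (c j)%:MP : {mpoly R[2]}) :
  wrg (step C u) = jac C u * wrg u.
Proof.
case: u => P Q.
have hM (D A B : {mpoly R[2]}) : D^`M(i) = 0 -> (D * (A * B))^`M(i) = D * (A^`M(i) * B + A * B^`M(i)).
  by move=> hC; rewrite mderivM hC mul0r add0r mderivM.
have g0 j : (C j)^`M(i) = 0 by exact: mderivC.
rewrite /wrg /step /qa /qb /jac /jq /jp /jr /= !expr2 !mderivD !hM //.
exact: wronsk_ident.
Qed.
End Wronskian.

Lemma wrg0 (R : comNzRingType) : wrg 0 (varX R, varY R) = varY R.
Proof.
rewrite /wrg /varX /varY /= !mderivX !mnm1E /= scale1r scale0r mulr0 subr0.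
have -> : (U_(0%R : 'I_2) - U_(0%R : 'I_2) = 0)%MM by apply/mnmP => j; rewrite mnmBE subnn mnm0E.
by rewrite mpolyX0 mul1r.
Qed.
Lemma wrg1 (R : comNzRingType) : wrg 1 (varX R, varY R) = - varX R.
Proof.
rewrite /wrg /varX /varY /= !mderivX !mnm1E /= scale1r scale0r mul0r sub0r.
have -> : (U_(1%R : 'I_2) - U_(1%R : 'I_2) = 0)%MM by apply/mnmP => j; rewrite mnmBE subnn mnm0E.
by rewrite mpolyX0 mulr1.
Qed.

Definition wr (i : 'I_2) (u : A2XY * A2XY) : A2XY := wrg i u.

Lemma wr_step i u : wr i (step genC u) = jac genC u * wr i u.
Proof. exact: (wrg_step i gen_coefs u). Qed.

(** The product of the Jacobians along the orbit. *)
Definition JJ n : A2XY := \prod_(i < n) jac genC (phi_iter i).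

Lemma phi_iterS n : phi_iter n.+1 = step genC (phi_iter n).
Proof. by rewrite !phi_iterE /orb iterS. Qed.

Lemma wr_iter i n : wr i (phi_iter n) = JJ n * wr i (vX, vY).
Proof.
elim: n => [|n IH]; first by rewrite /JJ big_ord0 mul1r.
by rewrite phi_iterS wr_step IH /JJ big_ord_recr /= mulrA [_ * jac _ _]mulrC.
Qed.

Lemma wr0 : wr 0 (vX, vY) = vY. Proof. exact: wrg0. Qed.
Lemma wr1 : wr 1 (vX, vY) = - vX. Proof. exact: wrg1. Qed.

(** The factors by which the pullback acts in the charts Y <> 0 and X <> 0. *)
Definition LamY n : FracA2XY := (vY * (vY * JJ n))%:F / ((phi_iter n).2 ^+ 2)%:F.
Definition LamX n : FracA2XY := (vX * (vX * JJ n))%:F / ((phi_iter n).1 ^+ 2)%:F.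

Lemma phi_pullbackE n h : phi_pullback n h = (LamY n * h.1, LamX n * h.2).
Proof.
have hY := wr_iter 0 n; have hX := wr_iter 1 n; rewrite wr0 in hY; rewrite wr1 in hX.
have aux (R : comNzRingType) (v j w : R) : w = j * - v -> v * - w = v * (v * j) by move=> ->; ring.
have eY : vY * wr 0 (phi_iter n) = vY * (vY * JJ n) by rewrite hY [JJ n * _]mulrC.
have eX : vX * - wr 1 (phi_iter n) = vX * (vX * JJ n) by exact: aux hX.
have eX' : - wr 1 (phi_iter n) = (phi_iter n).2^`M(1) * (phi_iter n).1 - (phi_iter n).2 * (phi_iter n).1^`M(1).
  by rewrite /wr /wrg opprB [X in X - _]mulrC [X in _ - X]mulrC.
rewrite /LamY /LamX -eY -eX eX'; reflexivity.
Qed.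

Lemma bihomog_cast d e d' e' F : bihomog d e F -> d = d' -> e = e' -> bihomog d' e' F.
Proof. by move=> h <- <-. Qed.

Lemma bihomog_jac n : bihomog (2 ^ n.+1) (2 ^ n.+1) (jac genC (phi_iter n)).
Proof.
have [h1 h2] := phi_iter_bihomog n.
have hc i : bihomog 1 0 (genC i) by apply: bihomogC; exact: X_homog.
have hB (i j k l : 'I_6) : bihomog (1 + 1) (0 + 0) (genC i * genC j - genC k * genC l).
  by apply: bihomogB; apply: bihomogM.
have hq : bihomog (1 + 1) (0 + 0) (jq genC) by exact: hB.
have hp : bihomog (1 + 1) (0 + 0) (jp genC) by exact: hB.
have hr : bihomog (1 + 1) (0 + 0) (jr genC) by exact: hB.
have two : bihomog 0 0 (1 + 1) by apply: bihomogD; exact: bihomog1.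
have t1 := bihomogM hq (bihomogM h1 h1).
have t2 := bihomogM (bihomogM two hp) (bihomogM h1 h2).
have t3 := bihomogM hr (bihomogM h2 h2).
have t := bihomogD (bihomogD t1 t2) t3.
apply: bihomog_cast t _ _; have := expn_gt0 2 n; rewrite expnS; lia.
Qed.

Lemma JJ_bihomog n : bihomog (2 * (2 ^ n - 1)) (2 * (2 ^ n - 1)) (JJ n).
Proof.
elim: n => [|n IH]; first by rewrite /JJ big_ord0; exact: bihomog1.
rewrite /JJ big_ord_recr /=.
have -> : (2 * (2 ^ n.+1 - 1) = 2 * (2 ^ n - 1) + 2 ^ n.+1)%N by have := expn_gt0 2 n; rewrite expnS; lia.
by apply: bihomogM => //; exact: bihomog_jac.
Qed.

Lemma vYJ_bihomog (v : A2XY) n : bihomog 0 1 v -> bihomog (2 * (2 ^ n - 1)) (2 * 2 ^ n) (v * (v * JJ n)).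
Proof.
move=> hv; have := bihomogM hv (bihomogM hv (JJ_bihomog n)).
by rewrite !add0n (_ : 1 + (1 + 2 * (2 ^ n - 1)) = 2 * 2 ^ n)%N //; have := expn_gt0 2 n; lia.
Qed.

Lemma phi2_bihomog n : bihomog (2 * (2 ^ n - 1)) (2 * 2 ^ n) ((phi_iter n).1 ^+ 2) /\
  bihomog (2 * (2 ^ n - 1)) (2 * 2 ^ n) ((phi_iter n).2 ^+ 2).
Proof.
have [h1 h2] := phi_iter_bihomog n; rewrite !expr2 !mul2n -!addnn.
by split; apply: bihomogM.
Qed.

(** The product of the Jacobians along the orbit of [u], at the point [c]. *)
Definition jorb (K : comNzRingType) (c : 'I_6 -> K) n u := \prod_(i < n) jac c (orb c i u).

Lemma rm_jac (T S : comNzRingType) (f : {rmorphism T -> S}) c u :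
  f (jac c u) = jac (f \o c) (f u.1, f u.2).
Proof.
rewrite /jac /jq /jp /jr; set t : T := 2; have ht : f t = 2 := rmorph_nat f 2.
by clearbody t; rewrite !expr2 !(rmorphD, rmorphN, rmorphM) /= ht.
Qed.

Lemma ev_jac (K : comNzRingType) (c : 'I_6 -> K) x y u :
  evXY c x y (jac genC u) = jac c (evXY c x y u.1, evXY c x y u.2).
Proof.
etransitivity; first exact: (rm_jac (evXY c x y)).
by congr (jac _ _); apply/funext => i /=; rewrite evXY_C ev_X.
Qed.

Lemma ev_JJ (K : comNzRingType) (c : 'I_6 -> K) x y n : evXY c x y (JJ n) = jorb c n (x, y).
Proof.
rewrite /JJ rmorph_prod; apply: eq_bigr => i _.
by rewrite [LHS]ev_jac ev_phi_iter.
Qed.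

Lemma frac_den_mul (R : idomainType) (a D N : R) (F : {fraction R}) :
  D%:F * F = N%:F -> (a * D)%:F * F = (a * N)%:F.
Proof. by move=> h; rewrite !tofracM -mulrA h. Qed.
Lemma frac_cross (R : idomainType) (s D0 N0 N : R) (F : {fraction R}) :
  D0 != 0 -> s%:F * F = N%:F -> F = N0%:F / D0%:F -> N * D0 = N0 * s.
Proof.
move=> hD h1 h2; apply/eqP; rewrite -tofrac_eq !tofracM -h1 h2 -mulrA divfK ?tofrac_eq0 //.
by rewrite mulrC.
Qed.
Lemma frac_uncross (R : idomainType) (s D0 N0 N : R) (F : {fraction R}) :
  D0 != 0 -> s != 0 -> N * D0 = N0 * s -> F = N0%:F / D0%:F -> F = N%:F / s%:F.
Proof.
move=> hD hs h ->; apply/eqP; rewrite eqr_div ?tofrac_eq0 // -!tofracM tofrac_eq h //.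
Qed.
Lemma frac_den (R : idomainType) (D N : R) (F : {fraction R}) :
  D != 0 -> F = N%:F / D%:F -> D%:F * F = N%:F.
Proof. by move=> hD ->; rewrite mulrC divfK // tofrac_eq0. Qed.

Section Charts.
Variables (g : A2) (dg : nat).
Hypothesis hg : g \is dg.-homog.
Hypothesis g0 : g != 0.

(** The function whose nonvanishing defines [chartY g], up to bihomogeneity. *)
Definition sY : A2XY := (g * rho)%:MP * vY.

Lemma grho_homog : g * rho \is (dg + 4)%N.-homog.
Proof. exact: dhomogM hg rho_homog. Qed.

Lemma sY_bihomog k : bihomog (k * (dg + 4)) k (sY ^+ k).
Proof.
by have := bihomogXn k (bihomogM (bihomogC grho_homog) bihomogY); rewrite addn0 add0n mul1n mulnC.
Qed.

Lemma ev_sY (K : fieldType) (c : 'I_6 -> K) x y :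
  evXY c x y sY = eval_coefs c g * rhoc c * y.
Proof. by rewrite /sY evXYM evXY_C evXY_Y evM ev_rho. Qed.

Lemma pt_closed (K : fieldType) (c : 'I_6 -> K) x : rhoc c != 0 -> eval_coefs c g != 0 ->
  chartY g (Pt c x 1).
Proof.
move=> hr hgc; have hp : fpt c x 1 by split => //; rewrite xpair_eqE oner_eq0 andbF.
split; first exact: Pt_point.
  by move=> /(PtP _ _ _ bihomogY); rewrite evXY_Y => /eqP; rewrite oner_eq0.
by move=> /(PtP _ _ _ (bihomogC hg)); rewrite evXY_C; apply/eqP.
Qed.

Lemma good_exists : exists c : 'I_6 -> algC, rhoc c != 0 /\ eval_coefs c g != 0.
Proof.
have [c hc] := A2_dense (mulf_neq0 rho_neq0 g0); exists c.
by move: hc; rewrite evM ev_rho mulf_eq0 negb_or => /andP.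
Qed.

Lemma krullXY (I : set A2XY) (s : A2XY) :
  I 0 -> (forall x y : A2XY, I x -> I y -> I (x + y)) -> (forall a x : A2XY, I x -> I (a * x)) ->
  (forall k, ~ I (s ^+ k)) -> exists P : set A2XY, [/\ prime_set P, classical_sets.subset I P & ~ P s].
Proof. by move=> h0 hD hM hs; apply: krull. Qed.

(** An ideal with no zero on [chartY g] contains a power of [sY]. The absence of
    zeros is expressed either by elements of the ideal or by the points that
    contain it. *)
Lemma krull_sY (I : set A2XY) :
  I 0 -> (forall x y : A2XY, I x -> I y -> I (x + y)) -> (forall a x : A2XY, I x -> I (a * x)) ->
  (forall (K : fieldType) (c : 'I_6 -> K) x y, fpt c x y -> eval_coefs c g != 0 -> y != 0 ->
      exists F, I F /\ evXY c x y F != 0) \/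
  (forall Q (K : fieldType) (c : 'I_6 -> K) x y, fpt c x y -> eval_coefs c g != 0 -> y != 0 ->
      (forall F, Q F <-> evXY c x y F = 0) -> classical_sets.subset I Q -> False) ->
  exists k, I (sY ^+ k).
Proof.
move=> h0 hD hM h; apply: contrapT => nk.
have [|Q [pQ IQ sQ]] := krullXY h0 hD hM (s := sY); first by move=> k Ik; apply: nk; exists k.
have [K [c [x [y hQ]]]] := prime_reps pQ.
have : evXY c x y sY != 0 by apply/eqP => /hQ.
rewrite ev_sY !mulf_eq0 !negb_or => /andP[/andP[hgc hr] hy].
have hp : fpt c x y by split => //; rewrite xpair_eqE (negbTE hy) andbF.
case: h => h; last exact: (h Q K c x y hp hgc hy hQ IQ).
by have [F [/IQ /hQ -> ]] := h K c x y hp hgc hy; rewrite eqxx.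
Qed.

(** A rational function that is regular on [chartY g] has a denominator that is
    a power of [sY]: the denominators form an ideal with no zero there. *)
Lemma hartogs (F : FracA2XY) : (forall P, chartY g P -> regular_at P F) ->
  exists k N, bihomog (k * (dg + 4)) k N /\ F = N%:F / (sY ^+ k)%:F.
Proof.
move=> reg.
pose I : set A2XY := fun D => exists N : A2XY, D%:F * F = N%:F.
have [||||k [N sk]] := krull_sY (I := I).
  - by exists 0; rewrite !tofrac0 mul0r.
  - by move=> D D' [N h] [N' h']; exists (N + N'); rewrite !tofracD mulrDl h h'.
  - by move=> a D [N h]; exists (a * N); exact: frac_den_mul h.
  - right=> Q K c x y hp hgc hy hQ IQ.
  have cP : chartY g (Pt c x y).
    split; first exact: Pt_point.
      by move=> /(PtP _ _ _ bihomogY); rewrite evXY_Y; apply/eqP.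
    by move=> /(PtP _ _ _ (bihomogC hg)); rewrite evXY_C; apply/eqP.
  have [d [e [N [D [h1 h2 h3 h4]]]]] := reg _ cP.
  apply: (h3); apply/(PtP _ _ _ h2)/hQ/IQ; exists N.
  have D0 : D != 0.
    apply/eqP => e0; apply: h3; rewrite e0.
    by case: (Pt_prime c x y) => -[].
  exact: frac_den D0 h4.
(* The bihomogeneous denominator [D0] of [F] at some point of the chart is used
   to replace [N] by a bihomogeneous component. *)
have [c [hr hgc]] := good_exists.
have [d0 [e0 [N0 [D0 [h1 h2 h3 h4]]]]] : exists d e (N D : A2XY), [/\ bihomog d e N, bihomog d e D, ~ Pt c 0 1 D & F = N%:F / D%:F] := reg _ (pt_closed 0 hr hgc).
have nD0 : D0 != 0.
  by apply/eqP => e; apply: h3; rewrite e; case: (Pt_prime c 0 1) => -[].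
have s0 : sY ^+ k != 0.
  apply/eqP => /(congr1 (evXY c 0 1)); rewrite evXYXn ev_sY mulr1 (rmorph0 (evXY c 0 1)) => /eqP.
  by apply/negP; rewrite expf_neq0 // mulf_neq0.
have e : N * D0 = N0 * sY ^+ k by exact: (frac_cross nD0 sk h4).
exists k, (bihomog_part (k * (dg + 4)) k N); split; first exact: bihomog_part_bihomog.
apply: (frac_uncross nD0 s0 _ h4).
rewrite -[LHS](bihomog_part_mul (k * (dg + 4)) k N h2) e.
apply: bihomog_part_id.
by rewrite addnC [(k + _)%N]addnC; exact: bihomogM (sY_bihomog k).
Qed.

(** A form [D] without zeros on the locus [Ph = 0] of the chart is invertible
    modulo [Ph] after multiplication by a power of [sY]: the ideal (Ph, D) has
    no zero on the chart. *)
Lemma clear_den d1 e1 d2 e2 (D Ph : A2XY) : bihomog d1 e1 D -> bihomog d2 e2 Ph ->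
  (forall (K : fieldType) (c : 'I_6 -> K) x y, fpt c x y -> eval_coefs c g != 0 -> y != 0 ->
     evXY c x y Ph = 0 -> evXY c x y D != 0) ->
  exists k A, [/\ (d1 <= k * (dg + 4))%N, (e1 <= k)%N, bihomog (k * (dg + 4) - d1) (k - e1) A &
    forall (K : fieldType) (c : 'I_6 -> K) x y, evXY c x y Ph = 0 ->
      evXY c x y (sY ^+ k) = evXY c x y A * evXY c x y D].
Proof.
move=> hD hP hn.
pose I : set A2XY := fun F => exists A B : A2XY, F = A * D + B * Ph.
have [||||k0 [A [B e]]] := krull_sY (I := I).
  - by exists 0, 0; rewrite !mul0r addr0.
  - by move=> x y [A [B ->]] [A' [B' ->]]; exists (A + A'), (B + B'); ring.
  - by move=> a x [A [B ->]]; exists (a * A), (a * B); ring.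
  - left=> K c x y hp hgc hy; have [z|nz] := eqVneq (evXY c x y Ph) 0.
    by exists D; split; [exists 1, 0; ring | exact: hn].
  by exists Ph; split => //; exists 0, 1; ring.
pose k := (k0 + (d1 + e1 + d2 + e2))%N.
have {}e : sY ^+ k = (sY ^+ (d1 + e1 + d2 + e2) * A) * D + (sY ^+ (d1 + e1 + d2 + e2) * B) * Ph.
  by rewrite /k exprD e; ring.
move: (_ * A) (_ * B) e => {}A {}B e.
exists k, (bihomog_part (k * (dg + 4) - d1) (k - e1) A).
have l1 : (d1 <= k * (dg + 4))%N by rewrite /k; nia.
have l2 : (d2 <= k * (dg + 4))%N by rewrite /k; nia.
have l3 : (e1 <= k)%N by rewrite /k; lia.
have l4 : (e2 <= k)%N by rewrite /k; lia.
split => //; first exact: bihomog_part_bihomog.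
move=> K c x y z.
have pA : bihomog_part (k * (dg + 4)) k (A * D) = bihomog_part (k * (dg + 4) - d1) (k - e1) A * D.
  by rewrite -(bihomog_part_mul _ _ _ hD) !subnK.
have pB : bihomog_part (k * (dg + 4)) k (B * Ph) = bihomog_part (k * (dg + 4) - d2) (k - e2) B * Ph.
  by rewrite -(bihomog_part_mul _ _ _ hP) !subnK.
have := bihomog_part_id (sY_bihomog k); rewrite {1}e bihomog_partD pA pB => <-.
by rewrite evXYD (evXYM _ _ _ _ Ph) z mulr0 addr0 (evXYM _ _ _ _ D).
Qed.
End Charts.

(** * A basis of the sections of Omega on Per*_n *)
Lemma per_par (K : fieldType) (c : 'I_6 -> K) u v n : rhoc c != 0 -> u != (0, 0) -> v != (0, 0) ->
  par u v -> per c v n -> per c u n.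
Proof.
move=> hr hu hv huv hp; rewrite /per.
apply: (@par_trans _ (orb c n v)); [exact: orb_nondeg | exact: par_orb |].
by apply: (@par_trans _ v) => //; exact: par_sym.
Qed.

Lemma exact_par (K : fieldType) (c : 'I_6 -> K) u v n : rhoc c != 0 -> u != (0, 0) -> v != (0, 0) ->
  par u v -> exact_per c v n -> exact_per c u n.
Proof.
move=> hr hu hv huv [n0 pn hm]; split=> //; first exact: per_par huv pn.
by move=> m /hm; apply: contra; apply: per_par => //; exact: par_sym.
Qed.

Lemma neq0y (K : fieldType) (x y : K) : y != 0 -> (x, y) != (0, 0).
Proof. by move=> h; rewrite xpair_eqE (negbTE h) andbF. Qed.

(* Fixed from here on: a dynatomic polynomial [Phi] over [g0 <> 0]. *)
Section Basis.
Variables (n : nat) (Phi : PA) (g0 m : A2) (D dm : nat).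
Hypothesis n0 : (0 < n)%N.
Hypothesis hdyn : dyn n Phi g0.
Hypothesis hPhi : homc D Phi.
Hypothesis hm : m \is dm.-homog.
Hypothesis g0E : g0 = lead_coef Phi * m.

Let l := lead_coef Phi.
Let dg := (D + dm)%N.
Let nu := (size Phi).-1.

Lemma hg0 : g0 \is dg.-homog.
Proof. by rewrite g0E; apply: dhomogM => //; rewrite lead_coefE; exact: hPhi. Qed.

Lemma sizePhi : size Phi = nu.+1.
Proof. by rewrite /nu prednK // size_poly_gt0 (dyn_Phi0 hdyn). Qed.

Lemma g0l (K : fieldType) (c : 'I_6 -> K) : eval_coefs c g0 = eval_coefs c l * eval_coefs c m.
Proof. by rewrite g0E evM. Qed.

(** The bihomogeneous equation of Per*_n. *)
Definition Phih : A2XY := hz nu Phi.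
Lemma Phih_bihomog : bihomog D nu Phih. Proof. exact: hz_bihomog. Qed.
Lemma ev_Phih (K : fieldType) (c : 'I_6 -> K) (x y : K) : y != 0 ->
  evXY c x y Phih = y ^+ nu * (pc c Phi).[x / y].
Proof. by move=> y0; rewrite /Phih hz_eval_y // sizePhi. Qed.

Lemma Phih_root (K : fieldType) (c : 'I_6 -> K) (x y : K) : y != 0 ->
  (evXY c x y Phih == 0) = root (pc c Phi) (x / y).
Proof. by move=> y0; rewrite ev_Phih // mulf_eq0 expf_eq0 (negbTE y0) andbF. Qed.

Lemma finite_per (K : fieldType) (c : 'I_6 -> K) x y : fpt c x y -> eval_coefs c g0 != 0 ->
  per c (x, y) n -> y != 0.
Proof.
move=> [hr hxy] hg hp; apply: contra (dyn_inf hdyn hg) => /eqP y0.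
apply: per_par hp => //; first by rewrite xpair_eqE oner_eq0.
by rewrite /par y0 /= mulr0 mul0r.
Qed.

Lemma Phih_exact (K : fieldType) (c : 'I_6 -> K) x y : fpt c x y -> eval_coefs c g0 != 0 -> y != 0 ->
  (evXY c x y Phih = 0 <-> exact_per c (x, y) n).
Proof.
move=> [hr hxy] hg y0.
have h1 : (x / y, 1) != (0, 0) :> K * K by apply: neq0y; exact: oner_neq0.
have hp : par (x / y, 1) (x, y) by rewrite /par /= divfK // mul1r.
have e : evXY c x y Phih = 0 <-> root (pc c Phi) (x / y) by rewrite -Phih_root //; split=> /eqP.
rewrite e (dyn_root hdyn hr hg); split; apply: exact_par => //; exact: par_sym.
Qed.

(** Where [g0] does not vanish, points of Per*_n are finite and satisfy
    [Phih = 0]. *)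
Lemma Per_star_Phih (K : fieldType) (c : 'I_6 -> K) x y P : Per_star n P -> fpt c x y -> reps c x y P ->
  eval_coefs c g0 != 0 -> y != 0 /\ evXY c x y Phih = 0.
Proof.
move=> PP hp hrep hg.
have pn : Per n P by exact: Per_star_sub PP.
have hP : is_point P by case: pn.
split; first by apply: finite_per hp hg _; apply/(Per_per _ hP hrep).
have [M [hM MP exM]] := Per_star_exact n0 PP.
have [K' [c' [x' [y' [hp' hrep' _]]]]] := point_reps hM.
have hg' : eval_coefs c' g0 != 0.
  apply: contra hg => /eqP z; rewrite -(evXY_C c x y).
  by apply/eqP/(hrep _ _ _ (bihomogC hg0))/MP/(hrep' _ _ _ (bihomogC hg0)); rewrite evXY_C.
have ex' := (exact_ptP _ hM hrep').1 exM.
have y0' : y' != 0 by apply: finite_per hp' hg' _; case: ex'.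
apply/(hrep _ _ _ Phih_bihomog)/MP/(hrep' _ _ _ Phih_bihomog).
exact/(Phih_exact hp' hg' y0').
Qed.

Lemma closed_Per_star (K : fieldType) (c : 'I_6 -> K) x : rhoc c != 0 -> eval_coefs c g0 != 0 ->
  root (pc c Phi) x -> Per_star n (Pt c x 1).
Proof.
move=> hr hg rx; apply: exact_Per_star => //.
have hp : fpt c x 1 by split => //; apply: neq0y; exact: oner_neq0.
apply/(exact_ptP _ (Pt_point hp) (@Pt_reps _ c x 1)).
exact/(dyn_root hdyn hr hg).
Qed.

(** The coordinate of the basis. [xx] is X/Y, [TT] is a degree 0 function on
    Rat_2 that vanishes exactly where [g0] does, and [tW] equals [TT * xx] on
    Per*_n but is regular in the chart X <> 0: on Phih = 0 one has
    l x^nu = - (lower terms), which contains a factor Y.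
    [tau] and [wW] are the values of [TT] and [tW]. *)
Definition TT : FracA2XY := ((g0 ^+ 4)%:MP : A2XY)%:F / ((rho ^+ dg)%:MP : A2XY)%:F.
Definition xx : FracA2XY := vX%:F / vY%:F.
Definition G0 : A2XY := - hz nu.-1 Phi.
Definition tW : FracA2XY := ((g0 ^+ 3 * m)%:MP * G0 : A2XY)%:F / ((rho ^+ dg)%:MP * vX ^+ nu.-1 : A2XY)%:F.
Definition tau (K : fieldType) (c : 'I_6 -> K) := eval_coefs c g0 ^+ 4 / rhoc c ^+ dg.
Definition wW (K : fieldType) (c : 'I_6 -> K) x y := 
  eval_coefs c (g0 ^+ 3 * m) * evXY c x y G0 / (rhoc c ^+ dg * x ^+ nu.-1).

Lemma hv_TT (K : fieldType) (c : 'I_6 -> K) x y : rhoc c != 0 -> hv c x y TT (tau c).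
Proof.
move=> hr; rewrite /tau -ev_rho -!evXn -(evXY_C c x y) -(evXY_C c x y (rho ^+ dg)).
apply: (hv_div (d := dg * 4) (e := 0)); first exact: bihomogC (homogX _ hg0).
  by rewrite mulnC; exact: bihomogC (homogX _ rho_homog).
by rewrite evXY_C evXn ev_rho expf_neq0.
Qed.

Lemma hv_xx (K : fieldType) (c : 'I_6 -> K) x y : y != 0 -> hv c x y xx (x / y).
Proof.
move=> y0; rewrite -{2}(evXY_X c x y) -{3}(evXY_Y c x y).
by apply: (hv_div bihomogX bihomogY); rewrite evXY_Y.
Qed.

Lemma G0_bihomog : bihomog D nu.-1 G0.
Proof. by apply: bihomogN; exact: hz_bihomog. Qed.

Lemma hv_tW (K : fieldType) (c : 'I_6 -> K) x y : rhoc c != 0 -> x != 0 -> hv c x y tW (wW c x y).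
Proof.
move=> hr x0.
have e1 : evXY c x y ((rho ^+ dg)%:MP * vX ^+ nu.-1) = rhoc c ^+ dg * x ^+ nu.-1.
  by rewrite evXYM evXY_C evXn ev_rho evXYXn evXY_X.
have e2 : evXY c x y ((g0 ^+ 3 * m)%:MP * G0) = eval_coefs c (g0 ^+ 3 * m) * evXY c x y G0.
  by rewrite evXYM evXY_C.
rewrite /wW -e1 -e2.
have b1 := bihomogM (bihomogC (dhomogM (homogX 3 hg0) hm)) G0_bihomog.
have b2 := bihomogM (bihomogC (homogX dg rho_homog)) (bihomogXn nu.-1 bihomogX).
apply: (hv_div (d := 4 * dg) (e := nu.-1)).
- by apply: bihomog_cast b1 _ _; rewrite /dg; lia.
- by apply: bihomog_cast b2 _ _; rewrite /dg; lia.
- by rewrite e1 mulf_neq0 // expf_neq0.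
Qed.

Lemma wWE (K : fieldType) (c : 'I_6 -> K) x y : (0 < nu)%N -> rhoc c != 0 -> x != 0 -> y != 0 -> evXY c x y Phih = 0 ->
  wW c x y = tau c * (x / y).
Proof.
move=> nu0 hr x0 y0 h.
have e : evXY c x y G0 * y = eval_coefs c l * x ^+ nu.
  have eP : evXY c x y Phih = evXY c x y (hz nu.-1 Phi) * y + eval_coefs c l * x ^+ nu.
    rewrite /Phih !hz_eval big_ord_recr /= subnn mulr1 /l lead_coefE -/nu; congr (_ + _).
    rewrite prednK // big_distrl /=; apply: eq_bigr => i _.
    have -> : (nu - i = (nu.-1 - i).+1)%N by have := ltn_ord i; lia.
    by rewrite exprSr !mulrA.
  by rewrite /G0 evXYN mulNr; apply/eqP; rewrite eq_sym -addr_eq0 addrC -eP h.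
have e' : evXY c x y G0 = eval_coefs c l * x ^+ nu / y by rewrite -e mulfK.
have ex : x ^+ nu = x * x ^+ nu.-1 by rewrite -exprS prednK.
rewrite /wW /tau e' evM evXn ex g0l.
have r0 : rhoc c ^+ dg != 0 by rewrite expf_neq0.
have z0 : x ^+ nu.-1 != 0 by rewrite expf_neq0.
move: (eval_coefs c l) (eval_coefs c m) (rhoc c ^+ dg) (x ^+ nu.-1) r0 z0 => a b r z r0 z0.
by field; rewrite r0 z0 y0.
Qed.

(** The sections TT^(j+3) x^j dx. In the chart X <> 0 the coefficient of d(Y/X)
    is - TT^(j+3) x^(j+2) = - TT (TT x)^(j+2), where the powers of [tW] replace
    those of [TT * xx]. The positive powers of [TT] make the two expressions
    agree on all of Per*_n: both vanish at the points with g0 = 0. *)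
Definition ej (j : nat) : FracA2XY * FracA2XY := (TT ^+ j.+3 * xx ^+ j, - (TT * tW ^+ j.+2)).

Lemma hv_ej1 (K : fieldType) (c : 'I_6 -> K) x y j : rhoc c != 0 -> y != 0 ->
  hv c x y (ej j).1 (tau c ^+ j.+3 * (x / y) ^+ j).
Proof. by move=> hr y0; apply: hvM; apply: hvX; [exact: hv_TT | exact: hv_xx]. Qed.

Lemma hv_ej2 (K : fieldType) (c : 'I_6 -> K) x y j : rhoc c != 0 -> x != 0 ->
  hv c x y (ej j).2 (- (tau c * wW c x y ^+ j.+2)).
Proof. by move=> hr x0; apply/hvN/hvM; [exact: hv_TT | apply: hvX; exact: hv_tW]. Qed.

Lemma chartY_y (K : fieldType) (c : 'I_6 -> K) x y P g : reps c x y P -> chartY g P -> y != 0.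
Proof.
move=> h [_ hy _]; apply/eqP => y0; apply: hy.
by apply/(h _ _ _ bihomogY); rewrite evXY_Y.
Qed.
Lemma chartX_x (K : fieldType) (c : 'I_6 -> K) x y P g : reps c x y P -> chartX g P -> x != 0.
Proof.
move=> h [_ hx _]; apply/eqP => x0; apply: hx.
by apply/(h _ _ _ bihomogX); rewrite evXY_X.
Qed.

Lemma hv_yx2 (K : fieldType) (c : 'I_6 -> K) x y : x != 0 -> hv c x y ((vY%:F / vX%:F) ^+ 2) ((y / x) ^+ 2).
Proof.
move=> x0; apply: hvX; have := @hv_div _ c x y _ _ _ _ bihomogY bihomogX.
by rewrite evXY_X evXY_Y; apply.
Qed.

Lemma ej_Omega g j : (0 < nu)%N -> Omega_Per n g (ej j).
Proof.
move=> nu0; split.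
- move=> P hP; have pP : is_point P by case: hP.
  have [K [c [x [y [[hr hxy] hrep _]]]]] := point_reps pP.
  apply/(reps_regular _ hrep); eexists; apply: hv_ej1 => //; exact: chartY_y hrep hP.
- move=> P hP; have pP : is_point P by case: hP.
  have [K [c [x [y [[hr hxy] hrep _]]]]] := point_reps pP.
  apply/(reps_regular _ hrep); eexists; apply: hv_ej2 => //; exact: chartX_x hrep hP.
move=> P [[PP cY] cX]; have pP : is_point P by case: cY.
have [K [c [x [y [hp hrep _]]]]] := point_reps pP; have [hr hxy] := hp.
have y0 := chartY_y hrep cY; have x0 := chartX_x hrep cX.
apply/(reps_vanishes _ hrep).
have := hvD (hv_ej1 x j hr y0) (hvM (hv_yx2 c y x0) (hv_ej2 y j hr x0)).
suff -> : tau c ^+ j.+3 * (x / y) ^+ j + (y / x) ^+ 2 * (- (tau c * wW c x y ^+ j.+2)) = 0 by [].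
have [g0z|g0n] := eqVneq (eval_coefs c g0) 0.
  by rewrite /tau g0z expr0n mul0r expr0n !mul0r oppr0 mulr0 addr0.
have [_ h] := Per_star_Phih PP hp hrep g0n.
have -> : y / x = (x / y)^-1 by rewrite invf_div.
have z0 : x / y != 0 by rewrite mulf_neq0 // invr_neq0.
rewrite (wWE nu0 hr x0 y0 h); move: (tau c) (x / y) z0 => t z z0.
rewrite [(t * z) ^+ _]exprMn !exprS; move: (z ^+ j) (t ^+ j) => zj tj.
by field.
Qed.

(** A function regular on [chartY g0] is, on Per*_n, a linear combination of the
    [ej]: the numerator is reduced modulo [Phi]. *)
Lemma chart_section_coords F : (forall P, chartY g0 P -> regular_at P F) ->
  exists r : 'cV[FracA2]_nu, (forall j, degree0_loc (g0 * rho) (r j 0)) /\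
   forall (K : fieldType) (c : 'I_6 -> K) x y, fpt c x y -> eval_coefs c g0 != 0 -> y != 0 ->
     evXY c x y Phih = 0 -> exists2 a : 'I_nu -> K, (forall j, rv c (r j 0) (a j)) &
      hv c x y F (\sum_j a j * (tau c ^+ j.+3 * (x / y) ^+ j)).
Proof.
move=> /(hartogs hg0 (dyn_g0 hdyn)) [k [N [hN FE]]].
have hp := homc_dehom hN; set p := dehom N in hp.
have [kk [q [r [e sr hq hr]]]] := pdiv_hom hPhi (eq_leq sizePhi) hp.
have lE : Phi`_nu = l by rewrite /l lead_coefE.
rewrite lE in e.
(* [F] is r(x/y) / (l^(kk+1) (g0 rho)^k) on Per*_n. The factor m^(kk+1) turns the
   power of l into a power of g0 = l m, and TT^(j+3) in [ej] is compensated by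
   rho^(dg (j+3)) / g0^(4 (j+3)). *)
pose K0 j := (kk.+1 + k + 4 * j.+3)%N.
pose num j := r`_j * rho ^+ (dg * j.+3) * m ^+ kk.+1 * rho ^+ (K0 j - k).
have hnum j : num j \is ((dg + 4) * K0 j)%N.-homog.
  have h1 := dhomogM (dhomogM (dhomogM (hr j) (homogX (dg * j.+3) rho_homog)) (homogX kk.+1 hm)) (homogX (K0 j - k) rho_homog).
  rewrite (_ : (dg + 4) * K0 j = k * (dg + 4) + D * kk.+1 + 4 * (dg * j.+3) + dm * kk.+1 + 4 * (K0 j - k))%N //.
  have -> : (K0 j - k = kk.+1 + 4 * j.+3)%N by rewrite /K0 addnAC addnK.
  rewrite /K0 /dg; nia.
have hden := grho_homog hg0.
have grho0 : g0 * rho != 0 by rewrite mulf_neq0 ?rho_neq0 // (dyn_g0 hdyn).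
exists (\col_j ((num j)%:F / (g0 * rho)%:F ^+ (K0 j))); split.
  move=> j; rewrite mxE; exists (K0 j), (num j); split => //.
  by rewrite (homog_msize1 grho0 hden) [(K0 j * _)%N]mulnC; exact: hnum.
move=> K c x y [rc xy0] gc y0 Ph0.
have gl := g0l c; have lc : eval_coefs c l != 0 by apply: contraNneq gc => z; rewrite gl z mul0r.
have mc : eval_coefs c m != 0 by apply: contraNneq gc => z; rewrite gl z mulr0.
pose B := eval_coefs c l ^+ kk.+1 * (eval_coefs c g0 * rhoc c) ^+ k.
have B0 : B != 0 by rewrite mulf_neq0 // expf_neq0 // mulf_neq0.
have tau0 : tau c != 0 by rewrite /tau mulf_neq0 ?invr_neq0 ?expf_neq0.
exists (fun j : 'I_nu => eval_coefs c r`_j / (B * tau c ^+ j.+3)).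
  move=> j; rewrite mxE.
  have hgr : eval_coefs c ((g0 * rho) ^+ K0 j) != 0 by rewrite evXn evM ev_rho expf_neq0 // mulf_neq0.
  have := rv_div (hnum j) (homogX (K0 j) hden) hgr.
  rewrite tofracXn; congr (rv _ _ _).
  have eK : K0 j = (kk.+1 + k + 4 * j.+3)%N by [].
  have eKk : (K0 j - k = kk.+1 + 4 * j.+3)%N by rewrite eK addnAC addnK.
  rewrite /num !evM !evXn eKk eK !evM ev_rho /B /tau.
  move: lc mc rc gc gl; move: (eval_coefs c l) (eval_coefs c m) (rhoc c) (eval_coefs c r`_j) (eval_coefs c g0) => L M R rj G lc mc rc gc gl.
  have e1 : R ^+ (dg * j.+3) = (R ^+ dg) ^+ j.+3 by rewrite exprM.
  have e2 : R ^+ (kk.+1 + 4 * j.+3) = R ^+ kk.+1 * (R ^+ 4) ^+ j.+3 by rewrite exprD exprM.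
  have e3 : (G * R) ^+ (kk.+1 + k + 4 * j.+3) = L ^+ kk.+1 * M ^+ kk.+1 * R ^+ kk.+1 * (G * R) ^+ k * ((G ^+ 4) ^+ j.+3 * (R ^+ 4) ^+ j.+3).
    by rewrite !exprD exprM [(G * R) ^+ kk.+1]exprMn [(G * R) ^+ 4]exprMn [(_ * _) ^+ j.+3]exprMn {1}gl [(L * M) ^+ _]exprMn.
  rewrite e1 e2 e3 expr_div_n.
  have := expf_neq0 kk.+1 lc; have := expf_neq0 kk.+1 mc; have := expf_neq0 kk.+1 rc.
  have := expf_neq0 k (mulf_neq0 gc rc).
  have := expf_neq0 j.+3 (expf_neq0 4 gc); have := expf_neq0 j.+3 (expf_neq0 4 rc).
  have := expf_neq0 j.+3 (expf_neq0 dg rc).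
  move: (L ^+ kk.+1) (M ^+ kk.+1) (R ^+ kk.+1) ((G * R) ^+ k) ((G ^+ 4) ^+ j.+3) ((R ^+ 4) ^+ j.+3) ((R ^+ dg) ^+ j.+3).
  move=> t1 t2 t3 t4 t5 t6 t7 h7 h6 h5 h4 h3 h2 h1; field.
  by rewrite h1 h2 h3 h4 h5 h6 h7.
have hs := sY_bihomog hg0 k.
have sc : evXY c x y (sY g0 ^+ k) != 0 by rewrite evXYXn ev_sY expf_neq0 // !mulf_neq0.
have := hv_div hN hs sc; rewrite -FE.
suff -> : \sum_(j < nu) eval_coefs c r`_j / (B * tau c ^+ j.+3) * (tau c ^+ j.+3 * (x / y) ^+ j) =
   evXY c x y N / evXY c x y (sY g0 ^+ k) by [].
have sr' : (size (pc c r) <= nu)%N by apply: leq_trans sr; exact: size_poly.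
have rE : \sum_(j < nu) eval_coefs c r`_j / (B * tau c ^+ j.+3) * (tau c ^+ j.+3 * (x / y) ^+ j) = (pc c r).[x / y] / B.
  rewrite (horner_coef_wide _ sr') big_distrl /=; apply: eq_bigr => j _.
  rewrite /pc coef_map /=.
  have := expf_neq0 j.+3 tau0; move: (tau c ^+ j.+3) ((x / y) ^+ j) (eval_coefs c r`_j) => t z rj t0.
  by field; rewrite t0 B0.
have e2 : eval_coefs c l ^+ kk.+1 * (pc c p).[x / y] = (pc c r).[x / y].
  have := congr1 (fun P : PA => (pc c P).[x / y]) e; rewrite pcZ pcD pcM hornerZ hornerD hornerM evXn => ->.
  move/eqP: Ph0; rewrite Phih_root // => /rootP ->; by rewrite mulr0 add0r.
rewrite rE -e2 (dehom_eval c x y0 hN) evXYXn ev_sY -/p exprMn /B.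
have := expf_neq0 k y0; have := expf_neq0 kk.+1 lc; have := expf_neq0 k (mulf_neq0 gc rc).
move: (y ^+ k) (eval_coefs c l ^+ kk.+1) ((eval_coefs c g0 * rhoc c) ^+ k) => Y L G hG hL hY.
by field; rewrite hY hG hL.
Qed.

Definition eb (j : 'I_nu) := ej j.

Lemma nu_gt0 (j : 'I_nu) : (0 < nu)%N.
Proof. by case: (nu) j => // -[]. Qed.

Lemma hv_lincomb1 (K : fieldType) (c : 'I_6 -> K) x y (r : 'cV[FracA2]_nu) a : rhoc c != 0 -> y != 0 ->
  (forall j, rv c (r j 0) (a j)) ->
  hv c x y (lincomb r eb).1 (\sum_j a j * (tau c ^+ j.+3 * (x / y) ^+ j)).
Proof.
move=> hr y0 ra; apply: hv_sum => j; apply: hvM; first exact: hv_incl.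
exact: hv_ej1.
Qed.

Lemma hv_lincomb2 (K : fieldType) (c : 'I_6 -> K) x y (r : 'cV[FracA2]_nu) a : rhoc c != 0 -> x != 0 ->
  (forall j, rv c (r j 0) (a j)) ->
  hv c x y (lincomb r eb).2 (\sum_j a j * - (tau c * wW c x y ^+ j.+2)).
Proof.
move=> hr x0 ra; apply: hv_sum => j; apply: hvM; first exact: hv_incl.
exact: hv_ej2.
Qed.

(** A section of the chart X <> 0 that agrees on the overlap with a linear
    combination of the first components of the [ej] is the same combination of
    their second components. *)
Lemma chartX_vanish (K : fieldType) (c : 'I_6 -> K) x y P (F : FracA2XY) (r : 'cV[FracA2]_nu) a b2 :
  reps c x y P -> rhoc c != 0 -> x != 0 -> y != 0 -> evXY c x y Phih = 0 ->
  (forall j, rv c (r j 0) (a j)) -> hv c x y F b2 ->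
  (\sum_j a j * (tau c ^+ j.+3 * (x / y) ^+ j)) + (y / x) ^+ 2 * b2 = 0 ->
  vanishes_at P (F - (lincomb r eb).2).
Proof.
move=> hrep hr x0 y0 h ra hF e; apply/(reps_vanishes _ hrep).
have := hvB hF (hv_lincomb2 y hr x0 ra).
suff -> : b2 - \sum_j a j * - (tau c * wW c x y ^+ j.+2) = 0 by [].
have z0 : x / y != 0 by rewrite mulf_neq0 // invr_neq0.
have -> : \sum_j a j * - (tau c * wW c x y ^+ j.+2) = - (x / y) ^+ 2 * \sum_j a j * (tau c ^+ j.+3 * (x / y) ^+ j).
  rewrite big_distrr /=; apply: eq_bigr => j _; rewrite (wWE (nu_gt0 j) hr x0 y0 h).
  move: (tau c) (x / y) z0 (a j) => t z z0 aj.
  rewrite [(t * z) ^+ _]exprMn !exprS; move: (z ^+ j) (t ^+ j) => zj tj; ring.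
move/eqP: e; rewrite addr_eq0 => /eqP ->.
have -> : y / x = (x / y)^-1 by rewrite invf_div.
by move: (x / y) z0 => z z0; field.
Qed.


Lemma alg_roots (c : 'I_6 -> algC) : eval_coefs c g0 != 0 ->
  exists rs : seq algC, [/\ uniq rs, size rs = nu & forall x, (x \in rs) = root (pc c Phi) x].
Proof.
move=> gc; have lc := dyn_lead_neq0 hdyn gc.
have sz := size_pc_lead lc; rewrite sizePhi in sz.
have p0 : pc c Phi != 0 by rewrite -size_poly_gt0 sz.
have [rs er] := closed_field_poly_normal (pc c Phi).
have l0 : lead_coef (pc c Phi) != 0 by rewrite lead_coef_eq0.
exists rs; split.
- rewrite -separable_prod_XsubC; apply: dvdp_separable (dyn_sep hdyn gc).
  by rewrite [in X in _ %| X]er dvdpZr.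
- by have := congr1 (fun p : {poly algC} => size p) er; rewrite size_scale // size_prod_XsubC sz => -[].
- by move=> x; rewrite er rootZ // root_prod_XsubC.
Qed.

(** The Vandermonde matrix at distinct points is invertible. *)
Lemma vandermonde_free (c : 'I_6 -> algC) rs (a : 'I_nu -> algC) : uniq rs -> size rs = nu -> tau c != 0 ->
  (forall x, x \in rs -> \sum_j a j * (tau c ^+ j.+3 * x ^+ j) = 0) -> forall j, a j = 0.
Proof.
move=> urs srs t0 h j.
pose P : {poly algC} := \poly_(i < nu) (if insub i is Some k then a k * tau c ^+ i.+3 else 0).
have Pc (i : 'I_nu) : P`_i = a i * tau c ^+ i.+3 by rewrite coef_poly ltn_ord valK.
have P0 : P = 0.
  apply/eqP/negPn/negP => Pn.
  have := max_poly_roots Pn _ urs; rewrite srs ltnNge size_poly => H.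
  suff : false by []. apply: H; apply/allP => x xr; rewrite rootE.
  rewrite (horner_coef_wide _ (size_poly _ _)) -[X in _ == X](h x xr); apply/eqP/eq_bigr => i _.
  by rewrite Pc -mulrA.
by have /eqP := Pc j; rewrite P0 coef0 eq_sym mulf_eq0 expf_eq0 (negbTE t0) andbF orbF => /eqP.
Qed.

Lemma ghomog_ex : exists d, g0 * rho \is d.-homog.
Proof. by eexists; exact: grho_homog hg0. Qed.
Lemma grho_neq0 : g0 * rho != 0.
Proof. by rewrite mulf_neq0 ?rho_neq0 // (dyn_g0 hdyn). Qed.

Lemma tau_neq0 (K : fieldType) (c : 'I_6 -> K) : rhoc c != 0 -> eval_coefs c g0 != 0 -> tau c != 0.
Proof. by move=> rc gc; rewrite /tau mulf_neq0 ?invr_neq0 ?expf_neq0. Qed.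

Lemma eb_basis : is_basis n g0 eb.
Proof.
split; first by move=> j; apply: ej_Omega; exact: nu_gt0 j.
move=> h [h1 h2 h3]; have [r [rd rE]] := chart_section_coords h1.
have key (K : fieldType) (c : 'I_6 -> K) x y P : Per_star n P -> fpt c x y -> reps c x y P -> ~ P g0%:MP ->
    [/\ eval_coefs c g0 != 0, y != 0 & evXY c x y Phih = 0].
  move=> PP hp hrep ng.
  have gc : eval_coefs c g0 != 0.
    by apply/eqP => z; apply: ng; apply/(hrep _ _ _ (bihomogC hg0)); rewrite evXY_C.
  by have [y0 hy] := Per_star_Phih PP hp hrep gc.
exists r; split.
  split; first exact: rd.
  split.
  - move=> P [PP cY]; have pP : is_point P by case: cY.
    have [K [c [x [y [hp hrep _]]]]] := point_reps pP; have [hr hxy] := hp.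
    have [gc y0 hy] : [/\ eval_coefs c g0 != 0, y != 0 & evXY c x y Phih = 0] by apply: (key _ _ _ _ _ PP hp hrep); case: cY.
    have [a ra hF] := rE _ _ _ _ hp gc y0 hy.
    apply/(reps_vanishes _ hrep); have := hvB hF (hv_lincomb1 x hr y0 ra).
    by rewrite subrr.
  - move=> P [PP cX]; have pP : is_point P by case: cX.
    have [K [c [x [y [hp hrep _]]]]] := point_reps pP; have [hr hxy] := hp.
    have [gc y0 hy] : [/\ eval_coefs c g0 != 0, y != 0 & evXY c x y Phih = 0] by apply: (key _ _ _ _ _ PP hp hrep); case: cX.
    have x0 := chartX_x hrep cX.
    have cY : chartY g0 P.
      case: cX => hP _ ng; split => //; move=> /(hrep _ _ _ bihomogY); rewrite evXY_Y; exact/eqP.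
    have [a ra hF] := rE _ _ _ _ hp gc y0 hy.
    have [b2 hb2] := (reps_regular _ hrep).1 (h2 _ cX).
    apply: (chartX_vanish hrep hr x0 y0 hy ra hb2).
    have hc : hv c x y (h.1 + (vY%:F / vX%:F) ^+ 2 * h.2) 0.
      by apply/(reps_vanishes _ hrep); apply: h3; split; [split|].
    exact: (hv_uniq (hvD hF (hvM (hv_yx2 c y x0) hb2)) hc).
move=> r' [rd' [e1 _]]; apply/matrixP => j i; rewrite ord1.
apply: (rv_dense (mulf_neq0 (dyn_g0 hdyn) grho_neq0)) => c; rewrite (evM c g0) mulf_eq0 negb_or => /andP[gc hc].
have hr : rhoc c != 0 by move: hc; rewrite evM ev_rho mulf_eq0 negb_or => /andP[].
have val k : exists a, rv c (r k 0) a by apply: rv_degree0 ghomog_ex hc (rd k).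
have val' k : exists a, rv c (r' k 0) a by apply: rv_degree0 ghomog_ex hc (rd' k).
have [a ra] := choice val; have [a' ra'] := choice val'.
suff e : a j = a' j by exists (a j) => //; rewrite e.
apply/eqP; rewrite -subr_eq0; apply/eqP.
have [rs [urs srs rsE]] := alg_roots gc.
apply: (vandermonde_free (a := fun k => a k - a' k) urs srs (tau_neq0 hr gc)) => x xr.
rewrite rsE in xr.
have hp : fpt c x 1 by split => //; apply: neq0y; exact: oner_neq0.
have PP := closed_Per_star hr gc xr; have cY := pt_closed hg0 x hr gc.
have hrep := @Pt_reps _ c x 1.
have [gc' y0 hy] : [/\ eval_coefs c g0 != 0, 1 != 0 :> algC & evXY c x 1 Phih = 0] by apply: (key _ _ _ _ _ PP hp hrep); case: cY.
have [b rb hF] := rE _ _ _ _ hp gc y0 hy.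
have z1 := (reps_vanishes _ hrep).1 (e1 _ (conj PP cY)).
have e2 := hv_uniq z1 (hvB hF (hv_lincomb1 x hr y0 ra')).
have eb' : b = a by apply/funext => k; exact: rv_uniq (rb k) (ra k).
rewrite eb' -sumrB in e2; rewrite [RHS]e2.
by apply: eq_bigr => k _; rewrite divr1 mulrBl.
Qed.

(** The values of [LamY] and [LamX]; at a point of period [n] both are the
    multiplier of the iterate. *)
Definition lamY (K : fieldType) (c : 'I_6 -> K) x y := y * (y * jorb c n (x, y)) / (orb c n (x, y)).2 ^+ 2.
Definition lamX (K : fieldType) (c : 'I_6 -> K) x y := x * (x * jorb c n (x, y)) / (orb c n (x, y)).1 ^+ 2.

Lemma ev_orb1 (K : fieldType) (c : 'I_6 -> K) x y : evXY c x y (phi_iter n).1 = (orb c n (x, y)).1.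
Proof. by rewrite -ev_phi_iter. Qed.
Lemma ev_orb2 (K : fieldType) (c : 'I_6 -> K) x y : evXY c x y (phi_iter n).2 = (orb c n (x, y)).2.
Proof. by rewrite -ev_phi_iter. Qed.

Lemma hv_LamY (K : fieldType) (c : 'I_6 -> K) x y : (orb c n (x, y)).2 != 0 -> hv c x y (LamY n) (lamY c x y).
Proof.
move=> h; have [_ h2] := phi2_bihomog n.
have := @hv_div _ c x y _ _ _ _ (vYJ_bihomog n bihomogY) h2.
by rewrite evXYXn ev_orb2 evXYM (evXYM _ _ _ vY (JJ n)) evXY_Y ev_JJ; apply; rewrite expf_neq0.
Qed.
Lemma hv_LamX (K : fieldType) (c : 'I_6 -> K) x y : (orb c n (x, y)).1 != 0 -> hv c x y (LamX n) (lamX c x y).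
Proof.
move=> h; have [h2 _] := phi2_bihomog n.
have := @hv_div _ c x y _ _ _ _ (vYJ_bihomog n bihomogX) h2.
by rewrite evXYXn ev_orb1 evXYM (evXYM _ _ _ vX (JJ n)) evXY_X ev_JJ; apply; rewrite expf_neq0.
Qed.

Lemma per_orb2 (K : fieldType) (c : 'I_6 -> K) x y : fpt c x y -> y != 0 -> per c (x, y) n -> (orb c n (x, y)).2 != 0.
Proof.
move=> [hr hxy] y0 /eqP /= hp; apply/eqP => z.
have : orb c n (x, y) != (0, 0) by apply: orb_nondeg.
case: (orb c n (x, y)) z hp => a b /= -> /eqP; rewrite mul0r mulf_eq0 (negbTE y0) orbF => /eqP ->.
by rewrite eqxx.
Qed.
Lemma per_orb1 (K : fieldType) (c : 'I_6 -> K) x y : fpt c x y -> x != 0 -> per c (x, y) n -> (orb c n (x, y)).1 != 0.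
Proof.
move=> [hr hxy] x0 /eqP /= hp; apply/eqP => z.
have : orb c n (x, y) != (0, 0) by apply: orb_nondeg.
case: (orb c n (x, y)) z hp => a b /= -> /eqP; rewrite mul0r eq_sym mulf_eq0 (negbTE x0) orbF => /eqP ->.
by rewrite eqxx.
Qed.

Lemma lamXY (K : fieldType) (c : 'I_6 -> K) x y : fpt c x y -> x != 0 -> y != 0 -> per c (x, y) n ->
  lamX c x y = lamY c x y.
Proof.
move=> hp x0 y0 pn; have h1 := per_orb1 hp x0 pn; have h2 := per_orb2 hp y0 pn.
move: pn => /eqP /=; rewrite /lamX /lamY; move: h1 h2 (jorb c n (x, y)); case: (orb c n (x, y)) => a b /= a0 b0 J e.
have -> : a = b * x / y by rewrite -e mulfK.
by field; rewrite b0 x0 y0.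
Qed.

Lemma bihomog_sq d e F : bihomog d e F -> bihomog (2 * d) (2 * e) (F ^+ 2).
Proof. by move=> /(bihomogXn 2); rewrite ![(_ * 2)%N]mulnC. Qed.

(** On Per*_n the multiplier coincides with a function regular on the chart,
    although [LamY] has a denominator. *)
Lemma regular_lam j : exists F, (forall P, chartY g0 P -> regular_at P F) /\
  forall (K : fieldType) (c : 'I_6 -> K) x y, fpt c x y -> eval_coefs c g0 != 0 -> y != 0 ->
    evXY c x y Phih = 0 -> hv c x y F (lamY c x y * (tau c ^+ j.+3 * (x / y) ^+ j)).
Proof.
have [_ b2] := phi_iter_bihomog n.
have [|k [A [l1 l2 hA eA]]] := clear_den hg0 (dyn_g0 hdyn) b2 Phih_bihomog.
  move=> K c x y hp gc y0 h; rewrite ev_orb2; apply: per_orb2 => //.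
  by have [_ pn _] := (Phih_exact hp gc y0).1 h.
pose F0 : FracA2XY := (vY * (vY * JJ n) * A ^+ 2 : A2XY)%:F / ((sY g0 ^+ k) ^+ 2)%:F.
have hv0 (K : fieldType) (c : 'I_6 -> K) x y : fpt c x y -> eval_coefs c g0 != 0 -> y != 0 ->
    hv c x y F0 (y * (y * jorb c n (x, y)) * evXY c x y A ^+ 2 / evXY c x y (sY g0 ^+ k) ^+ 2).
  move=> [hr _] gc y0.
  have hn := bihomogM (vYJ_bihomog n bihomogY) (bihomog_sq hA).
  have hd := bihomog_sq (sY_bihomog hg0 k).
  have hn' : bihomog (2 * (k * (dg + 4))) (2 * k) (vY * (vY * JJ n) * A ^+ 2).
    by apply: bihomog_cast hn _ _; move: l1 l2; move: (2 ^ n)%N (k * (dg + 4))%N => u v; lia.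
  have := @hv_div _ c x y _ _ _ _ hn' hd.
  rewrite (evXYM _ _ _ (vY * (vY * JJ n)) (A ^+ 2)) !evXYXn ev_sY (evXYM _ _ _ vY (vY * JJ n)) (evXYM _ _ _ vY (JJ n)) evXY_Y ev_JJ; apply.
  by rewrite !expf_neq0 // !mulf_neq0.
exists (F0 * (ej j).1); split.
  move=> P cY; have pP : is_point P by case: cY.
  have [K [c [x [y [hp hrep _]]]]] := point_reps pP; have [hr hxy] := hp.
  have y0 := chartY_y hrep cY.
  have gc : eval_coefs c g0 != 0.
    by apply/eqP => z; case: cY => _ _; apply; apply/(hrep _ _ _ (bihomogC hg0)); rewrite evXY_C.
  by apply/(reps_regular _ hrep); eexists; apply: hvM (hv0 _ _ _ _ hp gc y0) (hv_ej1 x j hr y0).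
move=> K c x y hp gc y0 h; have [hr hxy] := hp.
have [_ pn _] := (Phih_exact hp gc y0).1 h.
have o2 := per_orb2 hp y0 pn.
have := hvM (hv0 _ _ _ _ hp gc y0) (hv_ej1 x j hr y0).
have s0 : evXY c x y (sY g0 ^+ k) != 0 by rewrite evXYXn ev_sY expf_neq0 // !mulf_neq0.
suff -> : y * (y * jorb c n (x, y)) * evXY c x y A ^+ 2 / evXY c x y (sY g0 ^+ k) ^+ 2 = lamY c x y by [].
move: s0; rewrite (eA _ _ _ _ h) ev_orb2 mulf_eq0 negb_or => /andP[a0 _].
rewrite /lamY; move: (evXY c x y A) a0 (jorb c n (x, y)) ((orb c n (x, y)).2) o2 => a a0 J o o2.
by field; rewrite a0 o2.
Qed.

Lemma eb_matrix : exists M : 'M[FracA2]_nu, is_pullback_matrix n g0 eb M.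
Proof.
have ex (j : 'I_nu) : exists r : 'cV[FracA2]_nu, (forall i, degree0_loc (g0 * rho) (r i 0)) /\
    forall (K : fieldType) (c : 'I_6 -> K) x y, fpt c x y -> eval_coefs c g0 != 0 -> y != 0 ->
     evXY c x y Phih = 0 -> exists2 a : 'I_nu -> K, (forall i, rv c (r i 0) (a i)) &
      \sum_i a i * (tau c ^+ i.+3 * (x / y) ^+ i) = lamY c x y * (tau c ^+ j.+3 * (x / y) ^+ j).
  have [F [regF hF]] := regular_lam j; have [r [rd rE]] := chart_section_coords regF.
  exists r; split => // K c x y hp gc y0 h; have [a ra ha] := rE _ _ _ _ hp gc y0 h.
  by exists a => //; exact: hv_uniq ha (hF _ _ _ _ hp gc y0 h).
have [R hR] := choice ex.
exists (\matrix_(i, j) R j i 0); split.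
  by move=> i j; rewrite mxE; case: (hR j).
move=> j; have [rd rE] := hR j.
have -> : col j (\matrix_(i, j) R j i 0) = R j by apply/matrixP => i k; rewrite !mxE ord1.
rewrite phi_pullbackE; split.
- move=> P [PP cY]; have pP : is_point P by case: cY.
  have [K [c [x [y [hp hrep _]]]]] := point_reps pP; have [hr hxy] := hp.
  have gc : eval_coefs c g0 != 0.
    by apply/eqP => z; case: cY => _ _; apply; apply/(hrep _ _ _ (bihomogC hg0)); rewrite evXY_C.
  have [y0 hy] := Per_star_Phih PP hp hrep gc.
  have [_ pn _] := (Phih_exact hp gc y0).1 hy.
  have [a ra ea] := rE _ _ _ _ hp gc y0 hy.
  apply/(reps_vanishes _ hrep).
  have := hvB (hvM (hv_LamY (per_orb2 hp y0 pn)) (hv_ej1 x j hr y0)) (hv_lincomb1 x hr y0 ra).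
  by rewrite ea subrr.
move=> P [PP cX]; have pP : is_point P by case: cX.
have [K [c [x [y [hp hrep _]]]]] := point_reps pP; have [hr hxy] := hp.
have gc : eval_coefs c g0 != 0.
  by apply/eqP => z; case: cX => _ _; apply; apply/(hrep _ _ _ (bihomogC hg0)); rewrite evXY_C.
have [y0 hy] := Per_star_Phih PP hp hrep gc.
have [_ pn _] := (Phih_exact hp gc y0).1 hy.
have x0 := chartX_x hrep cX.
have [a ra ea] := rE _ _ _ _ hp gc y0 hy.
apply: (chartX_vanish hrep hr x0 y0 hy ra (hvM (hv_LamX (per_orb1 hp x0 pn)) (hv_ej2 y j hr x0))).
rewrite ea (lamXY hp x0 y0 pn) (wWE (nu_gt0 j) hr x0 y0 hy).
have -> : y / x = (x / y)^-1 by rewrite invf_div.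
have z0 : x / y != 0 by rewrite mulf_neq0 // invr_neq0.
move: (tau c) (lamY c x y) (x / y) z0 => t lm z z0.
rewrite [(t * z) ^+ _]exprMn !exprS; move: (z ^+ j) (t ^+ j) => zj tj.
by field.
Qed.
End Basis.

(** * Values of the characteristic polynomial *)
(** If [E] diagonalizes [M], with eigenvalues [lam], the characteristic
    polynomial is as expected; [E] is invertible as it divides [V]. *)
Lemma det_conj_diag (F : fieldType) d (E V R M : 'M[F]_d) (lam : 'rV[F]_d) :
  (forall a : 'cV[F]_d, V *m a = 0 -> a = 0) -> V = E *m R -> diag_mx lam *m E = E *m M ->
  \det ('X%:M + map_mx polyC M) = \prod_i ('X + (lam 0 i)%:P).
Proof.
move=> hV eV eE.
have VU : V \in unitmx.
  rewrite -unitmx_tr -row_free_unit; apply: inj_row_free => v hv.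
  apply: trmx_inj; rewrite trmx0; apply: hV.
  by rewrite -[V]trmxK -trmx_mul hv trmx0.
have EU : E \in unitmx by move: VU; rewrite eV !unitmxE det_mulmx unitrM => /andP[].
have E0 : \det (map_mx polyC E) != 0.
  by rewrite det_map_mx polyC_eq0 -unitfE -unitmxE.
apply: (mulfI E0); rewrite -det_mulmx mulmxDr -map_mxM -eE.
have -> : map_mx polyC E *m 'X%:M = 'X%:M *m map_mx polyC E by rewrite scalar_mxC.
rewrite map_mxM -mulmxDl det_mulmx mulrC; congr (_ * _).
have -> : 'X%:M + map_mx polyC (diag_mx lam) = diag_mx (\row_i ('X + (lam 0 i)%:P)).
  apply/matrixP => i j; rewrite !mxE; case: eqP => [->|_] /=; rewrite ?mulr1n ?mulr0n //.
  by rewrite addr0.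
by rewrite det_diag; apply: eq_bigr => i _; rewrite mxE.
Qed.

Section Charpoly.
Variables (n : nat) (Phi : PA) (g0 m : A2) (D dm : nat).
Hypothesis n0 : (0 < n)%N.
Hypothesis hdyn : dyn n Phi g0.
Hypothesis hPhi : homc D Phi.
Hypothesis hm : m \is dm.-homog.
Hypothesis g0E : g0 = lead_coef Phi * m.
Let nu := (size Phi).-1.

(** [E] is the matrix of the values of the given basis at the points of exact
    period [n], and [V] that of the sections [ej]. *)
Lemma charpoly_pv (g : A2) (e : 'I_nu -> FracA2XY * FracA2XY) (M : 'M[FracA2]_nu) (c : 'I_6 -> algC) rs :
  (exists d, g \is d.-homog) -> is_basis n g e -> is_pullback_matrix n g e M ->
  rhoc c != 0 -> eval_coefs c g != 0 -> eval_coefs c g0 != 0 ->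
  uniq rs -> size rs = nu -> (forall x, (x \in rs) = root (pc c Phi) x) ->
  pv c (\det ('X%:M + map_mx polyC M)) (\prod_(x <- rs) ('X + (lamY n c x 1)%:P)).
Proof.
move=> [dg hg] [eO eB] [Md eM] hr gc g0c urs srs rsE.
have hgr : exists d, g * rho \is d.-homog by eexists; exact: grho_homog hg.
have grc : eval_coefs c (g * rho) != 0 by rewrite evM ev_rho mulf_neq0.
pose xi (i : 'I_nu) := rs`_i.
have xir i : root (pc c Phi) (xi i) by rewrite -rsE mem_nth // srs.
have pS i : Per_star n (Pt c (xi i) 1) := closed_Per_star hdyn hr g0c (xir i).
have cY i : chartY g (Pt c (xi i) 1) := pt_closed hg (xi i) hr gc.
have hrep i := @Pt_reps _ c (xi i) 1.
have hE (ij : 'I_nu * 'I_nu) : exists a, hv c (xi ij.1) 1 (e ij.2).1 a.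
  by have [h1 _ _] := eO ij.2; apply/(reps_regular _ (hrep ij.1)); exact: h1 (cY ij.1).
have [E0 E0E] := choice hE.
have hM (ij : 'I_nu * 'I_nu) : exists a, rv c (M ij.1 ij.2) a by apply: rv_degree0 hgr grc (Md _ _).
have [M0 M0E] := choice hM.
pose E := \matrix_(i < nu, j < nu) E0 (i, j); pose M' := \matrix_(i < nu, j < nu) M0 (i, j).
pose lam := \row_(i < nu) lamY n c (xi i) 1.
pose V := \matrix_(i < nu, j < nu) (tau g0 D dm c ^+ (j : nat).+3 * xi i ^+ j).
have hlin i (r : 'cV[FracA2]_nu) (a : 'I_nu -> algC) : (forall k, rv c (r k 0) (a k)) ->
    hv c (xi i) 1 (lincomb r e).1 (\sum_k a k * E0 (i, k)).
  by move=> ra; apply: hv_sum => k; apply: hvM; [exact: hv_incl | exact: (E0E (i, k))].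
have eR (j : 'I_nu) : exists a : 'I_nu -> algC, forall i, V i j = \sum_k a k * E0 (i, k).
  have [r [[rd [r1 _]] _]] := eB _ (ej_Omega n0 hdyn hPhi hm g0E g j (nu_gt0 j)).
  have /choice[a ra] : forall k, exists a, rv c (r k 0) a by move=> k; apply: rv_degree0 hgr grc (rd k).
  exists a => i; rewrite mxE.
  have z := (reps_vanishes _ (hrep i)).1 (r1 _ (conj (pS i) (cY i))).
  have h := hvB (hv_ej1 hPhi hm g0E (xi i) j hr (oner_neq0 _)) (hlin i r a ra).
  by have := hv_uniq h z; rewrite divr1 => /eqP; rewrite subr_eq0 => /eqP.
have [R RE] := choice eR.
pose R' := \matrix_(i < nu, j < nu) R j i.
have eVR : V = E *m R'.
  by apply/matrixP => i j; rewrite RE !mxE; apply: eq_bigr => k _; rewrite !mxE mulrC.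
have eEM : diag_mx lam *m E = E *m M'.
  apply/matrixP => i j; rewrite mul_diag_mx !mxE.
  have [z1 _] := eM j; rewrite phi_pullbackE in z1.
  have {}z1 := (reps_vanishes _ (hrep i)).1 (z1 _ (conj (pS i) (cY i))).
  have ra k : rv c (col j M k 0) (M0 (k, j)) by rewrite mxE; exact: (M0E (k, j)).
  have hp : fpt c (xi i) 1 by split => //; apply: neq0y; exact: oner_neq0.
  have pn : per c (xi i, 1) n by have [_ ] := (dyn_root hdyn hr g0c _).1 (xir i).
  have h := hvB (hvM (hv_LamY (per_orb2 hp (oner_neq0 _) pn)) (E0E (i, j))) (hlin i _ _ ra).
  have := hv_uniq h z1 => /eqP; rewrite subr_eq0 => /eqP ->.
  by apply: eq_bigr => k _; rewrite !mxE mulrC.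
have hV (a : 'cV[algC]_nu) : V *m a = 0 -> a = 0.
  move=> Va; apply/matrixP => j i; rewrite ord1 mxE.
  apply: (vandermonde_free (D := D) (dm := dm) (g0 := g0) (c := c) (a := fun k => a k 0) urs srs).
    exact: tau_neq0.
  move=> x xr; have ix : (index x rs < nu)%N by rewrite -srs index_mem.
  have := congr1 (fun A : 'cV_nu => A (Ordinal ix) 0) Va; rewrite !mxE => h; rewrite -[RHS]h.
  by apply: eq_bigr => k _; rewrite !mxE /xi /= nth_index // mulrC.
have -> : \prod_(x <- rs) ('X + (lamY n c x 1)%:P) = \det ('X%:M + map_mx polyC M').
  rewrite (det_conj_diag hV eVR eEM) (big_nth 0) big_mkord srs.
  by apply: eq_bigr => i _; rewrite mxE.
apply: pv_det => i j; rewrite !mxE; apply: pvD; last by apply: pvC; exact: (M0E (i, j)).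
by case: (i == j); rewrite ?mulr1n ?mulr0n; [exact: (pvXn c 1) | exact: pv0].
Qed.
End Charpoly.

(** The algebraic map [c] has exactly [nu n] points of exact period [n], the
    elements of [rs], and infinity has not period [n]. *)
Definition good (n : nat) (c : 'I_6 -> algC) (rs : seq algC) : Prop :=
  [/\ uniq rs, size rs = `|nu n|%N, forall x, (x \in rs) <-> exact_per c (x, 1) n & ~~ per c (1, 0) n].

Lemma charpoly_exists n : (0 < n)%N -> exists (g0 : A2) (e0 : 'I_`|nu n| -> FracA2XY * FracA2XY) (M0 : 'M[FracA2]_`|nu n|),
  [/\ g0 != 0, exists d, g0 \is d.-homog, is_basis n g0 e0, is_pullback_matrix n g0 e0 M0 &
    forall c : 'I_6 -> algC, rhoc c != 0 -> eval_coefs c g0 != 0 -> exists2 rs, good n c rs &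
      forall g e (M : 'M[FracA2]_`|nu n|), (exists d, g \is d.-homog) -> is_basis n g e -> is_pullback_matrix n g e M ->
         eval_coefs c g != 0 -> pv c (\det ('X%:M + map_mx polyC M)) (\prod_(x <- rs) ('X + (lamY n c x 1)%:P))].
Proof.
move=> n0; have [[Phi g0] /= hd] := dyn_exists n0.
have [D hPhi] := dyn_hom hd; have [m [[dm hm] g0E]] := dyn_lead hd.
have sz : (size Phi).-1 = `|nu n|%N.
  have := dyn_size hd; have := dyn_Phi0 hd; rewrite -size_poly_gt0.
  by case: (size Phi) => // k _; rewrite intS addrC => /addIr <-.
rewrite /good -sz; exists g0, (@eb Phi g0 m D dm).
have [M hM] := eb_matrix n0 hd hPhi hm g0E.
exists M; split=> //; [exact: dyn_g0 hd | exact: dyn_ghom hd | exact: eb_basis |].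
move=> c hr gc; have [rs [urs srs rsE]] := alg_roots hd gc.
exists rs; first split => //.
- by move=> x; rewrite rsE; exact: (dyn_root hd hr gc).
- by have := dyn_inf hd gc.
move=> g e M' hg hb hM' gc'.
exact: (charpoly_pv n0 hd hPhi hm g0E hg hb hM' hr gc' gc urs srs rsE).
Qed.

(** * Conjugation of quadratic maps *)
Section Conj.
Variable T : comNzRingType.
Implicit Types (c : 'I_6 -> T) (p q r s : T).

(** The linear map with matrix (p q; r s). *)
Definition mob p q r s (u : T * T) : T * T := (p * u.1 + q * u.2, r * u.1 + s * u.2).

(** The coefficients of adj(f) o c o f, for f the matrix (p q; r s). *)
Definition cj p q r s c : 'I_6 -> T :=
  let A a0 a1 a2 := a0 * p ^+ 2 + a1 * (p * r) + a2 * r ^+ 2 in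
  let B a0 a1 a2 := 2 * a0 * (p * q) + a1 * (p * s + q * r) + 2 * a2 * (r * s) in
  let C a0 a1 a2 := a0 * q ^+ 2 + a1 * (q * s) + a2 * s ^+ 2 in
  mkc (s * A (c 0) (c 1) (c 2) - q * A (c 3) (c 4) (c 5))
      (s * B (c 0) (c 1) (c 2) - q * B (c 3) (c 4) (c 5))
      (s * C (c 0) (c 1) (c 2) - q * C (c 3) (c 4) (c 5))
      (- r * A (c 0) (c 1) (c 2) + p * A (c 3) (c 4) (c 5))
      (- r * B (c 0) (c 1) (c 2) + p * B (c 3) (c 4) (c 5))
      (- r * C (c 0) (c 1) (c 2) + p * C (c 3) (c 4) (c 5)).

(** The binary quadratic form with the given coefficients. *)
Definition quad (a b d : T) : {mpoly T[2]} :=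
  a *: varX _ ^+ 2 + b *: (varX _ * varY _) + d *: varY _ ^+ 2.

Lemma coef_quad a b d : [/\ (quad a b d)@_(U_(0) *+ 2) = a, (quad a b d)@_(U_(0) + U_(1)) = b & (quad a b d)@_(U_(1) *+ 2) = d].
Proof.
have e : forall m, (quad a b d)@_m = a * (m == (U_(0%R) *+ 2)%MM)%:R + b * (m == (U_(0%R) + U_(1%R))%MM)%:R + d * (m == (U_(1%R) *+ 2)%MM)%:R.
  by move=> m; rewrite /quad /varX /varY !mpolyXn -mpolyXD !mcoeffD !mcoeffZ !mcoeffX ![_ == m]eq_sym.
have t (m1 m2 : 'X_{1..2}) i : m1 i != m2 i -> (m1 == m2) = false.
  by move=> h; apply/negbTE; apply: contra h => /eqP ->.
have h1 : (U_(0%R) *+ 2 == U_(0%R) + U_(1%R) :> 'X_{1..2})%MM = false by apply: (t _ _ 0); rewrite mnmDE mulmnE !mnmE.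
have h2 : (U_(0%R) *+ 2 == U_(1%R) *+ 2 :> 'X_{1..2})%MM = false by apply: (t _ _ 0); rewrite !mulmnE !mnmE.
have h3 : (U_(0%R) + U_(1%R) == U_(1%R) *+ 2 :> 'X_{1..2})%MM = false by apply: (t _ _ 0); rewrite mnmDE mulmnE !mnmE.
have h1' := h1; have h2' := h2; have h3' := h3; rewrite eq_sym in h1'; rewrite eq_sym in h2'; rewrite eq_sym in h3'.
by split; rewrite e !(h1, h2, h3, h1', h2', h3', eqxx) !mulr0 mulr1 ?add0r ?addr0.
Qed.

Lemma quad_subst a b d p q r s :
  quad a b d \mPo [tuple p *: varX _ + q *: varY _; r *: varX _ + s *: varY _] =
  quad (a * p ^+ 2 + b * (p * r) + d * r ^+ 2)
       (2 * a * (p * q) + b * (p * s + q * r) + 2 * d * (r * s))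
       (a * q ^+ 2 + b * (q * s) + d * s ^+ 2).
Proof.
rewrite /quad !comp_mpolyD !comp_mpolyZ !expr2 !rmorphM /= /varX /varY !comp_mpolyXU -!tnth_nth !(tnth_nth 0) /=.
rewrite -!mul_mpolyC !rmorphD !rmorphM /= !rmorph_nat.
move: 'X_0 'X_1 => X Y.
have -> : (p * s + q * r)%:MP_[2] = p%:MP * s%:MP + q%:MP * r%:MP by rewrite rmorphD !rmorphM.
by move: (a%:MP) (b%:MP) (d%:MP) (p%:MP) (q%:MP) (r%:MP) (s%:MP) => ? ? ? ? ? ? ?; ring.
Qed.
Lemma coefs_quad a b d a' b' d' : coefs_of (quad a b d) (quad a' b' d') = mkc a b d a' b' d'.
Proof.
apply/funext => i; rewrite /coefs_of.
have [-> -> ->] := coef_quad a b d; have [-> -> ->] := coef_quad a' b' d'.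
by rewrite /mkc (tnth_nth 0) /=; case: i => [[|[|[|[|[|[|]]]]]]].
Qed.
Lemma conj_coefsE (f : 'M[T]_2) c : conj_coefs f c = cj (f 0 0) (f 0 1) (f 1 0) (f 1 1) c.
Proof.
have lc x y a b d a' b' d' : x *: quad a b d + y *: quad a' b' d' = quad (x * a + y * a') (x * b + y * b') (x * d + y * d').
  rewrite /quad -!mul_mpolyC !rmorphD !rmorphM /=; move: (varX T) (varY T) => X Y.
  by move: (x%:MP) (y%:MP) (a%:MP) (b%:MP) (d%:MP) (a'%:MP) (b'%:MP) (d'%:MP) => ? ? ? ? ? ? ? ?; ring.
rewrite /conj_coefs -!/(quad _ _ _) /form_a /form_b -!/(quad _ _ _) !quad_subst -scaleNr !lc.
by rewrite coefs_quad /cj !mulNr.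
Qed.
End Conj.

Section ConjDyn.
Variable T : comNzRingType.
Implicit Types (c : 'I_6 -> T) (p q r s : T).

Lemma step_cj p q r s c u :
  step (cj p q r s c) u = (s * qa c (mob p q r s u) - q * qb c (mob p q r s u),
                           - r * qa c (mob p q r s u) + p * qb c (mob p q r s u)).
Proof.
by rewrite /step /qa /qb /cj /mkc !(tnth_nth 0) /=; congr (_, _); ring.
Qed.

Lemma act_step p q r s c u :
  mob p q r s (step (cj p q r s c) u) =
  ((p * s - q * r) * qa c (mob p q r s u), (p * s - q * r) * qb c (mob p q r s u)).
Proof.
rewrite step_cj; move: (qa _ _) (qb _ _) => a b.
by rewrite /mob /=; congr (_, _); ring.
Qed.

Lemma jac_cj p q r s c u :
  jac (cj p q r s c) u = (p * s - q * r) ^+ 2 * jac c (mob p q r s u).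
Proof.
rewrite /jac /jq /jp /jr /cj /mkc !(tnth_nth 0) /=; ring.
Qed.

Lemma rhoc_cj p q r s c : rhoc (cj p q r s c) = (p * s - q * r) ^+ 6 * rhoc c.
Proof.
pose t := p * s - q * r.
have eq : jq (cj p q r s c) = t ^+ 2 * (jq c * p ^+ 2 + 2 * jp c * (p * r) + jr c * r ^+ 2).
  by rewrite /t /jq /jp /jr /cj /mkc !(tnth_nth 0) /=; ring.
have ep : jp (cj p q r s c) = t ^+ 2 * (jq c * (p * q) + jp c * (p * s + q * r) + jr c * (r * s)).
  by rewrite /t /jq /jp /jr /cj /mkc !(tnth_nth 0) /=; ring.
have er : jr (cj p q r s c) = t ^+ 2 * (jq c * q ^+ 2 + 2 * jp c * (q * s) + jr c * s ^+ 2).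
  by rewrite /t /jq /jp /jr /cj /mkc !(tnth_nth 0) /=; ring.
rewrite /rhoc eq ep er /t; move: (jq c) (jp c) (jr c) => a b d; ring.
Qed.

Lemma cj_id c : cj 1 0 0 1 c = c.
Proof.
apply/funext => i; rewrite /cj /mkc (tnth_nth 0) /=.
case: i => [[|[|[|[|[|[|//]]]]]] hi] /=; rewrite ?expr2 !(mulr0, mul0r, mulr1, mul1r, addr0, add0r, oppr0, subr0); congr (c _); exact/val_inj.
Qed.

Lemma cj_scale k p q r s c : cj (k * p) (k * q) (k * r) (k * s) c = (fun i => k ^+ 3 * cj p q r s c i).
Proof.
apply/funext => i; rewrite /cj /mkc !(tnth_nth 0) /=.
by case: i => [[|[|[|[|[|[|//]]]]]] hi] /=; ring.
Qed.
End ConjDyn.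

Lemma rm_cj (T S : comNzRingType) (f : {rmorphism T -> S}) p q r s c :
  f \o cj p q r s c = cj (f p) (f q) (f r) (f s) (f \o c).
Proof.
apply/funext => i; rewrite /cj /mkc /= !(tnth_nth 0) /=.
case: i => [[|[|[|[|[|[|//]]]]]] hi] /=; rewrite ?expr2 !(rmorphD, rmorphB, rmorphM, rmorphN, rmorph_nat) /=; ring.
Qed.

Lemma det2 (T : comNzRingType) (f : 'M[T]_2) : \det f = f 0 0 * f 1 1 - f 0 1 * f 1 0.
Proof. rewrite (expand_det_row _ 0) !big_ord_recl big_ord0 /cofactor !det_mx11 !mxE /= /bump /=.
have -> : lift 0 0 = 1 :> 'I_2 by exact/val_inj.
have -> : lift 1 0 = 0 :> 'I_2 by exact/val_inj.
by rewrite expr0 expr1 addr0; ring.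
Qed.

Section ConjPer.
Variables (K : fieldType) (p q r s : K) (c : 'I_6 -> K).
Hypothesis d1 : p * s - q * r = 1.
Let c' := cj p q r s c.
Let f := mob p q r s.

Lemma act_orb k u : f (orb c' k u) = orb c k (f u).
Proof.
elim: k => [//|k IH]; rewrite /orb !iterS -!/(orb _ _ _) -IH.
by rewrite /f act_step d1 !mul1r.
Qed.

Lemma jorb_cj k u : jorb c' k u = jorb c k (f u).
Proof. by apply: eq_bigr => i _; rewrite jac_cj d1 expr1n mul1r -/f act_orb. Qed.

Lemma par_act u v : par (f u) (f v) = par u v.
Proof.
rewrite /par -subr_eq0 -[in RHS]subr_eq0 /f /mob /=; congr (_ == _).
by rewrite -[RHS]mul1r -d1; ring.
Qed.

Lemma per_cj u k : per c' u k = per c (f u) k.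
Proof. by rewrite /per -[LHS]par_act act_orb. Qed.

Lemma exact_cj u k : exact_per c' u k <-> exact_per c (f u) k.
Proof.
by split=> -[k0 pk hk]; split=> [//||m /hk]; rewrite ?per_cj // -per_cj.
Qed.

Lemma act_neq0 u : u != (0, 0) -> f u != (0, 0).
Proof.
case: u => x y; apply: contra; rewrite !xpair_eqE /f /mob /= => /andP[/eqP h1 /eqP h2].
have ex : x = s * (p * x + q * y) - q * (r * x + s * y) by rewrite -[LHS]mul1r -d1; ring.
have ey : y = p * (r * x + s * y) - r * (p * x + q * y) by rewrite -[LHS]mul1r -d1; ring.
by apply/andP; split; apply/eqP; [rewrite ex | rewrite ey]; rewrite h1 h2 !mulr0 subrr.
Qed.
End ConjPer.

Lemma lamY_evXY n (K : fieldType) (c : 'I_6 -> K) x y :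
  lamY n c x y = evXY c x y (vY * (vY * JJ n)) / evXY c x y ((phi_iter n).2 ^+ 2).
Proof. by rewrite evXYXn ev_orb2 evXYM (evXYM _ _ _ vY (JJ n)) evXY_Y ev_JJ. Qed.

Lemma lamY_scale n (K : fieldType) (c : 'I_6 -> K) t x y : t != 0 ->
  lamY n c (t * x) (t * y) = lamY n c x y.
Proof.
move=> t0; rewrite !lamY_evXY.
have e : c = (fun i => 1 * c i) by apply/funext => i; rewrite mul1r.
rewrite [in LHS]e (evXY_scale _ _ _ _ _ (vYJ_bihomog n bihomogY)) (evXY_scale _ _ _ _ _ (phi2_bihomog n).2).
rewrite !expr1n !mul1r.
have := expf_neq0 (2 * 2 ^ n)%N t0; move: (t ^+ _) => z z0.
by rewrite invfM mulrACA mulfV // mul1r.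
Qed.

(** If the iterate multiplies [u] by [k], the multiplier is the product of the
    Jacobians along the orbit, divided by k^2; this expression does not depend
    on the coordinate. *)
Lemma lamY_multiplier n (K : fieldType) (c : 'I_6 -> K) u k : u.2 != 0 ->
  orb c n u = (k * u.1, k * u.2) -> lamY n c u.1 u.2 = jorb c n u / k ^+ 2.
Proof.
case: u => x y /= y0 e; rewrite /lamY e /=.
have [->|k0] := eqVneq k 0; first by rewrite mul0r !expr0n invr0 !mulr0.
by field; rewrite k0 y0.
Qed.

Lemma lamY_cj n (K : fieldType) (p q r s : K) c u : p * s - q * r = 1 ->
  u.2 != 0 -> (mob p q r s u).2 != 0 -> per (cj p q r s c) u n ->
  lamY n (cj p q r s c) u.1 u.2 = lamY n c (mob p q r s u).1 (mob p q r s u).2.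
Proof.
move=> d1 u0 v0 pu.
have u00 : u != (0, 0) by apply: contraNneq u0 => ->.
have [k ek] := par_scale u00 pu.
rewrite (lamY_multiplier u0 ek) (lamY_multiplier (k := k) v0) ?jorb_cj //.
by rewrite -act_orb // ek /mob /=; congr (_, _); ring.
Qed.

(** Conjugation permutes the points of exact period [n] and preserves their
    multipliers. *)
Lemma good_prod_cj n (c : 'I_6 -> algC) p q r s rs rs' : rhoc c != 0 -> p * s - q * r = 1 ->
  good n c rs -> good n (cj p q r s c) rs' ->
  \prod_(x <- rs') ('X + (lamY n (cj p q r s c) x 1)%:P) = \prod_(x <- rs) ('X + (lamY n c x 1)%:P).
Proof.
move=> hr d1 [urs srs rsE ninf] [urs' srs' rsE' ninf'].
pose f x := mob p q r s (x, 1); pose h x := (f x).1 / (f x).2.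
have n1 x : (x, 1) != (0, 0) :> algC * algC by apply: neq0y; exact: oner_neq0.
have f0 x : f x != (0, 0) by exact: act_neq0.
have fE x : x \in rs' -> exact_per c (f x) n by move=> /rsE' /exact_cj; apply.
have f2 x : x \in rs' -> (f x).2 != 0.
  move=> /fE [_ pn _]; apply: contra ninf => /eqP z.
  apply: per_par pn => //; first by rewrite xpair_eqE oner_eq0.
  by rewrite /par z /= mulr0 mul0r.
have hE x : x \in rs' -> h x \in rs.
  move=> xr; apply/rsE; apply: exact_par (fE _ xr) => //.
  by rewrite /par /h /= divfK ?f2 // mul1r.
have hin : {in rs' &, injective h}.
  move=> x y xr yr /eqP; rewrite /h eqr_div ?f2 // => /eqP e.
  have : par (f x) (f y) by rewrite /par e mulrC.
  by rewrite par_act // /par /= mulr1 mul1r => /eqP.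
have pe : perm_eq (map h rs') rs.
  apply: uniq_perm => //; first by rewrite map_inj_in_uniq.
  have sub : {subset map h rs' <= rs} by move=> _ /mapP[x xr ->]; exact: hE.
  by have [||//] := uniq_min_size _ sub; rewrite ?map_inj_in_uniq // size_map srs srs'.
rewrite -(perm_big _ pe) big_map big_seq [RHS]big_seq; apply: eq_bigr => x xr.
congr ('X + _%:P); have [_ pn _] := (rsE' x).1 xr.
rewrite (lamY_cj (u := (x, 1)) d1 (oner_neq0 _) (f2 _ xr) pn) -[(mob _ _ _ _ _)]/(f x).
by rewrite -(lamY_scale _ _ (h x) 1 (f2 _ xr)) mulr1 /h mulrC divfK // f2.
Qed.

(** Evaluation of an integral polynomial. *)
Definition evn (n : nat) (T : comNzRingType) (v : 'I_n -> T) : {mpoly int[n]} -> T := mmap intr v.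
HB.instance Definition _ (n : nat) (T : comNzRingType) (v : 'I_n -> T) :=
  GRing.RMorphism.copy (evn v) (mmap intr v).
Lemma evnX n (T : comNzRingType) (v : 'I_n -> T) i : evn v 'X_i = v i.
Proof. by rewrite /evn mmapX mmap1U. Qed.
Lemma evn_int n (T : comNzRingType) (v : 'I_n -> int) (P : {mpoly int[n]}) :
  evn (fun i => (v i)%:~R : T) P = (P.@[v])%:~R.
Proof.
apply: (@mpoly_rm_eq _ _ _ (GRing.RMorphism.clone _ _ (evn _) _) (GRing.RMorphism.clone _ _ (intr \o meval v) _)) => [r|i] /=.
  by rewrite /evn mmapC mevalC.
by rewrite evnX mevalXU.
Qed.

Lemma mpoly_dense n (h P : {mpoly int[n]}) : h != 0 ->
  (forall v : 'I_n -> algC, evn v h != 0 -> evn v P = 0) -> P = 0.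
Proof.
move=> h0 H; apply/eqP/negPn/negP => P0.
have [v] := mpoly_nonzero_pt (mulf_neq0 h0 P0); rewrite rmorphM mulf_eq0 negb_or => /andP[hv Pv].
have := H (fun i => (v i)%:~R); rewrite !evn_int !intr_eq0 => /(_ hv) /eqP; rewrite intr_eq0.
exact/negP.
Qed.

(* Universal coefficients c0, ..., c5 and matrix entries f0, ..., f3. *)
Definition cU : 'I_6 -> {mpoly int[10]} := fun i => 'X_(lshift 4 i).
Definition fU (i : 'I_4) : {mpoly int[10]} := 'X_(rshift 6 i).
Definition join (T : Type) (c : 'I_6 -> T) (f : 'I_4 -> T) : 'I_(6 + 4) -> T :=
  fun i => match split i with inl j => c j | inr j => f j end.
Definition t4 (T : Type) (p q r s : T) : 'I_4 -> T := tnth [tuple p; q; r; s].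

Lemma ev_cU (T : comNzRingType) (c : 'I_6 -> T) f : evn (join c f) \o cU = c.
Proof.
apply/funext => i /=; rewrite /cU evnX /join; case: splitP => j /= e.
  by congr (c _); exact/val_inj.
by have := ltn_ord i; rewrite e ltnNge leq_addr.
Qed.
Lemma ev_fU (T : comNzRingType) (c : 'I_6 -> T) f i : evn (join c f) (fU i) = f i.
Proof.
rewrite /fU evnX /join; case: splitP => j /= e.
  by have := ltn_ord j; rewrite -e ltnNge leq_addr.
by congr (f _); apply/val_inj/(@addnI 6).
Qed.

Definition cjU : 'I_6 -> {mpoly int[10]} := cj (fU 0) (fU 1) (fU 2) (fU 3) cU.
Definition detU := fU 0 * fU 3 - fU 1 * fU 2.

Lemma ev_cjU (T : comNzRingType) (c : 'I_6 -> T) p q r s :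
  evn (join c (t4 p q r s)) \o cjU = cj p q r s c.
Proof. by rewrite /cjU rm_cj ev_cU /= !ev_fU. Qed.
Lemma ev_detU (T : comNzRingType) (c : 'I_6 -> T) p q r s :
  evn (join c (t4 p q r s)) detU = p * s - q * r.
Proof. by rewrite /detU rmorphB !rmorphM /= !ev_fU. Qed.

Lemma join_surj (T : Type) (v : 'I_10 -> T) : exists (c : 'I_6 -> T) p q r s, v = join c (t4 p q r s).
Proof.
exists (fun i => v (@lshift 6 4 i)), (v (@rshift 6 4 0)), (v (@rshift 6 4 1)), (v (@rshift 6 4 2)), (v (@rshift 6 4 3)).
apply/funext => i; rewrite /join /t4; case: splitP => j e; first by congr (v _); exact/val_inj.
rewrite (tnth_nth (v i)); case: j e => [[|[|[|[|//]]]] hj] /= e; by congr (v _); exact/val_inj.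
Qed.

Section Rm.
Variables (U T : comNzRingType) (f : {rmorphism U -> T}).
Lemma rm_sub_expM (A B D : U) k : f (A - D ^+ k * B) = f A - f D ^+ k * f B.
Proof. by rewrite rmorphB rmorphM rmorphXn. Qed.
Lemma rm_mul4 (A B C D : U) : f (A * B * C * D) = f A * f B * f C * f D.
Proof. by rewrite !rmorphM. Qed.
End Rm.

Lemma evn_ev n (T : comNzRingType) (v : 'I_n -> T) c (P : A2) :
  evn v (eval_coefs c P) = eval_coefs (evn v \o c) P.
Proof. exact: rm_ev. Qed.

(** A form [N] of degree 4k that is invariant under SL_2 at generic algebraic
    points satisfies N(f.c) = det(f)^(6k) N(c) identically: over the algebraic
    numbers, scaling [f] by a square root of its determinant multiplies the
    conjugate by the cube of that root. *)
Lemma cj_invariant (N g : A2) k dg : N \is (4 * k)%N.-homog -> g \is dg.-homog -> g != 0 ->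
  (forall (c : 'I_6 -> algC) p q r s, p * s - q * r = 1 -> rhoc c != 0 ->
     eval_coefs c g != 0 -> eval_coefs (cj p q r s c) g != 0 ->
     eval_coefs (cj p q r s c) N = eval_coefs c N) ->
  forall (T : comNzRingType) (c : 'I_6 -> T) p q r s, p * s - q * r = 1 ->
     eval_coefs (cj p q r s c) N = eval_coefs c N.
Proof.
pose idU : {mpoly int[10]} := eval_coefs cjU N - detU ^+ (6 * k) * eval_coefs cU N.
pose h : {mpoly int[10]} := detU * eval_coefs cU rho * eval_coefs cU g * eval_coefs cjU g.
have idE (T : comNzRingType) (c : 'I_6 -> T) p q r s : evn (join c (t4 p q r s)) idU =
    eval_coefs (cj p q r s c) N - (p * s - q * r) ^+ (6 * k) * eval_coefs c N.
  have e1 := evn_ev (join c (t4 p q r s)) cjU N; have e2 := evn_ev (join c (t4 p q r s)) cU N.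
  by rewrite ev_cjU in e1; rewrite ev_cU in e2; rewrite -e1 -e2 -(ev_detU c); exact: rm_sub_expM.
have hE (T : comNzRingType) (c : 'I_6 -> T) p q r s : evn (join c (t4 p q r s)) h =
    (p * s - q * r) * rhoc c * eval_coefs c g * eval_coefs (cj p q r s c) g.
  have e1 := evn_ev (join c (t4 p q r s)) cjU g; have e2 := evn_ev (join c (t4 p q r s)) cU g.
  have e3 := evn_ev (join c (t4 p q r s)) cU rho.
  rewrite ev_cjU in e1; rewrite ev_cU in e2; rewrite ev_cU in e3.
  rewrite -ev_rho -e1 -e2 -e3 -(ev_detU c); exact: rm_mul4.
move=> hN hg g0 H; suff e : idU = 0.
  move=> T c p q r s d1; have := idE T c p q r s.
  by rewrite e d1 expr1n mul1r rmorph0 => /esym /eqP; rewrite subr_eq0 => /eqP.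
have [w hw] := A2_dense (mulf_neq0 rho_neq0 g0).
move: hw; rewrite evM ev_rho mulf_eq0 negb_or => /andP[w1 w2].
apply: (mpoly_dense (h := h)) => [|v].
  apply/eqP => h0; have := hE _ w 1 0 0 1; rewrite h0 rmorph0 cj_id mulr1 mulr0 subr0 mul1r => /esym /eqP.
  by apply/negP; rewrite !mulf_neq0.
have [c [p [q [r [s ->]]]]] := join_surj v.
rewrite hE idE !mulf_eq0 !negb_or -!andbA => /and4P[d0 rc gc gc'].
have [t et] : exists t : algC, t ^+ 2 = p * s - q * r by exists (sqrtC (p * s - q * r)); rewrite sqrtCK.
have t0 : t != 0 by apply: contraNneq d0 => t0; rewrite -et t0 expr0n.
have ek x : x = t * (x / t) by rewrite mulrC divfK.
have d1 : (p / t) * (s / t) - (q / t) * (r / t) = 1.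
  have -> : (p / t) * (s / t) - (q / t) * (r / t) = (p * s - q * r) / t ^+ 2 by field.
  by rewrite et divff.
have ec : cj p q r s c = (fun i => t ^+ 3 * cj (p / t) (q / t) (r / t) (s / t) c i).
  by rewrite -cj_scale -!ek.
have {gc'} gc' : eval_coefs (cj (p / t) (q / t) (r / t) (s / t) c) g != 0.
  by move: gc'; rewrite ec (ev_scale _ _ hg) mulf_eq0 negb_or => /andP[].
rewrite ec (ev_scale _ _ hN) (H c _ _ _ _ d1 rc gc gc') -et -!exprM.
by rewrite (_ : 3 * (4 * k) = 2 * (6 * k))%N ?subrr // !mulnA.
Qed.

(** * Invariance of the sigma_i^(n) *)
Lemma coef_revsum (R : nzRingType) d (s : nat -> R) i :
  (\sum_(j < d.+1) (s j)%:P * 'X^(d - j))`_i = if (i <= d)%N then s (d - i)%N else 0.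
Proof.
rewrite coef_sum; case: leqP => hi.
  have hi' : (d - i < d.+1)%N by rewrite ltnS leq_subr.
  rewrite (bigD1 (Ordinal hi')) //= coefCM coefXn subKn // eqxx mulr1 big1 ?addr0 // => j ne.
  rewrite coefCM coefXn; case: eqP => [e|_]; last by rewrite mulr0.
  by case/eqP: ne; apply/val_inj => /=; rewrite e subKn // -ltnS.
rewrite big1 // => j _; rewrite coefCM coefXn; case: eqP => [e|_]; last by rewrite mulr0.
by move: hi; rewrite e ltnNge leq_subr.
Qed.

(** The value of [sigma_i^(n)] at a generic algebraic point is an elementary
    symmetric function of the multipliers. *)
Lemma sigma_value n s : (0 < n)%N -> is_sigma n s ->
  exists g : A2, [/\ g != 0, exists d, g \is d.-homog &
   forall c : 'I_6 -> algC, rhoc c != 0 -> eval_coefs c g != 0 -> exists2 rs, good n c rs &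
     forall i, (i <= `|nu n|)%N -> rv c (s i) (\prod_(x <- rs) ('X + (lamY n c x 1)%:P))`_(`|nu n| - i)].
Proof.
move=> n0 [sd sE]; have [g [e [M [g0 hg eb eM H]]]] := charpoly_exists n0.
exists g; split => // c hr gc; have [rs hrs hpv] := H c hr gc; exists rs => // i hi.
have := hpv g e M hg eb eM gc (`|nu n| - i)%N; rewrite (sE g e M g0 hg eb eM).
by rewrite coef_revsum leq_subr subKn.
Qed.

Lemma SL2_invariant0 : SL2_invariant 0.
Proof.
exists 0%N, 0; split; first exact: dhomog0.
  by rewrite (_ : (0 : A2)%:F = 0) ?mul0r // tofrac0.
by move=> T c f _ _; rewrite !rmorph0 !mul0r.
Qed.

Lemma sigma_SL2 n i s : (0 < n)%N -> is_sigma n s -> (i <= `|nu n|)%N -> SL2_invariant (s i).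
Proof.
move=> n0 hs hi; have [g [g0 [dg hg] H]] := sigma_value n0 hs.
have [k [N [hN sN]]] := hs.1 i.
exists k, N; split => // T c f rc d1.
rewrite det2 in d1; rewrite conj_coefsE !ev_rho rhoc_cj d1 expr1n mul1r.
rewrite msize_rho mulnC in hN.
congr (_ / _); apply: (cj_invariant hN hg g0) d1 => b p q r t d1 rb gb gb'.
have rb' : rhoc (cj p q r t b) != 0 by rewrite rhoc_cj d1 expr1n mul1r.
have val (c' : 'I_6 -> algC) a : rhoc c' != 0 -> rv c' (s i) a -> eval_coefs c' N = a * rhoc c' ^+ k.
  move=> rc'; rewrite sN -tofracXn => ha.
  have := rv_div hN (homogX k rho_homog) (_ : eval_coefs c' (rho ^+ k) != 0).
  by rewrite evXn ev_rho => /(_ (expf_neq0 k rc')) /rv_uniq /(_ ha) <-; rewrite divfK // expf_neq0.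
have [rs hrs v1] := H b rb gb; have [rs' hrs' v2] := H _ rb' gb'.
rewrite (val _ _ rb (v1 i hi)) (val _ _ rb' (v2 i hi)) rhoc_cj d1 expr1n mul1r.
by rewrite (good_prod_cj rb d1 hrs hrs').
Qed.

Lemma sigma_invariant n i : (0 < n)%N -> i%:Z <= nu n -> SL2_invariant (sigma n i).
Proof.
move=> n0 hi; rewrite /sigma; case: xgetP => [s _ hs|_]; last exact: SL2_invariant0.
apply: sigma_SL2 hs _ => //; move: hi; case: (nu n) => // m; by rewrite lez_nat.
Qed.

(** * Milnor's formulas for the multipliers at the fixed points *)
Section Milnor.
Variable T : comNzRingType.
Implicit Type c : 'I_6 -> T.

(** The numerators of sigma_1 and sigma_2, with denominator [rho]. *)
Definition sigma1_of c : T :=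
  c 2 * c 4 ^+ 3 - 4 * c 2 * c 3 * c 4 * c 5 - 6 * c 2 ^+ 2 * c 3 ^+ 2
  - c 1 * c 4 ^+ 2 * c 5 + 4 * c 1 * c 3 * c 5 ^+ 2 + 4 * c 1 * c 2 * c 3 * c 4
  - 2 * c 1 ^+ 2 * c 3 * c 5 + c 1 ^+ 3 * c 3 - 2 * c 0 * c 2 * c 4 ^+ 2
  + 4 * c 0 * c 2 * c 3 * c 5 - 4 * c 0 * c 1 * c 2 * c 3
  - c 0 * c 1 ^+ 2 * c 4 + 2 * c 0 ^+ 2 * c 5 ^+ 2 + 4 * c 0 ^+ 2 * c 2 * c 4.

Definition sigma2_of c : T :=
  - (c 4 ^+ 2 * c 5 ^+ 2) + 4 * c 3 * c 5 ^+ 3 - 2 * c 2 * c 4 ^+ 3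
  + 10 * c 2 * c 3 * c 4 * c 5 + 12 * c 2 ^+ 2 * c 3 ^+ 2
  - 4 * c 1 * c 3 * c 5 ^+ 2 - 7 * c 1 * c 2 * c 3 * c 4
  - c 1 ^+ 2 * c 4 ^+ 2 + 5 * c 1 ^+ 2 * c 3 * c 5 - 2 * c 1 ^+ 3 * c 3
  + 2 * c 0 * c 4 * c 5 ^+ 2 + 5 * c 0 * c 2 * c 4 ^+ 2
  - 4 * c 0 * c 2 * c 3 * c 5 - c 0 * c 1 * c 4 * c 5
  + 10 * c 0 * c 1 * c 2 * c 3 - 4 * c 0 ^+ 2 * c 2 * c 4
  + 2 * c 0 ^+ 2 * c 1 * c 5 - c 0 ^+ 2 * c 1 ^+ 2 + 4 * c 0 ^+ 3 * c 2.

(* The hypotheses say that x1, x2, x3 are the roots of the fixed point equation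
   x F_b(x, 1) - F_a(x, 1) = b0 (x - x1) (x - x2) (x - x3). The multiplier at x1
   is 1 - D x1 x2 x3 / Q x1. *)
Variables (c : 'I_6 -> T) (x1 x2 x3 : T).
Hypothesis e0 : c 0 = c 4 + c 3 * (x1 + x2 + x3).
Hypothesis e1 : c 1 = c 5 - c 3 * (x1 * x2 + x1 * x3 + x2 * x3).
Hypothesis e2 : c 2 = c 3 * (x1 * x2 * x3).
Let Q x := qb c (x, 1).
Let D (x y z : T) := c 3 * (x - y) * (x - z).

Lemma rho_fix : rhoc c = c 3 * (Q x1 * Q x2 * Q x3).
Proof.
rewrite /Q /rhoc /jp /jq /jr /qb e0 e1 e2 /=.
by move: (c 3) (c 4) (c 5) => b0 b1 b2; ring.
Qed.

Lemma jac_fix : [/\ jac c (x1, 1) = Q x1 * (Q x1 - D x1 x2 x3),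
  jac c (x2, 1) = Q x2 * (Q x2 - D x2 x1 x3) & jac c (x3, 1) = Q x3 * (Q x3 - D x3 x1 x2)].
Proof.
rewrite /Q /D /jac /jp /jq /jr /qb e0 e1 e2 /=.
by move: (c 3) (c 4) (c 5) => b0 b1 b2; split; ring.
Qed.

Lemma sg_fix : [/\
  sigma1_of c = c 3 * ((Q x1 - D x1 x2 x3) * Q x2 * Q x3 + Q x1 * (Q x2 - D x2 x1 x3) * Q x3 + Q x1 * Q x2 * (Q x3 - D x3 x1 x2)),
  sigma2_of c = c 3 * ((Q x1 - D x1 x2 x3) * (Q x2 - D x2 x1 x3) * Q x3 +
     (Q x1 - D x1 x2 x3) * Q x2 * (Q x3 - D x3 x1 x2) + Q x1 * (Q x2 - D x2 x1 x3) * (Q x3 - D x3 x1 x2)) &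
  sigma1_of c - 2 * rhoc c = c 3 * ((Q x1 - D x1 x2 x3) * (Q x2 - D x2 x1 x3) * (Q x3 - D x3 x1 x2))].
Proof.
rewrite rho_fix /sigma1_of /sigma2_of /Q /D /qb e0 e1 e2 /=.
by move: (c 3) (c 4) (c 5) => b0 b1 b2; split; ring.
Qed.
End Milnor.

Lemma milnor_formulas (K : fieldType) (c : 'I_6 -> K) x1 x2 x3 (lam := fun x => jac c (x, 1) / qb c (x, 1) ^+ 2) :
  c 0 = c 4 + c 3 * (x1 + x2 + x3) -> c 1 = c 5 - c 3 * (x1 * x2 + x1 * x3 + x2 * x3) ->
  c 2 = c 3 * (x1 * x2 * x3) -> rhoc c != 0 ->
  [/\ lam x1 + lam x2 + lam x3 = sigma1_of c / rhoc c,
      lam x1 * lam x2 + lam x1 * lam x3 + lam x2 * lam x3 = sigma2_of c / rhoc c &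
      lam x1 * lam x2 * lam x3 = sigma1_of c / rhoc c - 2].
Proof.
move=> e0 e1 e2 hr; have [s1 s2 s3] := sg_fix e0 e1 e2; have [j1 j2 j3] := jac_fix e0 e1 e2.
have er := rho_fix e0 e1 e2.
have -> : sigma1_of c / rhoc c - 2 = (sigma1_of c - 2 * rhoc c) / rhoc c by rewrite mulrBl mulfK.
rewrite s3 s1 s2 /lam j1 j2 j3; move: hr; rewrite er !mulf_eq0 !negb_or -!andbA => /and4P[b0 q1 q2 q3].
move: (c 3) (qb c (x1, 1)) (qb c (x2, 1)) (qb c (x3, 1)) b0 q1 q2 q3 => b Q1 Q2 Q3 b0 q1 q2 q3.
by split; field; rewrite b0 q1 q2 q3.
Qed.

Lemma prod3_coef (R : comNzRingType) (a b d : R) i :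
  (('X + a%:P) * (('X + b%:P) * ('X + d%:P)))`_i =
  [:: a * b * d; a * b + a * d + b * d; a + b + d; 1]`_i.
Proof.
have -> : ('X + a%:P) * (('X + b%:P) * ('X + d%:P)) =
    'X^3 + (a + b + d)%:P * 'X^2 + (a * b + a * d + b * d)%:P * 'X^1 + (a * b * d)%:P.
  by rewrite !rmorphD !rmorphM /=; ring.
rewrite !coefD !coefCM !coefXn coefC.
by case: i => [|[|[|[|i]]]] /=; rewrite ?mulr0 ?mulr1 ?add0r ?addr0 // nth_nil.
Qed.

Lemma nu1 : nu 1 = 3.
Proof. by rewrite /nu (_ : divisors 1 = [:: 1%N]) // big_seq1. Qed.

Lemma good1_fixed (c : 'I_6 -> algC) rs : rhoc c != 0 -> good 1 c rs ->
  exists x1 x2 x3, [/\ rs = [:: x1; x2; x3], c 0 = c 4 + c 3 * (x1 + x2 + x3),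
    c 1 = c 5 - c 3 * (x1 * x2 + x1 * x3 + x2 * x3) & c 2 = c 3 * (x1 * x2 * x3)].
Proof.
move=> hr [urs srs rsE ninf]; rewrite nu1 in srs.
have b0 : c 3 != 0.
  apply: contra ninf => /eqP z.
  by rewrite /per /par /orb /= /qa /qb /= z expr1n !(expr2, mulr0, mul0r, add0r, mulr1).
case: rs urs srs rsE => [|x1 [|x2 [|x3 [|]]]] // urs _ rsE; exists x1, x2, x3.
pose q := Poly [:: - c 2; c 5 - c 1; c 4 - c 0; c 3].
have qs : q = [:: - c 2; c 5 - c 1; c 4 - c 0; c 3] :> seq algC by rewrite (PolyK (c := 0)).
have qE i : q`_i = [:: - c 2; c 5 - c 1; c 4 - c 0; c 3]`_i by rewrite qs.
have rq x : x \in [:: x1; x2; x3] -> root q x.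
  move=> /rsE [_ /eqP e _]; rewrite rootE horner_Poly /=.
  move: e; rewrite /orb /= /qa /qb /= expr1n !mulr1 => e.
  by rewrite -[X in _ == X](subrr (c 0 * x ^+ 2 + c 1 * x + c 2)) [X in _ == X - _]e; apply/eqP; ring.
have := @all_roots_prod_XsubC _ q [:: x1; x2; x3]; rewrite qs => /(_ erefl) H.
have {H} qP : q = c 3 *: (('X + (- x1)%:P) * (('X + (- x2)%:P) * ('X + (- x3)%:P))).
  rewrite {}H; last by rewrite uniq_rootsE.
    by rewrite lead_coefE qs /= !big_cons big_nil mulr1 !polyCN.
  by apply/allP => x; exact: rq.
have h i := congr1 (fun p : {poly algC} => p`_i) qP.
have := h 0%N; have := h 1%N; have := h 2%N; rewrite !coefZ !prod3_coef !qE /= => h2 h1 h0.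
split => //.
- by rewrite -[c 0](subKr (c 4)) opprB addrC -[_ - c 4]opprB h2; ring.
- by rewrite -[c 1](subKr (c 5)) h1; ring.
- by rewrite -[c 2]opprK h0; ring.
Qed.

Lemma good1_prod (c : 'I_6 -> algC) rs : rhoc c != 0 -> good 1 c rs -> forall i,
  (\prod_(x <- rs) ('X + (lamY 1 c x 1)%:P))`_i =
  [:: sigma1_of c / rhoc c - 2; sigma2_of c / rhoc c; sigma1_of c / rhoc c; 1]`_i.
Proof.
move=> hr /(good1_fixed hr) [x1 [x2 [x3 [-> e0 e1 e2]]]] i.
have lE x : lamY 1 c x 1 = jac c (x, 1) / qb c (x, 1) ^+ 2.
  by rewrite /lamY /jorb big_ord1 /orb /= !mul1r.
rewrite !big_cons big_nil mulr1 prod3_coef !lE.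
by have [-> -> ->] := milnor_formulas e0 e1 e2 hr.
Qed.


Lemma rm_sg (T S : comNzRingType) (f : {rmorphism T -> S}) c :
  f (sigma1_of c) = sigma1_of (f \o c) /\ f (sigma2_of c) = sigma2_of (f \o c).
Proof.
have fM x y : f (x * y) = f x * f y by exact: rmorphM.
have fX x k : f (x ^+ k) = f x ^+ k by exact: rmorphXn.
have fD x y : f (x + y) = f x + f y by exact: rmorphD.
have fN x : f (- x) = - f x by exact: rmorphN.
have fn k : f k%:R = k%:R by exact: rmorph_nat.
by split; rewrite /sigma1_of /sigma2_of !(fD, fN, fM, fX, fn).
Qed.

Definition sigma1_num : A2 := sigma1_of gen_coefs.
Definition sigma2_num : A2 := sigma2_of gen_coefs.

Lemma ev_sigma1_num (T : comNzRingType) (c : 'I_6 -> T) : eval_coefs c sigma1_num = sigma1_of c.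
Proof. by rewrite /sigma1_num (rm_sg _ _).1; congr sigma1_of; apply/funext => i /=; rewrite ev_X. Qed.
Lemma ev_sigma2_num (T : comNzRingType) (c : 'I_6 -> T) : eval_coefs c sigma2_num = sigma2_of c.
Proof. by rewrite /sigma2_num (rm_sg _ _).2; congr sigma2_of; apply/funext => i /=; rewrite ev_X. Qed.

Lemma sigma_num_homog : sigma1_num \is 4.-homog /\ sigma2_num \is 4.-homog.
Proof.
have hX i : gen_coefs i \is 1.-homog by exact: X_homog.
have h i j k l : gen_coefs i * gen_coefs j * gen_coefs k * gen_coefs l \is 4.-homog.
  exact: (dhomogM (dhomogM (dhomogM (hX i) (hX j)) (hX k)) (hX l)).
have hn (u : nat) p : p \is 4.-homog -> u%:R * p \is 4.-homog by move=> hp; rewrite mulr_natl rpredMn.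
pose m i j k l := gen_coefs i * gen_coefs j * gen_coefs k * gen_coefs l.
split.
- have -> : sigma1_num = m 2 4 4 4 - 4%:R * m 2 3 4 5 - 6%:R * m 2 2 3 3
  - m 1 4 4 5 + 4%:R * m 1 3 5 5 + 4%:R * m 1 2 3 4
  - 2%:R * m 1 1 3 5 + m 1 1 1 3 - 2%:R * m 0 2 4 4
  + 4%:R * m 0 2 3 5 - 4%:R * m 0 1 2 3
  - m 0 1 1 4 + 2%:R * m 0 0 5 5 + 4%:R * m 0 0 2 4.
    by rewrite /sigma1_num /sigma1_of /m; move: (gen_coefs 0) (gen_coefs 1) (gen_coefs 2) (gen_coefs 3) (gen_coefs 4) (gen_coefs 5) => ? ? ? ? ? ?; ring.
  by rewrite !(rpredD, rpredB, rpredN, hn, h).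
- have -> : sigma2_num = - m 4 4 5 5 + 4%:R * m 3 5 5 5 - 2%:R * m 2 4 4 4
  + 10%:R * m 2 3 4 5 + 12%:R * m 2 2 3 3
  - 4%:R * m 1 3 5 5 - 7%:R * m 1 2 3 4
  - m 1 1 4 4 + 5%:R * m 1 1 3 5 - 2%:R * m 1 1 1 3
  + 2%:R * m 0 4 5 5 + 5%:R * m 0 2 4 4
  - 4%:R * m 0 2 3 5 - m 0 1 4 5
  + 10%:R * m 0 1 2 3 - 4%:R * m 0 0 2 4
  + 2%:R * m 0 0 1 5 - m 0 0 1 1 + 4%:R * m 0 0 0 2.
    by rewrite /sigma2_num /sigma2_of /m; move: (gen_coefs 0) (gen_coefs 1) (gen_coefs 2) (gen_coefs 3) (gen_coefs 4) (gen_coefs 5) => ? ? ? ? ? ?; ring.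
  by rewrite !(rpredD, rpredB, rpredN, hn, h).
Qed.

(** 1, sigma_1, sigma_2, sigma_3 for the fixed points, with
    sigma_3 = sigma_1 - 2; the values for i > 3 are irrelevant. *)
Definition milnor_s (i : nat) : FracA2 :=
  [:: 1; sigma1_num%:F / rho%:F; sigma2_num%:F / rho%:F; sigma1_num%:F / rho%:F - 2]`_i.

Lemma rho_F : rho%:F != 0. Proof. by rewrite tofrac_eq0 rho_neq0. Qed.

Lemma milnor_s_loc i : degree0_loc rho (milnor_s i).
Proof.
have [h1 h2] := sigma_num_homog.
have k0 (a : nat) : degree0_loc rho a%:R.
  exists 0%N, a%:R; split; last by rewrite expr0 divr1 tofracMn tofrac1.
  by rewrite mul0n -[a%:R]mul1r mulr_natr rpredMn // dhomog1.
have k1 N : N \is 4.-homog -> degree0_loc rho (N%:F / rho%:F).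
  by move=> hN; exists 1%N, N; rewrite msize_rho expr1.
case: i => [|[|[|[|i]]]]; rewrite /milnor_s /=; [exact: (k0 1%N)|exact: k1|exact: k1| |rewrite nth_nil; exact: (k0 0%N)].
have -> : sigma1_num%:F / rho%:F - 2 = (sigma1_num - rho *+ 2)%:F / rho%:F.
  by rewrite tofracB tofracMn mulrBl mulrnAl divff // rho_F.
by apply: k1; rewrite rpredB // rpredMn // rho_homog.
Qed.

Lemma rv_milnor_s (c : 'I_6 -> algC) i : rhoc c != 0 ->
  rv c (milnor_s i) [:: 1; sigma1_of c / rhoc c; sigma2_of c / rhoc c; sigma1_of c / rhoc c - 2]`_i.
Proof.
move=> hr; have [h1 h2] := sigma_num_homog.
have v1 : rv c (sigma1_num%:F / rho%:F) (sigma1_of c / rhoc c).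
  by rewrite -ev_sigma1_num -ev_rho; apply: (rv_div h1 rho_homog); rewrite ev_rho.
have v2 : rv c (sigma2_num%:F / rho%:F) (sigma2_of c / rhoc c).
  by rewrite -ev_sigma2_num -ev_rho; apply: (rv_div h2 rho_homog); rewrite ev_rho.
case: i => [|[|[|[|i]]]]; rewrite /milnor_s /= ?nth_nil; [exact: rv1|done|done| |exact: rv0].
by apply: rvB => //; exact: (rv_nat c 2).
Qed.

Lemma milnor_s_is_sigma : is_sigma 1 milnor_s.
Proof.
split; first exact: milnor_s_loc.
have [g1 [_ [_ [g10 _ _ _ H]]]] := charpoly_exists (ltn0Sn 0).
move=> d g e M g0 hg hb hM; apply/polyP => i.
apply: (rv_dense (mulf_neq0 rho_neq0 (mulf_neq0 g0 g10))) => c.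
rewrite !evM ev_rho !mulf_eq0 !negb_or => /and3P[rc gc g1c].
have [rs hrs hpv] := H c rc g1c.
have := hpv g e M hg hb hM gc i; rewrite (good1_prod rc hrs).
move=> h; eexists; first exact: h.
rewrite coef_revsum /d nu1; have v := rv_milnor_s _ rc.
case: i h => [|[|[|[|i]]]] _; [exact: (v 3)|exact: (v 2)|exact: (v 1)|exact: (v 0)|].
by rewrite /= nth_nil; exact: rv0.
Qed.

(** * Normal forms *)
Lemma sigma1E : sigma 1 1 = sigma1_num%:F / rho%:F /\ sigma 1 2 = sigma2_num%:F / rho%:F.
Proof.
have [s hs es] : exists2 s, is_sigma 1 s & sigma 1 = s.
  by exists (sigma 1) => //; exact: (xgetPex (P := [set s | is_sigma 1 s]%classic) (fun=> 0) (ex_intro _ _ milnor_s_is_sigma)).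
rewrite es; have [g [g0 _ H]] := sigma_value (ltn0Sn 0) hs.
have eq i : (i <= 3)%N -> s i = milnor_s i.
  move=> hi; apply: (rv_dense (mulf_neq0 rho_neq0 g0)) => c.
  rewrite evM ev_rho mulf_eq0 negb_or => /andP[rc gc].
  have [rs hrs /(_ i)] := H c rc gc; rewrite nu1 => /(_ hi); rewrite (good1_prod rc hrs) => v.
  eexists; first exact: v.
  have := rv_milnor_s i rc.
  by case: i hi v => [|[|[|[|]]]].
by split; rewrite eq.
Qed.

Lemma rv_scale (c : 'I_6 -> algC) t x a : t != 0 -> rv c x a -> rv (fun i => t * c i) x a.
Proof.
move=> t0 [d [N [D [hN hD D0 -> ->]]]].
have := @rv_div _ (fun i => t * c i) d N D hN hD.
rewrite (ev_scale _ _ hN) (ev_scale _ _ hD) => /(_ (mulf_neq0 (expf_neq0 _ t0) D0)).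
by rewrite invfM mulrACA divff ?mul1r // expf_neq0.
Qed.

(** Invariant functions take the same value at [c] and at a conjugate of [c]. *)
Lemma inv_rv x (c : 'I_6 -> algC) p q r s : SL2_invariant x -> rhoc c != 0 -> p * s - q * r != 0 ->
  exists2 a, rv c x a & rv (cj p q r s c) x a.
Proof.
move=> [k [N [hN -> inv]]] rc d0; rewrite msize_rho mulnC in hN.
have val (b : 'I_6 -> algC) : rhoc b != 0 -> rv b (N%:F / rho%:F ^+ k) (eval_coefs b N / rhoc b ^+ k).
  move=> rb; rewrite -ev_rho -evXn -tofracXn; apply: (rv_div hN (homogX k rho_homog)).
  by rewrite evXn ev_rho expf_neq0.
exists (eval_coefs c N / rhoc c ^+ k); first exact: val.
pose t := sqrtC (p * s - q * r).
have et : t ^+ 2 = p * s - q * r by rewrite sqrtCK.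
have t0 : t != 0 by apply: contraNneq d0 => t0; rewrite -et t0 expr0n.
have ek x0 : x0 = t * (x0 / t) by rewrite mulrC divfK.
have d1 : (p / t) * (s / t) - (q / t) * (r / t) = 1.
  have -> : (p / t) * (s / t) - (q / t) * (r / t) = (p * s - q * r) / t ^+ 2 by field.
  by rewrite et divff.
rewrite (ek p) (ek q) (ek r) (ek s) cj_scale; apply: rv_scale; first exact: expf_neq0.
pose f : 'M[algC]_2 := \matrix_(i < 2, j < 2) (if i == 0 then if j == 0 then p / t else q / t else if j == 0 then r / t else s / t).
have fd : \det f = 1 by rewrite det2 !mxE.
have := inv _ c f; rewrite !ev_rho unitfE => /(_ rc fd).
rewrite conj_coefsE !mxE /= => <-; apply: val.
by rewrite rhoc_cj d1 expr1n mul1r.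
Qed.

(** The normal form (X^2 - q mu XY - q Y^2, mu XY + Y^2): infinity is fixed with
    multiplier [mu], and 0 is critical. The critical points are 0 and -2/mu, and
    [pm] is invariant under the involution of [q] that exchanges them. *)
Definition nf (T : comNzRingType) (mu q : T) : 'I_6 -> T := mkc 1 (- (q * mu)) (- q) 0 mu 1.
Definition pm (T : comNzRingType) (mu q : T) : T := - mu ^+ 2 * q ^+ 2 + (2 * mu - 4) * q.

Section NF.
Variables (T : comNzRingType) (mu q : T).
Lemma rhoc_nf : rhoc (nf mu q) = 1.
Proof. rewrite /rhoc /jp /jq /jr /nf /mkc !(tnth_nth 0) /=; ring. Qed.
Lemma sg1_nf : sigma1_of (nf mu q) = mu * pm mu q + 2.
Proof. rewrite /sigma1_of /pm /nf /mkc !(tnth_nth 0) /=; ring. Qed.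
Lemma sg2_nf : sigma2_of (nf mu q) = mu ^+ 2 * pm mu q - mu ^+ 2 + 2 * mu + pm mu q.
Proof. rewrite /sigma2_of /pm /nf /mkc !(tnth_nth 0) /=; ring. Qed.
End NF.

Lemma cj_nf (K : fieldType) (mu q : K) : mu != 0 ->
  cj (-1) (- 2 / mu) 0 1 (nf mu q) = nf mu (- q - (4 - 2 * mu) / mu ^+ 2).
Proof.
move=> m0; apply/funext => i; rewrite /cj /nf /mkc !(tnth_nth 0) /=.
by case: i => [[|[|[|[|[|[|//]]]]]] hi] /=; field.
Qed.

Lemma coefs_ext (T : Type) (c d : 'I_6 -> T) : c 0 = d 0 -> c 1 = d 1 -> c 2 = d 2 -> c 3 = d 3 ->
  c 4 = d 4 -> c 5 = d 5 -> c = d.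
Proof.
move=> e0 e1 e2 e3 e4 e5; apply/funext => -[[|[|[|[|[|[|//]]]]]] hi].
- by rewrite (_ : Ordinal hi = 0) //; exact/val_inj.
- by rewrite (_ : Ordinal hi = 1) //; exact/val_inj.
- by rewrite (_ : Ordinal hi = 2) //; exact/val_inj.
- by rewrite (_ : Ordinal hi = 3) //; exact/val_inj.
- by rewrite (_ : Ordinal hi = 4) //; exact/val_inj.
- by rewrite (_ : Ordinal hi = 5) //; exact/val_inj.
Qed.

(** If infinity is fixed with nonzero multiplier, an affine change of coordinate
    moves a critical point to 0; scaling it makes the coefficients of X^2 and of
    Y^2 in the two forms equal. *)
Lemma affine_nf (c : 'I_6 -> algC) : rhoc c != 0 -> c 3 = 0 -> c 4 != 0 ->
  exists e u k q, [/\ c 0 != 0, e != 0, k != 0 & cj e u 0 1 c = (fun i => k * nf (c 4 / c 0) q i)].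
Proof.
move=> hr b0 b1.
have a0 : c 0 != 0.
  by apply: contra hr => /eqP z; rewrite /rhoc /jp /jq z b0 !(mul0r, mulr0, subrr, expr0n).
(* [e] is chosen such that the resultant of the conjugate is (a0' b2')^2, so that
   a1' b2' - a2' b1' = 0, which says that 0 is critical; [u] is chosen such that
   b2' = a0'. *)
have [e ee] : exists e, e ^+ 2 = rhoc c / c 0 ^+ 4 by exists (sqrtC (rhoc c / c 0 ^+ 4)); rewrite sqrtCK.
have e0 : e != 0.
  have e2 : e ^+ 2 != 0 by rewrite ee mulf_neq0 // invr_neq0 // expf_neq0.
  by apply: contraNneq e2 => ->; rewrite expr0n.
pose u := (c 0 * e - c 5) / c 4.
pose c' := cj e u 0 1 c.
have h0 : c' 0 = c 0 * e ^+ 2 by rewrite /c' /cj /mkc !(tnth_nth 0) /= b0; ring.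
have h3 : c' 3 = 0 by rewrite /c' /cj /mkc !(tnth_nth 0) /= b0; ring.
have h4 : c' 4 = c 4 * e ^+ 2 by rewrite /c' /cj /mkc !(tnth_nth 0) /= b0; ring.
have h5 : c' 5 = c 0 * e ^+ 2.
  by rewrite /c' /cj /mkc !(tnth_nth 0) /= b0 /u; field.
have hrho : rhoc c' = c 0 ^+ 4 * e ^+ 8.
  have -> : e ^+ 8 = e ^+ 6 * e ^+ 2 by ring.
  by rewrite /c' rhoc_cj mulr1 mulr0 subr0 ee; field.
have hj : jr c' = 0.
  have : jq c' * jr c' = 0.
    have -> : jq c' * jr c' = jp c' ^+ 2 - rhoc c' by rewrite /rhoc; ring.
    by rewrite hrho /jp h0 h3 h5; ring.
  move=> /eqP; rewrite mulf_eq0 => /orP[|/eqP //].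
  have e2 : e ^+ 2 != 0 by exact: expf_neq0.
  by rewrite /jq h0 h3 h4 mulr0 subr0 (negbTE (mulf_neq0 (mulf_neq0 a0 e2) (mulf_neq0 b1 e2))).
exists e, u, (c 0 * e ^+ 2), (- c' 2 / (c 0 * e ^+ 2)); split => //.
  by rewrite mulf_neq0 // expf_neq0.
rewrite -/c'; have h1 : c' 1 = c' 2 * c 4 / c 0.
  have k0 : c 0 * e ^+ 2 != 0 by rewrite mulf_neq0 // expf_neq0.
  move/eqP: hj; rewrite /jr subr_eq0 h5 h4 => /eqP hj; apply: (mulIf k0); rewrite hj; by field.
apply: coefs_ext; rewrite /nf /mkc !(tnth_nth 0) /= ?h0 ?h1 ?h3 ?h4 ?h5.
- by rewrite mulr1.
- by field; rewrite a0 e0.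
- by field; rewrite a0 e0.
- by rewrite mulr0.
- by field.
- by rewrite mulr1.
Qed.

(** A map with a fixed point [z] of nonzero multiplier is conjugate to a
    multiple of a normal form, as far as invariants can see. *)
Lemma fixed_nf (c : 'I_6 -> algC) z : rhoc c != 0 -> qb c (z, 1) != 0 ->
  qa c (z, 1) = z * qb c (z, 1) -> jac c (z, 1) != 0 ->
  exists q, forall x, SL2_invariant x ->
   exists2 a, rv c x a & rv (nf (jac c (z, 1) / qb c (z, 1) ^+ 2) q) x a.
Proof.
move=> hr Q0 fz J0; pose c' := cj z (-1) 1 0 c.
have d1 : z * 0 - (-1) * 1 = 1 by rewrite mulr0 mulr1 opprK add0r.
have hr' : rhoc c' != 0 by rewrite rhoc_cj d1 expr1n mul1r.
have h0 : c' 0 = qb c (z, 1) by rewrite /c' /cj /mkc !(tnth_nth 0) /qb /=; ring.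
have h3 : c' 3 = 0.
  have -> : c' 3 = z * qb c (z, 1) - qa c (z, 1) by rewrite /c' /cj /mkc !(tnth_nth 0) /qb /qa /=; ring.
  by rewrite fz subrr.
have hJ : jac c (z, 1) = c' 0 * c' 4.
  have ea : mob z (-1) 1 0 (1, 0) = (z, 1) by rewrite /mob /=; congr (_, _); ring.
  have := jac_cj z (-1) 1 0 c (1, 0); rewrite d1 expr1n mul1r ea => <-.
  by rewrite -/c' /jac /jq h3 /= mulr0; ring.
have h4 : c' 4 != 0 by apply: contraNneq J0; rewrite hJ => ->; rewrite mulr0.
have [e [u [k [q [a0 e0 k0 eq]]]]] := affine_nf hr' h3 h4.
exists q => x hx; rewrite hJ -h0.
have -> : c' 0 * c' 4 / c' 0 ^+ 2 = c' 4 / c' 0 by field.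
have d2 : z * 0 - (-1) * 1 != 0 by rewrite d1 oner_neq0.
have d3 : e * 1 - u * 0 != 0 by rewrite mulr1 mulr0 subr0.
have [a ra ra'] := inv_rv hx hr d2; have [b rb] := inv_rv hx hr' d3.
rewrite (rv_uniq rb ra') eq => rb'; exists a => //.
have ki : k^-1 != 0 by rewrite invr_neq0.
have := rv_scale ki rb'; congr (rv _ _ _); apply/funext => i.
by rewrite mulrA mulVf // mul1r.
Qed.

(** * Invariants on the family of normal forms *)
Local Notation ZX := {poly int}.
Local Notation ZXX := {poly {poly int}}.

Section Spec.
Variable K : comNzRingType.
(** Elements of Z[mu][q] (the outer variable is q): specialization of [mu], and
    evaluation. *)
Definition spec (mu : K) (h : ZXX) : {poly K} := map_poly (horner_eval mu \o map_poly intr) h.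
HB.instance Definition _ mu := GRing.RMorphism.copy (spec mu) (map_poly (horner_eval mu \o map_poly intr)).
Definition ev2 (mu q : K) (h : ZXX) : K := (spec mu h).[q].
HB.instance Definition _ mu q := GRing.RMorphism.copy (ev2 mu q) (horner_eval q \o spec mu).

Lemma specC mu a : spec mu a%:P = (map_poly intr a).[mu]%:P.
Proof. by rewrite /spec map_polyC. Qed.
Lemma specX mu : spec mu 'X = 'X.
Proof. by rewrite /spec map_polyX. Qed.
Lemma ev2C mu q a : ev2 mu q a%:P = (map_poly intr a).[mu].
Proof. by rewrite /ev2 specC hornerC. Qed.
Lemma ev2X mu q : ev2 mu q 'X = q.
Proof. by rewrite /ev2 specX hornerX. Qed.
Lemma ev2_comp mu q A P : ev2 mu q (A \Po P) = ev2 mu (ev2 mu q P) A.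
Proof.
elim/poly_ind: A => [|A a IH]; first by rewrite comp_poly0 !rmorph0.
by rewrite comp_polyD comp_polyM comp_polyX comp_polyC !rmorphD !rmorphM /= IH ev2X !ev2C.
Qed.
End Spec.

Lemma poly_eq_fun (p q : {poly algC}) : (forall x, p.[x] = q.[x]) -> p = q.
Proof.
move=> h; apply/eqP; rewrite -subr_eq0; apply/negPn/negP => d0.
have := @max_poly_roots _ (p - q) [seq i%:R | i <- iota 0 (size (p - q)%R)] d0.
rewrite size_map size_iota ltnn map_inj_uniq ?iota_uniq; last by move=> a b /eqP; rewrite eqr_nat => /eqP.
move=> /(_ _ isT) H; suff : false by []; apply: H.
by apply/allP => x _; rewrite rootE hornerD hornerN h subrr.
Qed.

Lemma intpoly_eq0 (a : ZX) : (forall mu : algC, mu != 0 -> mu != 2 -> (map_poly intr a).[mu] = 0) -> a = 0.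
Proof.
move=> h; apply/eqP/negPn/negP => a0.
have b0 : a * ('X * ('X - 2%:P)) != 0 by rewrite !mulf_neq0 ?polyX_eq0 ?polyXsubC_eq0.
have [t] := poly_nonroot b0; rewrite !hornerM hornerX hornerXsubC => ht.
have {ht} : [&& a.[t] != 0, t != 0 & t - 2 != 0] by move: ht; rewrite !mulf_eq0 !negb_or.
case/and3P=> ha ht ht2.
have := h t%:~R; rewrite intr_eq0 ht => /(_ isT).
rewrite -[X in _ != X](_ : 2%:~R = 2 :> algC) // eqr_int -subr_eq0 ht2 => /(_ isT).
by rewrite horner_map /= => /eqP; rewrite intr_eq0 (negbTE ha).
Qed.

(** mu^2 q + 4 - 2 mu, which vanishes at the image of q = 0 under the
    involution, and the invariant [pm]. *)
Definition lin_q : ZXX := ('X ^+ 2)%:P * 'X + (4%:P - 2%:P * 'X)%:P.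
Definition pm_poly : ZXX := - ('X * lin_q).

Lemma size_lin_q : size lin_q = 2%N.
Proof. by rewrite /lin_q size_MXaddC polyC_eq0 expf_eq0 /= polyX_eq0 /= size_polyC expf_eq0 polyX_eq0. Qed.
Lemma ev2_lin_q mu q : ev2 mu q lin_q = mu ^+ 2 * q + (4 - 2 * mu) :> algC.
Proof.
have e4 : (map_poly intr (4%:P - 2%:P * 'X)).[mu] = 4 - 2 * mu.
  by rewrite rmorphB rmorphM /= !map_polyC map_polyX /= hornerD hornerN hornerM !hornerC hornerX.
have e2 : (map_poly intr ('X ^+ 2)).[mu] = mu ^+ 2 by rewrite rmorphXn /= map_polyX hornerXn.
by rewrite /lin_q rmorphD rmorphM /= !ev2C ev2X e4 e2.
Qed.
Lemma ev2_pm_poly mu q : ev2 mu q pm_poly = pm mu q :> algC.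
Proof. by rewrite /pm_poly rmorphN rmorphM /= ev2X ev2_lin_q /pm; ring. Qed.

Lemma divX_poly (g : ZXX) : (forall i, (g`_i).[0] = 0) -> exists g', g = 'X%:P * g'.
Proof.
move=> h; exists (\poly_(i < size g) drop_poly 1 g`_i).
apply/polyP => i; rewrite coefCM coef_poly; case: ltnP => hi; last by rewrite mulr0 nth_default.
apply/polyP => j; rewrite coefXM coef_drop_poly; case: j => [|j] /=; last by rewrite addn1.
by rewrite -horner_coef0.
Qed.

(** Gauss lemma for [lin_q], which is nonzero at mu = 0. *)
Lemma cancel_X m (h g : ZXX) : ('X ^+ m)%:P * h = g * lin_q -> exists g', h = g' * lin_q.
Proof.
elim: m h g => [|m IH] h g e; first by exists g; rewrite -e expr0 mul1r.
have [g' eg] : exists g', g = 'X%:P * g'.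
  apply: divX_poly => i.
  have := congr1 (map_poly (horner_eval 0)) e.
  have eL : map_poly (horner_eval 0) lin_q = 4%:P :> {poly int}.
    rewrite /lin_q rmorphD rmorphM /= !map_polyC /= map_polyX /horner_eval hornerXn expr0n polyC0 mul0r add0r.
    by rewrite hornerD hornerN hornerM !hornerC hornerX mulr0 subr0.
  have eX : map_poly (horner_eval 0) ('X ^+ m.+1)%:P = 0 :> {poly int}.
    by rewrite map_polyC /= /horner_eval hornerXn expr0n polyC0.
  rewrite !rmorphM /= eL eX mul0r => /esym /eqP; rewrite mulf_eq0.
  case/orP => [/eqP gz|]; first by have := congr1 (fun p : {poly int} => p`_i) gz; rewrite coef_map coef0.
  by rewrite polyC_eq0.
apply: (IH h g'); apply: (mulfI (x := 'X%:P)); first by rewrite polyC_eq0 polyX_eq0.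
by rewrite mulrA -polyCM -exprS e eg mulrA.
Qed.

Lemma div_lin_q (h : ZXX) : (forall mu q : algC, mu != 0 -> mu != 2 -> mu ^+ 2 * q + (4 - 2 * mu) = 0 -> ev2 mu q h = 0) ->
  exists g, h = g * lin_q.
Proof.
move=> H.
have e := Pdiv.Idomain.divp_eq h lin_q.
have sr : (size (h %% lin_q)%R <= 1)%N by rewrite -ltnS -size_lin_q ltn_modp -size_poly_eq0 size_lin_q.
have rE := size1_polyC sr.
have r0 : (h %% lin_q)`_0 = 0.
  apply: intpoly_eq0 => mu m0 m2.
  pose q := - (4 - 2 * mu) / mu ^+ 2.
  have hq : mu ^+ 2 * q + (4 - 2 * mu) = 0 by rewrite /q; field.
  have := congr1 (ev2 mu q) e; rewrite -mul_polyC rmorphD !rmorphM /= ev2_lin_q hq H // !mulr0 add0r.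
  by rewrite [in X in _ = X]rE ev2C => <-.
rewrite rE r0 polyC0 addr0 -mul_polyC lead_coefE size_lin_q in e.
have l2 : lin_q`_1 = 'X ^+ 2 by rewrite /lin_q coefD coefCM coefX coefC /= mulr1 addr0.
by rewrite /= l2 -exprM in e; exact: cancel_X e.
Qed.

(** The involution of [q], and the polynomials invariant under it. *)
Definition Smu (mu : algC) : {poly algC} := - 'X - ((4 - 2 * mu) / mu ^+ 2)%:P.
Definition sym_poly (h : ZXX) := forall mu : algC, mu != 0 -> spec mu h \Po Smu mu = spec mu h.

Lemma spec_pm_poly (mu q : algC) : (spec mu pm_poly).[q] = pm mu q.
Proof. exact: ev2_pm_poly. Qed.

Lemma sym_pm_poly : sym_poly pm_poly.
Proof.
move=> mu m0; apply: poly_eq_fun => x; rewrite horner_comp !spec_pm_poly.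
have -> : (Smu mu).[x] = - x - (4 - 2 * mu) / mu ^+ 2.
  by rewrite /Smu hornerD !hornerN hornerX hornerC.
by rewrite /pm; field.
Qed.

Lemma pm_poly_neq0 (mu : algC) : mu != 0 -> spec mu pm_poly != 0.
Proof.
move=> m0; apply/eqP => z.
have := spec_pm_poly mu 1; have := spec_pm_poly mu (-1); rewrite z !horner0 => h1 h2.
have : - 2 * mu ^+ 2 = 0 by rewrite -[RHS]addr0 [X in _ = X + _]h1 [X in _ = _ + X]h2 /pm; ring.
by move/eqP; rewrite mulf_eq0 oppr_eq0 pnatr_eq0 expf_eq0 (negbTE m0).
Qed.

(** Invariant polynomials are polynomials in [pm_poly]: h - h(0) vanishes at q = 0,
    hence also on [lin_q], and is divisible by [pm_poly]; the quotient is invariant of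
    smaller degree. *)
Lemma sym_poly_comp (h : ZXX) : sym_poly h -> exists A : ZXX, h = A \Po pm_poly.
Proof.
elim: {h}(size h) {-2}h (leqnn (size h)) => [|n IH] h hn hs.
  by exists 0; move: hn; rewrite leqn0 size_poly_eq0 comp_poly0 => /eqP.
have eh : h = drop_poly 1 h * 'X + (h`_0)%:P.
  apply/polyP => i; rewrite coefD coefMX coefC coef_drop_poly.
  by case: i => [|i]; rewrite /= ?add0r ?addr0 ?addn1.
have [g eg] : exists g, drop_poly 1 h = g * lin_q.
  apply: div_lin_q => mu q m0 m2 hq.
  have q0 : q != 0.
    apply: contraNneq m2 => q0; rewrite q0 mulr0 add0r in hq.
    have : 2 * (2 - mu) = 0 by rewrite -[RHS]hq; ring.
    by move=> /eqP; rewrite mulf_eq0 pnatr_eq0 /= subr_eq0 eq_sym.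
  have e (x : algC) : ev2 mu x h = ev2 mu x (drop_poly 1 h) * x + (map_poly intr h`_0).[mu].
    by rewrite {1}eh rmorphD rmorphM /= ev2X ev2C.
  have es : ev2 mu q h = ev2 mu 0 h.
    rewrite /ev2 -[in LHS](hs _ m0) horner_comp; congr (_.[_]).
    rewrite /Smu hornerD !hornerN hornerX hornerC.
    have -> : 4 - 2 * mu = - (mu ^+ 2 * q) by apply/eqP; rewrite -addr_eq0 addrC hq.
    by field.
  move: es; rewrite !e mulr0 add0r => /eqP; rewrite -subr_eq0 addrK mulf_eq0 (negbTE q0) orbF.
  by move/eqP.
have e2 : h = - g * pm_poly + (h`_0)%:P by rewrite {1}eh eg /pm_poly; ring.
have [|mu m0|A eA] := IH (- g).
- rewrite size_polyN; have [->|g0] := eqVneq g 0; first by rewrite size_poly0.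
  have l0 : lin_q != 0 by rewrite -size_poly_eq0 size_lin_q.
  have := size_mul g0 l0; rewrite -eg size_lin_q size_drop_poly addnC /= => es.
  have : (size h - 1 <= n)%N by rewrite leq_subLR add1n.
  by rewrite es add1n; exact: ltnW.
- have := hs mu m0; rewrite {1 2}e2 rmorphD rmorphM /= comp_polyD comp_polyM specC comp_polyC (sym_pm_poly m0).
  by move=> /addIr /mulIf; apply; exact: pm_poly_neq0.
exists (A * 'X + (h`_0)%:P).
by rewrite comp_polyD comp_polyM comp_polyX comp_polyC -eA.
Qed.

Lemma comp_nf (T S : comNzRingType) (f : {rmorphism T -> S}) mu q : f \o nf mu q = nf (f mu) (f q).
Proof.
apply: coefs_ext; rewrite /nf /mkc /= !(tnth_nth 0) /= ?rmorphN ?rmorphM ?rmorph1 ?rmorph0 //.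
Qed.

(** On normal forms an invariant function is a polynomial in [mu] and [pm]. *)
Lemma inv_nf (x : FracA2) : SL2_invariant x -> exists A : ZXX, forall mu q : algC, mu != 0 ->
  rv (nf mu q) x (ev2 mu (pm mu q) A).
Proof.
move=> hx; have [k [N [hN xE _]]] := hx.
pose h : ZXX := eval_coefs (nf 'X%:P 'X) N.
have hE (mu q : algC) : ev2 mu q h = eval_coefs (nf mu q) N.
  rewrite /h rm_ev; congr (eval_coefs _ N).
  by rewrite comp_nf /= ev2X ev2C map_polyX hornerX.
rewrite msize_rho mulnC in hN.
have val (mu q : algC) : rv (nf mu q) x (ev2 mu q h).
  rewrite hE xE -tofracXn.
  have := @rv_div _ (nf mu q) _ _ _ hN (homogX k rho_homog).
  by rewrite evXn ev_rho rhoc_nf expr1n divr1; apply; exact: oner_neq0.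
have [|A eA] := @sym_poly_comp h.
  move=> mu m0; apply: poly_eq_fun => q; rewrite horner_comp.
  have -> : (Smu mu).[q] = - q - (4 - 2 * mu) / mu ^+ 2.
    by rewrite /Smu hornerD !hornerN hornerX hornerC.
  have hr : rhoc (nf mu q) != 0 by rewrite rhoc_nf oner_neq0.
  have d0 : -1 * 1 - (- 2 / mu) * 0 != 0 by rewrite mulr0 subr0 mulr1 oppr_eq0 oner_neq0.
  have [a ra] := inv_rv hx hr d0; rewrite cj_nf // => ra'.
  by have := rv_uniq (val mu q) ra; have := rv_uniq (val mu _) ra'; rewrite /ev2 => -> ->.
by exists A => mu q m0; rewrite -ev2_pm_poly -ev2_comp -eA.
Qed.

(** * Polynomiality of the invariants *)
Section Reduce.
Variables (U K : comNzRingType) (e : K -> K -> {rmorphism U -> K}) (s1 s2 : U).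
Hypothesis e1 : forall m p, e m p s1 = m * p + 2.
Hypothesis e2 : forall m p, e m p s2 = m ^+ 2 * p - m ^+ 2 + 2 * m + p.

(** [F] is a combination of 1, m, m^2 with coefficients in the ring generated by
    sigma_1 = m p + 2 and sigma_2 = m^2 p - m^2 + 2 m + p. *)
Definition Rep (F : K -> K -> K) := exists c0 c1 c2 : U,
  forall m p, F m p = e m p c0 + e m p c1 * m + e m p c2 * m ^+ 2.

Lemma RepD F G : Rep F -> Rep G -> Rep (fun m p => F m p + G m p).
Proof.
move=> [a0 [a1 [a2 ha]]] [b0 [b1 [b2 hb]]]; exists (a0 + b0), (a1 + b1), (a2 + b2) => m p.
by rewrite ha hb !rmorphD /=; ring.
Qed.
Lemma Rep_int (k : int) : Rep (fun _ _ => k%:~R).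
Proof. by exists k%:~R, 0, 0 => m p; rewrite rmorph_int !rmorph0 !mul0r !addr0. Qed.
Lemma Rep_scale u F : Rep F -> Rep (fun m p => e m p u * F m p).
Proof.
move=> [a0 [a1 [a2 ha]]]; exists (u * a0), (u * a1), (u * a2) => m p.
by rewrite ha !rmorphM /=; ring.
Qed.
(* m^3 = sigma_1 m^2 - sigma_2 m + sigma_1 - 2. *)
Lemma Rep_mu F : Rep F -> Rep (fun m p => F m p * m).
Proof.
move=> [a0 [a1 [a2 ha]]]; exists (a2 * (s1 - 2)), (a0 - a2 * s2), (a1 + a2 * s1) => m p.
by rewrite ha !rmorphD /= !rmorphN !rmorphM /= rmorphB rmorph_nat e1 e2; ring.
Qed.
(* p = sigma_2 - sigma_1 m + m^2. *)
Lemma Rep_p F : Rep F -> Rep (fun m p => F m p * p).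
Proof.
move=> hF; have h1 := Rep_scale (- s1) (Rep_mu hF); have h2 := Rep_scale s2 hF.
have [c0 [c1 [c2 h]]] := RepD h2 (RepD h1 (Rep_mu (Rep_mu hF))).
by exists c0, c1, c2 => m p; rewrite -h rmorphN /= e1 e2; ring.
Qed.
Lemma Rep_ext F G : (forall m p, F m p = G m p) -> Rep F -> Rep G.
Proof. by move=> h [a0 [a1 [a2 ha]]]; exists a0, a1, a2 => m p; rewrite -h. Qed.

Lemma Rep_ev2 (A : ZXX) : Rep (fun m p => ev2 m p A).
Proof.
have Ra (a : {poly int}) : Rep (fun m _ => (map_poly intr a).[m]).
  elim/poly_ind: a => [|a k IH].
    by apply: Rep_ext (Rep_int 0) => m _; rewrite [in RHS]rmorph0 horner0.
  apply: Rep_ext (RepD (Rep_mu IH) (Rep_int k)) => m _.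
  by rewrite rmorphD rmorphM /= map_polyX map_polyC hornerMXaddC.
elim/poly_ind: A => [|A a IH].
  by apply: Rep_ext (Rep_int 0) => m p; rewrite [in RHS]rmorph0.
apply: Rep_ext (RepD (Rep_p IH) (Ra a)) => m p.
by rewrite rmorphD rmorphM /= ev2X ev2C.
Qed.
End Reduce.

Lemma quad3 (K : fieldType) (a b d x y z : K) : x != y -> x != z -> y != z ->
  a + b * x + d * x ^+ 2 = 0 -> a + b * y + d * y ^+ 2 = 0 -> a + b * z + d * z ^+ 2 = 0 -> a = 0.
Proof.
move=> xy xz yz hx hy hz.
have h1 : b + d * (x + y) = 0.
  have xy0 : x - y != 0 by rewrite subr_eq0.
  by apply: (mulIf xy0); rewrite mul0r -[RHS](subrr 0) -{1}hx -hy; ring.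
have h2 : b + d * (x + z) = 0.
  have xz0 : x - z != 0 by rewrite subr_eq0.
  by apply: (mulIf xz0); rewrite mul0r -[RHS](subrr 0) -{1}hx -hz; ring.
have d0 : d = 0.
  have yz0 : y - z != 0 by rewrite subr_eq0.
  by apply: (mulIf yz0); rewrite mul0r -[RHS](subrr 0) -{1}h1 -h2; ring.
have b0 : b = 0 by rewrite -h1 d0 mul0r addr0.
by rewrite -hx b0 d0 !mul0r !addr0.
Qed.

Lemma rv_int (c : 'I_6 -> algC) (k : int) : rv c k%:~R k%:~R.
Proof. by case: k => k; rewrite ?NegzE ?rmorphN; [exact: rv_nat | apply: rvN; exact: rv_nat]. Qed.

Lemma rv_mmap (c : 'I_6 -> algC) (v : 'I_2 -> FracA2) a b (P : {mpoly int[2]}) :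
  rv c (v 0) a -> rv c (v 1) b -> rv c (mmap intr v P) (evn (pt2 a b) P).
Proof.
move=> h0 h1; rewrite /evn /mmap; apply: rv_sum => m; apply: rvM; first exact: rv_int.
rewrite /mmap1 !big_ord_recl !big_ord0 !mulr1; apply: rvM; apply: rvX => //.
by rewrite (_ : lift ord0 ord0 = 1) //; exact/val_inj.
Qed.

(** The discriminant of T^3 - sigma_1 T^2 + sigma_2 T - sigma_3, times sigma_3,
    homogenized by sigma_1 = S1/R, sigma_2 = S2/R, sigma_3 = sigma_1 - 2. *)
Definition disc3 (T : comNzRingType) (S1 S2 R : T) : T :=
  (S1 ^+ 2 * S2 ^+ 2 - 4 * S2 ^+ 3 * R - 4 * S1 ^+ 3 * (S1 - 2 * R)
   + 18 * S1 * S2 * (S1 - 2 * R) * R - 27 * (S1 - 2 * R) ^+ 2 * R ^+ 2) * (S1 - 2 * R).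

Lemma rm_disc3 (T S : comNzRingType) (f : {rmorphism T -> S}) a b d :
  f (disc3 a b d) = disc3 (f a) (f b) (f d).
Proof.
have fM x y : f (x * y) = f x * f y by exact: rmorphM.
have fX x k : f (x ^+ k) = f x ^+ k by exact: rmorphXn.
have fD x y : f (x + y) = f x + f y by exact: rmorphD.
have fN x : f (- x) = - f x by exact: rmorphN.
have fn k : f k%:R = k%:R by exact: rmorph_nat.
by rewrite /disc3 !(fD, fN, fM, fX, fn).
Qed.

Definition sigma_disc : A2 := disc3 sigma1_num sigma2_num rho.

Lemma ev_sigma_disc (K : comNzRingType) (c : 'I_6 -> K) : eval_coefs c sigma_disc = disc3 (sigma1_of c) (sigma2_of c) (rhoc c).
Proof. by rewrite -ev_sigma1_num -ev_sigma2_num -ev_rho; exact: rm_disc3. Qed.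

Lemma sigma_disc_neq0 : sigma_disc != 0.
Proof.
have h : eval_coefs (nf 2 1 : 'I_6 -> algC) sigma_disc != 0.
  (* The multipliers at the fixed points are 2 and - 4 +- 2 sqrt 5. *)
  rewrite ev_sigma_disc sg1_nf sg2_nf rhoc_nf /pm /disc3.
  set u := (X in X != 0); have -> : u = - (2 ^+ 15 * 5) by rewrite /u; ring.
  by rewrite oppr_eq0 mulf_neq0 ?expf_neq0 ?pnatr_eq0.
by apply: contraNneq h => ->; rewrite rmorph0.
Qed.

(** At a generic point the three multipliers at the fixed points are distinct and
    nonzero, and a polynomial of degree at most 2 that takes the same value at
    all of them is constant. *)
Lemma invariant_poly x : SL2_invariant x -> in_Z_sigma12 x.
Proof.
move=> hx; have [A hA] := inv_nf hx.
pose vs (m p : algC) := pt2 (m * p + 2) (m ^+ 2 * p - m ^+ 2 + 2 * m + p).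
pose e (m p : algC) : {rmorphism {mpoly int[2]} -> algC} := GRing.RMorphism.clone _ _ (evn (vs m p)) _.
have [||c0 [c1 [c2 hc]]] := @Rep_ev2 _ _ e 'X_0 'X_1 _ _ A.
- by move=> m p; rewrite /= evnX.
- by move=> m p; rewrite /= evnX.
have {}hc m p : ev2 m p A = evn (vs m p) c0 + evn (vs m p) c1 * m + evn (vs m p) c2 * m ^+ 2 by exact: hc.
exists c0; have [g [_ [_ [g0 _ _ _ H]]]] := charpoly_exists (ltn0Sn 0).
apply: (rv_dense (mulf_neq0 rho_neq0 (mulf_neq0 g0 sigma_disc_neq0))) => c.
rewrite (evM c rho) (evM c g sigma_disc) ev_rho mulf_eq0 negb_or mulf_eq0 negb_or => /and3P[rc gc dc].
have [rs hrs _] := H c rc gc.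
have [x1 [x2 [x3 [rsE e0 e1 e2]]]] := good1_fixed rc hrs.
have [l1 l2 l3] := milnor_formulas e0 e1 e2 rc.
have er := rho_fix e0 e1 e2.
set S1 := sigma1_of c / rhoc c; set S2 := sigma2_of c / rhoc c.
pose lam z := jac c (z, 1) / qb c (z, 1) ^+ 2.
rewrite -/(lam x1) -/(lam x2) -/(lam x3) -/S1 -/S2 in l1 l2 l3.
have rv1 : rv c (sigma 1 1) S1 by rewrite sigma1E.1; exact: (rv_milnor_s 1 rc).
have rv2 : rv c (sigma 1 2) S2 by rewrite sigma1E.2; exact: (rv_milnor_s 2 rc).
have inv i : (i <= 2)%N -> SL2_invariant (milnor_s i).
  by move=> hi; apply: (sigma_SL2 (ltn0Sn 0) milnor_s_is_sigma); rewrite nu1; exact: leqW.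
have d1 : (1 : algC) * 1 - 0 * 0 != 0 by rewrite mulr1 mulr0 subr0 oner_neq0.
have [a ha _] := inv_rv hx rc d1.
have key z : qb c (z, 1) != 0 -> qa c (z, 1) = z * qb c (z, 1) -> lam z != 0 ->
    (evn (pt2 S1 S2) c0 - a) + evn (pt2 S1 S2) c1 * lam z + evn (pt2 S1 S2) c2 * lam z ^+ 2 = 0.
  move=> Q0 fz lz.
  have J0 : jac c (z, 1) != 0 by apply: contraNneq lz; rewrite /lam => ->; rewrite mul0r.
  have [q hq] := fixed_nf rc Q0 fz J0; rewrite -/(lam z) in hq.
  have rn : rhoc (nf (lam z) q) != 0 by rewrite rhoc_nf oner_neq0.
  have ea : a = ev2 (lam z) (pm (lam z) q) A.
    by have [b rb rb'] := hq _ hx; rewrite (rv_uniq ha rb) (rv_uniq rb' (hA _ _ lz)).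
  have es1 : S1 = lam z * pm (lam z) q + 2.
    have [b rb rb'] := hq _ (inv 1%N isT); rewrite (_ : S1 = b); last exact: (rv_uniq (rv_milnor_s 1 rc) rb).
    by rewrite (rv_uniq rb' (rv_milnor_s 1 rn)) /= rhoc_nf divr1 sg1_nf.
  have es2 : S2 = lam z ^+ 2 * pm (lam z) q - lam z ^+ 2 + 2 * lam z + pm (lam z) q.
    have [b rb rb'] := hq _ (inv 2%N isT); rewrite (_ : S2 = b); last exact: (rv_uniq (rv_milnor_s 2 rc) rb).
    by rewrite (rv_uniq rb' (rv_milnor_s 2 rn)) /= rhoc_nf divr1 sg2_nf.
  by rewrite ea hc /vs -es1 -es2; ring.
have dE : eval_coefs c sigma_disc = rhoc c ^+ 5 * ((lam x1 - lam x2) * (lam x1 - lam x3) * (lam x2 - lam x3)) ^+ 2 * (lam x1 * lam x2 * lam x3).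
  have h1 : sigma1_of c = rhoc c * S1 by rewrite /S1 mulrC divfK.
  have h2 : sigma2_of c = rhoc c * S2 by rewrite /S2 mulrC divfK.
  have h3 : sigma1_of c - 2 * rhoc c = rhoc c * (S1 - 2) by rewrite h1; ring.
  rewrite ev_sigma_disc /disc3 h3 h1 h2 -l3 -l2 -l1.
  by move: (rhoc c) (lam x1) (lam x2) (lam x3) => r u v w; ring.
move: dc; rewrite dE => /negP dc.
have [d12 d13 d23 l0] : [/\ lam x1 != lam x2, lam x1 != lam x3, lam x2 != lam x3 & lam x1 * lam x2 * lam x3 != 0].
  by split; apply/negP => /eqP z; apply: dc; rewrite z ?subrr ?(mul0r, mulr0, expr0n).
move: rc; rewrite er !mulf_eq0 !negb_or -!andbA => /and4P[b0 Q1 Q2 Q3].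
have [l01 l02 l03] : [/\ lam x1 != 0, lam x2 != 0 & lam x3 != 0].
  by split; apply: contraNneq l0 => ->; rewrite ?(mul0r, mulr0).
have fz z : (z - x1) * (z - x2) * (z - x3) = 0 -> qa c (z, 1) = z * qb c (z, 1).
  move=> hz; apply/eqP; rewrite -subr_eq0 -[X in _ == X](mulr0 (- c 3)) -hz /qa /qb e0 e1 e2 /=.
  by move: (c 3) (c 4) (c 5) => u v w; apply/eqP; ring.
have k1 := key _ Q1 (fz x1 _) l01; have k2 := key _ Q2 (fz x2 _) l02; have k3 := key _ Q3 (fz x3 _) l03.
have e' : evn (pt2 S1 S2) c0 - a = 0.
  by apply: (quad3 d12 d13 d23 (k1 _) (k2 _) (k3 _)); rewrite subrr ?(mul0r, mulr0).
move/eqP: e'; rewrite subr_eq0 => /eqP ea.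
by exists a => //; rewrite -ea; exact: rv_mmap.
Qed.

Theorem corollary1p6 :
  (forall x : FracA2, SL2_invariant x -> in_Z_sigma12 x) /\
  (forall n i : nat, (1 <= n)%N -> (1 <= i)%N -> i%:Z <= nu n ->
     SL2_invariant (sigma n i) /\ in_Z_sigma12 (sigma n i)).
Proof.
split; first exact: invariant_poly.
move=> n i n0 _ hi; have h := sigma_invariant n0 hi.
by split; last exact: invariant_poly.
Qed.
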